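(* For $(p,p')=(5,11)$ (level $N=1/5$) and $r\in\{0,1,2,3,4\}$, \begin{align*} (q)_{\infty}^3\,\mathcal{C}_{0,2r}^{1/5}(q) &=-q^{r^2-3r+1}J_{1,2}\,j(q^{4+8r};q^{22})\\ &\quad -q^{6-4r} \left ( j(-q^{16+10r};q^{110})-q^{4+8r}j(-q^{6-10r};q^{110})\right )\cdot q\,\phi_{10}(-q) \\ &\quad +q^{3-3r}\left ( j(-q^{27+10r};q^{110})-q^{3+6r}j(-q^{17-10r};q^{110})\right )\cdot \chi_{10}(q^2) \\ &\quad -q^{1-2r}\left ( j(-q^{38+10r};q^{110})-q^{2+4r}j(-q^{28-10r};q^{110})\right )\cdot \left ( -\psi_{10}(-q)\right ) \\ &\quad +q^{-r}\left ( j(-q^{49+10r};q^{110})-q^{1+2r}j(-q^{39-10r};q^{110})\right )\cdot X_{10}(q^2). \end{align*}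
   Context: Throughout $q=e^{2\pi i\tau}$ with $\operatorname{Im}\tau>0$, $q^{a}:=e^{2\pi i a\tau}$ for rational $a$, and $z=e^{2\pi i w}$, $z^{a}:=e^{2\pi i a w}$. Notation: $(x;q)_n=\prod_{i=0}^{n-1}(1-q^ix)$, $(q)_\infty=\prod_{n\ge1}(1-q^n)$, $j(x;q):=\sum_{n\in\mathbb{Z}}(-1)^nq^{n(n-1)/2}x^n$, $J_{a,b}:=j(q^a;q^b)$. Ramanujan's tenth-order mock theta functions are $$\phi_{10}(q)=\sum_{n\ge 0}\frac{q^{\binom{n+1}{2}}}{(q;q^2)_{n+1}},\quad \psi_{10}(q)=\sum_{n\ge 0}\frac{q^{\binom{n+2}{2}}}{(q;q^2)_{n+1}},\quad X_{10}(q)=\sum_{n\ge 0}\frac{(-1)^nq^{n^2}}{(-q;q)_{2n}},\quad \chi_{10}(q)=\sum_{n\ge 0}\frac{(-1)^nq^{(n+1)^2}}{(-q;q)_{2n+1}}.$$ Characters: for coprime integers $p\ge1$, $p'\ge 2$ put $N=p'/p-2$, and let $0\le\ell\le p'-2$. The character of the admissible irreducible highest weight $A_1^{(1)}$-module of level $N$ and spin $\ell$ is (Weyl–Kac formula) $$\chi_{\ell}^{N}(z;q)=\chi_{\ell}^{(p,p')}(z;q)=\frac{\Theta_{\ell+1,p'}(z;q^p)-\Theta_{-(\ell+1),p'}(z;q^p)}{\Theta_{1,2}(z;q)-\Theta_{-1,2}(z;q)},\qquad \Theta_{n,m}(z;q)=\sum_{k\in\mathbb{Z}+n/(2m)}q^{mk^2}z^{-mk}.$$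 It is holomorphic in the annulus $|q|<|z|<|q|^{-1}$. String functions: for $N\neq0$ and $m\in2\mathbb{Z}+\ell$, $C^N_{m,\ell}(q)$ is defined by the expansion in that annulus $$\chi_\ell^{N}(z;q)=\sum_{m\in2\mathbb{Z}+\ell}C_{m,\ell}^{N}(q)\,q^{\frac{m^2}{4N}}z^{-\frac m2},$$ and the normalized string function is $$\mathcal{C}_{m,\ell}^{N}(q):=q^{-s_{\lambda,\mu}}C_{m,\ell}^{N}(q),\qquad s_{\lambda,\mu}=-\frac18+\frac{p(\ell+1)^2}{4p'}-\frac{m^2}{4N}.$$ *)

(* Defs.v *)
From HB Require Import structures.
From mathcomp Require Import all_boot all_order all_algebra.
From mathcomp Require Import all_classical all_reals all_analysis.
From mathcomp Require Import complex.

Set Implicit Arguments.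
Unset Strict Implicit.
Unset Printing Implicit Defensive.

Import Order.TTheory GRing.Theory Num.Theory.
Import numFieldNormedType.Exports.

Local Open Scope classical_set_scope.
Local Open Scope ring_scope.
Local Open Scope complex_scope.

Section Series.
Variable R : realType.

(* R[i]^o is R[i] viewed as a normed module over itself: it carries the topology
   given by the modulus. *)
Definition csum (u : nat -> R[i]) : R[i] :=
  lim (series (u : nat -> R[i]^o) @ \oo).

Definition cprod (u : nat -> R[i]) : R[i] :=
  lim ((fun n => \prod_(i < n) u i : R[i]^o) @ \oo).

(* Negz n is the integer - (n + 1). *)
Definition zsum (f : int -> R[i]) : R[i] :=
  csum (fun n => f (Posz n)) + csum (fun n => f (Negz n)).

Definition has_zsum (f : int -> R[i]) (s : R[i]) : Prop :=
  exists a b : R[i]^o,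
    [/\ series ((fun n => f (Posz n)) : nat -> R[i]^o) @ \oo --> a,
        series ((fun n => f (Negz n)) : nat -> R[i]^o) @ \oo --> b
      & s = a + b].

End Series.

Section QSeries.
Variable R : realType.
Implicit Types (q x t w tau : R[i]).

Definition cexp x : R[i] :=
  (expR (complex.Re x))%:C * (cos (complex.Im x) +i* sin (complex.Im x)).

(* epow t a is exp (2 pi i a t): it stands for q^a when t = tau and for z^a when
   t = w, so that a fractional power is always attached to tau (or w), never to
   the bare number q (or z). *)
Definition epow t (a : rat) : R[i] := cexp ((2 * pi)%:C * 'i * ratr a * t).

Definition qpoch x q (n : nat) : R[i] := \prod_(i < n) (1 - q ^+ i * x).

Definition qinf q : R[i] := cprod (fun n => 1 - q ^+ n.+1).

(* The division of n (n - 1) by 2 is exact. *)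
Definition jtheta x q : R[i] :=
  zsum (fun n => (-1) ^ n * q ^ ((n * (n - 1)) %/ 2)%Z * x ^ n).

Definition Jtheta (a b : int) q : R[i] := jtheta (q ^ a) (q ^ b).

Definition phi10 q : R[i] :=
  csum (fun n => q ^+ 'C(n.+1, 2) / qpoch q (q ^+ 2) n.+1).

Definition psi10 q : R[i] :=
  csum (fun n => q ^+ 'C(n.+2, 2) / qpoch q (q ^+ 2) n.+1).

Definition X10 q : R[i] :=
  csum (fun n => (-1) ^+ n * q ^+ (n ^ 2) / qpoch (- q) q (2 * n)).

Definition chi10 q : R[i] :=
  csum (fun n => (-1) ^+ n * q ^+ (n.+1 ^ 2) / qpoch (- q) q (2 * n).+1).

End QSeries.

Section StringFunctions.
Variable R : realType.
Implicit Types (w tau : R[i]).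

(* Theta_{n,m}(z;q) with z = exp (2 pi i w) and q = exp (2 pi i tau); in this
   parametrization the base q^p is reached by replacing tau with p tau. *)
Definition Theta (n m : int) w tau : R[i] :=
  zsum (fun i =>
    let k : rat := i%:~R + n%:~R / (2 * m%:~R) in
    epow tau (m%:~R * k ^+ 2) * epow w (- (m%:~R * k))).

Definition chi_num (p p' l : nat) w tau : R[i] :=
  Theta l.+1%:Z p'%:Z w (p%:R * tau) - Theta (- l.+1%:Z) p'%:Z w (p%:R * tau).

Definition chi_den w tau : R[i] := Theta 1 2 w tau - Theta (-1) 2 w tau.

Definition chi (p p' l : nat) w tau : R[i] :=
  chi_num p p' l w tau / chi_den w tau.

Definition level (p p' : nat) : rat := p'%:R / p%:R - 2.

(* The singularities of the quotient chi in the annulus are removable; the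
   expansion is required only off the zeros of the denominator, where the quotient
   literally is the value of the character. By continuity of Laurent series this
   is the same as asking for the expansion in the whole annulus. *)
Definition string_expansion (p p' l : nat) tau (C : int -> R[i]) : Prop :=
  forall w, `|epow tau 1| < `|epow w 1| < `|epow tau 1|^-1 ->
    chi_den w tau != 0 ->
    has_zsum (fun k : int =>
        let m : int := 2 * k + l%:Z in
        C m * epow tau (m%:~R ^+ 2 / (4 * level p p')) * epow w (- m%:~R / 2))
      (chi p p' l w tau).

(* string_fun p p' l tau m is C_{m,l}^N(q) for m = l mod 2; at the other m the
   expansion puts no constraint and the value is meaningless. *)
Definition string_fun (p p' l : nat) tau : int -> R[i] :=
  xget (fun=> 0) [set C | string_expansion p p' l tau C].

Definition s_exponent (p p' l : nat) (m : int) : rat :=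
  - (1 / 8) + p%:R * l.+1%:R ^+ 2 / (4 * p'%:R)
    - m%:~R ^+ 2 / (4 * level p p').

Definition nstring_fun (p p' l : nat) (m : int) tau : R[i] :=
  epow tau (- s_exponent p p' l m) * string_fun p p' l tau m.

End StringFunctions.

(* Main.v *)
(** On |q| < |z| < 1 the reciprocal of j(z;q) has the Laurent expansion
    sum_i rho_i z^i / (q)_oo^3 with rho_i = sum_(n >= 0) (-1)^n q^(n(n+1)/2 + n i).
    Multiplying it by the numerator of the Weyl-Kac formula, and using that Laurent
    coefficients are unique, (q)_oo^3 C_(0,2r) becomes the double series
      S_r = sum_k q^(55 k^2 + 5 (2r+1) k) (rho_(11k+r) - rho_(-11k-r-1)).

    Let k_i(q) be the bounded sequence with k_0 = 1, k_1 = 2, k_(-i) = 2 - k_i and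
    k_i = 2 + q^(i-1) k_(i-2), and let K(x;q) = sum_i k_i x^i. Pairing k with the
    kernels (-1)^i q^(i(i-1)/2) / ((q)_(n-i) (q)_(n+i)) of the Bailey transform writes
    each of the four mock theta functions as a sum over i of k_i times a Gaussian. They
    are therefore coefficients of A(y^2) + y B(y^2), where A(t) and B(t) are constant
    multiples of K(t^2;q^4) j(-t;q^2) and K(t;-q) j(-q t;q^2). Both K(x;q) j(x;q) and
    certain products of two theta functions have coefficients obeying the recursion of
    the quintuple product, which determines them up to a constant; with the addition
    formula for theta functions this gives
      j(y;q) (A(y^2) + y B(y^2)) = J_(1,2) j(q y^2;q^2) j(-y^3;q).
    The coefficients c_N of A(y^2) + y B(y^2), suitably indexed, satisfy
    c_(N+10) = 2 + q^(N+5) c_N, and c_(-1), ..., c_(-4) are the mock theta functions.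
    Write c as an explicit particular solution plus a solution of the homogeneous
    recursion: in the coefficient of y^(1-r) of the product formula the former
    contributes S_r, the latter the theta multiples of the mock theta functions. *)

Require Import Defs.
From HB Require Import structures.
From mathcomp Require Import all_boot all_order all_algebra.
From mathcomp Require Import all_classical all_reals all_analysis.
From mathcomp Require Import complex ring lra zify.

Set Implicit Arguments.
Unset Strict Implicit.
Unset Printing Implicit Defensive.

Import Order.TTheory GRing.Theory Num.Theory.
Import numFieldNormedType.Exports.
Local Open Scope ring_scope.
Local Open Scope complex_scope.

(** Laurent coefficients are separated without contour integrals: averaging over dyadic roots of
    unity isolates one of them, and dominated convergence for unordered sums takes the limit. The
    domains of convergence shape the argument. k_i tends to 2 at plus infinity and decays
    geometrically at minus infinity, so K(x;q), like the reciprocal theta series, lives only on |q|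
    < |x| < 1. The product formula is therefore compared on one circle and turned at once into
    identities between coefficients. For the string function, the coefficients of the quotient are
    symmetric under i -> - i, hence decay on both sides and serve the whole annulus |q| < |z| <
    1/|q|. Origin of the constants: along a class s modulo 10 a homogeneous solution is c_s times
    the Gaussian q^(5 k^2 + s k), and the theta coefficient at 10 k contributes 50 k^2; the total 55
    k^2 gives the base q^110. The reflection c_N + c_(-N) = 2 makes the homogeneous part vanish on
    the classes 0 and 5 and pairs the other eight, so each of the four mock theta functions
    multiplies a difference of two theta functions. *)

Section Modulus.
Variable R : realType.
Local Notation C := R[i].
Implicit Types (x y : C) (u v : nat -> C).

(** The norm of [R[i]] takes its values in [R[i]], whose order is partial. This is the same modulus
    as an element of [R], where real arithmetic tactics apply. *)
Definition cabs x : R := complex.Re `|x|.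

Lemma cabsE x : `|x| = (cabs x)%:C.
Proof. by rewrite /cabs normc_def. Qed.

Lemma cabs_ge0 x : 0 <= cabs x.
Proof. by have := normr_ge0 x; rewrite cabsE ler0c. Qed.

Lemma cabs0 : cabs 0 = 0.
Proof. by apply: (@complexI R); rewrite -cabsE normr0. Qed.

Lemma cabs1 : cabs 1 = 1.
Proof. by apply: (@complexI R); rewrite -cabsE normr1. Qed.

Lemma cabsN x : cabs (- x) = cabs x.
Proof. by apply: (@complexI R); rewrite -!cabsE normrN. Qed.

Lemma cabsM x y : cabs (x * y) = cabs x * cabs y.
Proof. by apply: (@complexI R); rewrite rmorphM /= -!cabsE normrM. Qed.

Lemma cabsX x n : cabs (x ^+ n) = cabs x ^+ n.
Proof. by apply: (@complexI R); rewrite rmorphXn /= -!cabsE normrX. Qed.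

Lemma cabsV x : cabs x^-1 = (cabs x)^-1.
Proof. by apply: (@complexI R); rewrite fmorphV /= -!cabsE normfV. Qed.

Lemma cabsXz x (n : int) : cabs (x ^ n) = cabs x ^ n.
Proof. by case: n => n; rewrite ?NegzE -?exprnN -?exprnP ?cabsV cabsX. Qed.

Lemma cabsD x y : cabs (x + y) <= cabs x + cabs y.
Proof. by rewrite -lecR rmorphD /= -!cabsE ler_normD. Qed.

Lemma cabsB x y : cabs (x - y) <= cabs x + cabs y.
Proof. by rewrite -(cabsN y) cabsD. Qed.

Lemma cabsC x y : cabs (x - y) = cabs (y - x).
Proof. by rewrite -cabsN opprB. Qed.

Lemma cabs_eq0 x : (cabs x == 0) = (x == 0).
Proof. by rewrite -(normr_eq0 x) cabsE eq_complex /= eqxx andbT. Qed.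

Lemma cabs_gt0 x : (0 < cabs x) = (x != 0).
Proof. by rewrite lt_def cabs_ge0 andbT cabs_eq0. Qed.

Lemma cabs_real (a : R) : cabs a%:C = `|a|.
Proof. by rewrite /cabs normc_def /= expr0n addr0 sqrtr_sqr. Qed.

Lemma cabs_nat n : cabs n%:R = n%:R.
Proof.
by rewrite -(rmorph_nat (real_complex R)) cabs_real normr_nat.
Qed.

Lemma cabs_i : cabs 'i%C = 1.
Proof. by rewrite /cabs normc_def /= expr0n add0r expr1n sqrtr1. Qed.

Lemma cabs_signz (n : int) : cabs ((-1) ^ n) = 1.
Proof. by rewrite cabsXz cabsN cabs1 exp1rz. Qed.

Lemma cabs_sum (I : Type) (s : seq I) (f : I -> C) :
  cabs (\sum_(i <- s) f i) <= \sum_(i <- s) cabs (f i).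
Proof.
elim: s => [|a s IH]; first by rewrite !big_nil cabs0.
by rewrite !big_cons (le_trans (cabsD _ _)) // lerD2l.
Qed.

Lemma eq_cabs_small x y : (forall e : R, 0 < e -> cabs (x - y) < e) -> x = y.
Proof.
move=> h; apply/eqP; rewrite -subr_eq0 -cabs_eq0; apply/eqP.
apply/eqP; rewrite eq_le cabs_ge0 andbT leNgt; apply/negP => /h.
by rewrite ltxx.
Qed.

Definition clim u (l : C) : Prop :=
  forall e : R, 0 < e -> exists N, forall n, (N <= n)%N -> cabs (u n - l) < e.

(** A positive epsilon of [R[i]] has imaginary part zero, so testing real epsilons is enough. *)
Lemma climP u l : clim u l <-> ((u : nat -> C^o) @ \oo --> (l : C^o))%classic.
Proof.
split=> [h|/cvgrPdist_lt h].
- apply/cvgrPdist_lt => e e0; have e1 : 0 < complex.Re e.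
    by move: e0; rewrite ltcE => /andP[].
  have [N hN] := h _ e1; exists N => // n /= /hN hn.
  rewrite cabsE cabsC ltcE /=; move: e0; rewrite ltcE /= => /andP[-> _] /=.
  exact: hn.
- move=> e e0; have := h e%:C; rewrite ltcR => /(_ e0) [N _ hN]; exists N => n.
  by move=> /hN /=; rewrite cabsE ltcR cabsC.
Qed.

Lemma clim_lim u l : clim u l -> lim ((u : nat -> C^o) @ \oo)%classic = l.
Proof. by move/climP/cvg_lim; apply; exact: norm_hausdorff. Qed.

Lemma clim_unique u l l' : clim u l -> clim u l' -> l = l'.
Proof. by move=> /clim_lim <- /clim_lim <-. Qed.

Lemma climD u v l m : clim u l -> clim v m -> clim (fun n => u n + v n) (l + m).
Proof. by move=> /climP h /climP k; apply/climP; exact: (cvgD h k). Qed.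

Lemma clim_cst l : clim (fun=> l) l.
Proof. by move=> e e0; exists 0%N => n _; rewrite subrr cabs0. Qed.

Lemma climM u v l m : clim u l -> clim v m -> clim (fun n => u n * v n) (l * m).
Proof. by move=> /climP h /climP k; apply/climP; exact: (cvgM h k). Qed.

Lemma climV u l : l != 0 -> clim u l -> clim (fun n => (u n)^-1) l^-1.
Proof. by move=> l0 /climP h; apply/climP; exact: (cvgV l0 h). Qed.

Lemma clim_ext u v l : (forall n, u n = v n) -> clim u l -> clim v l.
Proof. by move=> h; rewrite (_ : u = v) //; apply/funext. Qed.

Lemma clim_sub u l (g : nat -> nat) :
  (forall n, (n <= g n)%N) -> clim u l -> clim (fun n => u (g n)) l.
Proof.
move=> gn h e /h [N hN]; exists N => n Nn; apply: hN.
exact: leq_trans Nn (gn n).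
Qed.

Lemma clim_squeeze u l (a : nat -> R) :
  (forall n, cabs (u n - l) <= a n) ->
  (forall e : R, 0 < e -> exists N, forall n, (N <= n)%N -> a n < e) -> clim u l.
Proof.
move=> h k e /k [N hN]; exists N => n /hN; exact: le_lt_trans.
Qed.

Lemma clim_cabs_le u l (B : R) : (forall n, cabs (u n) <= B) -> clim u l -> cabs l <= B.
Proof.
move=> h k; apply/ler_addgt0Pr => e /k [N /(_ N (leqnn _)) hN].
have := h N; have := cabsB (u N) (u N - l); rewrite subKr; lra.
Qed.

End Modulus.

(** * Absolutely summable families *)

(** Index sets carry no order: sums over [int] and [int * int] can then be reindexed by any
    bijection and exchanged, which is how the theta identities below are obtained. *)
Definition absum (R : realType) (I : choiceType) (f : I -> R[i]) : Prop :=
  exists M : R, forall s : seq I, uniq s -> \sum_(i <- s) cabs (f i) <= M.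

Definition hsum (R : realType) (I : choiceType) (f : I -> R[i]) (S : R[i]) : Prop :=
  forall e : R, 0 < e -> exists A : seq I, forall B : seq I,
    uniq B -> {subset A <= B} -> cabs (\sum_(i <- B) f i - S) < e.

(** Locked, so that unification never unfolds the choice. The default 0 is the value when there is
    no sum. *)
HB.lock Definition tsum (R : realType) (I : choiceType) (f : I -> R[i]) : R[i] :=
  xget 0 [set S | hsum f S]%classic.

Section Summation.
Variable R : realType.
Local Notation C := R[i].

Section Basic.
Variable I : choiceType.
Implicit Types (f g : I -> C).

Lemma hsum_unique f S S' : hsum f S -> hsum f S' -> S = S'.
Proof.
move=> h h'; apply: eq_cabs_small => e e0; have e2 : 0 < e / 2 by lra.
have [A hA] := h _ e2; have [A' hA'] := h' _ e2.
have uB := undup_uniq (A ++ A').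
have hB : {subset A <= undup (A ++ A')}.
  by move=> x; rewrite mem_undup mem_cat => ->.
have hB' : {subset A' <= undup (A ++ A')}.
  by move=> x; rewrite mem_undup mem_cat => ->; rewrite orbT.
have := hA _ uB hB; have := hA' _ uB hB'.
set T := \sum_(i <- _) _ => k k'.
have -> : S - S' = (T - S') - (T - S) by ring.
have := cabsB (T - S') (T - S); lra.
Qed.

Lemma tsumE f S : hsum f S -> tsum f = S.
Proof.
move=> h; rewrite tsum.unlock; apply: (hsum_unique _ h).
exact: (@xgetPex _ 0 [set S | hsum f S]%classic (ex_intro _ S h)). Qed.

Lemma hsumD f g S T : hsum f S -> hsum g T -> hsum (fun i => f i + g i) (S + T).
Proof.
move=> h h' e e0; have e2 : 0 < e / 2 by lra.
have [A hA] := h _ e2; have [A' hA'] := h' _ e2.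
exists (A ++ A') => B uB sB.
have k : cabs (\sum_(i <- B) f i - S) < e / 2.
  by apply: hA => // x xA; apply: sB; rewrite mem_cat xA.
have k' : cabs (\sum_(i <- B) g i - T) < e / 2.
  by apply: hA' => // x xA; apply: sB; rewrite mem_cat xA orbT.
rewrite big_split /= opprD addrACA.
have := cabsD (\sum_(i <- B) f i - S) (\sum_(i <- B) g i - T); lra.
Qed.

Lemma hsumZ a f S : hsum f S -> hsum (fun i => a * f i) (a * S).
Proof.
move=> h e e0; have a0 := cabs_ge0 a.
have e2 : 0 < e / (cabs a + 1) by rewrite divr_gt0 //; lra.
have [A hA] := h _ e2; exists A => B uB sB.
have := hA B uB sB; rewrite -mulr_sumr -mulrBr cabsM ltr_pdivlMr; last by lra.
have := cabs_ge0 (\sum_(i <- B) f i - S); nra.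
Qed.

Lemma eq_hsum f g S : f =1 g -> hsum f S -> hsum g S.
Proof. by move=> /funext ->. Qed.

Lemma le_asum f g : (forall i, cabs (f i) <= cabs (g i)) -> absum g -> absum f.
Proof.
move=> h [M hM]; exists M => s us; apply: le_trans (hM s us).
by apply: ler_sum => i _.
Qed.

Lemma absumD f g : absum f -> absum g -> absum (fun i => f i + g i).
Proof.
move=> [M hM] [N hN]; exists (M + N) => s us.
apply: (@le_trans _ _ (\sum_(i <- s) (cabs (f i) + cabs (g i)))).
  by apply: ler_sum => i _; exact: cabsD.
by rewrite big_split lerD //= ?hM ?hN.
Qed.

Lemma absumZ a f : absum f -> absum (fun i => a * f i).
Proof.
move=> [M hM]; exists (cabs a * M) => s us.
under eq_bigr do rewrite cabsM.
by rewrite -mulr_sumr ler_wpM2l ?cabs_ge0 ?hM.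
Qed.

Lemma absum_bdM f (b : I -> C) (B : R) :
  (forall i, cabs (b i) <= B) -> absum f -> absum (fun i => b i * f i).
Proof.
move=> hb af; apply: (@le_asum _ (fun i => B%:C * f i)); last exact: absumZ.
move=> i; rewrite !cabsM cabs_real ler_wpM2r ?cabs_ge0 //.
exact: le_trans (hb i) (ler_norm _).
Qed.

Lemma absum_ge0_hsum (f : I -> R) : (forall i, 0 <= f i) ->
  absum (fun i => (f i)%:C) -> exists S, hsum (fun i => (f i)%:C) S.
Proof.
move=> f0 [M hM].
pose E := [set x | exists2 s, uniq s & x = \sum_(i <- s) f i]%classic.
have hE : has_sup E.
  split; first by exists 0, [::]; rewrite ?big_nil.
  exists M => _ [s us ->]; apply: le_trans (hM s us).
  by apply: ler_sum => i _; rewrite cabs_real ler_norm.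
exists (sup E)%:C => e e0.
have [_ [A uA ->] hA] := sup_adherent e0 hE.
exists A => B uB sB.
have le1 : \sum_(i <- B) f i <= sup E by apply: sup_upper_bound => //; exists B.
have le2 : \sum_(i <- A) f i <= \sum_(i <- B) f i.
  rewrite [leRHS](bigID (mem A)) /= -[leLHS]addr0 lerD ?sumr_ge0 //.
  rewrite -[leRHS]big_filter le_eqVlt; apply/orP; left; apply/eqP; apply: perm_big.
  apply: uniq_perm => //; first exact: filter_uniq.
  by move=> x; rewrite mem_filter; case: (boolP (x \in A)) => // /sB ->.
rewrite -rmorph_sum -rmorphB cabs_real /= ler0_norm; lra.
Qed.

Lemma absum_hsum f : absum f -> exists S, hsum f S.
Proof.
move=> af.
(* [p] stands for the real or the imaginary part and [s] for a sign: the family is cut into four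
   nonnegative ones, each dominated by [cabs]. *)
have part (p : C -> R) (s : R) : (forall x, `|p x| <= cabs x) -> `|s| = 1 ->
    exists S, hsum (fun i => (Num.max (s * p (f i)) 0)%:C) S.
  move=> hp s1; apply: absum_ge0_hsum => [i|]; first by rewrite le_max lexx orbT.
  apply: le_asum af => i; apply: le_trans (hp (f i)).
  rewrite cabs_real.
  have : `|s * p (f i)| = `|p (f i)| by rewrite normrM s1 mul1r.
  by case: (leP (s * p (f i)) 0) => h <-; rewrite ?normr0.
have hre (x : C) : `|complex.Re x| <= cabs x.
  by have := normc_ge_Re x; rewrite cabsE lecR.
have him (x : C) : `|complex.Im x| <= cabs x.
  have := hre (x * 'i%C); rewrite ReiNIm normrN cabsM cabs_i; lra.
have n1 : `|1 : R| = 1 by rewrite normr1.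
have n2 : `|- 1 : R| = 1 by rewrite normrN1.
have [S1 h1] := part _ _ hre n1; have [S2 h2] := part _ _ hre n2.
have [S3 h3] := part _ _ him n1; have [S4 h4] := part _ _ him n2.
exists ((S1 + (-1) * S2) + 'i%C * (S3 + (-1) * S4)).
apply: eq_hsum (hsumD (hsumD h1 (hsumZ (-1) h2))
                      (hsumZ 'i%C (hsumD h3 (hsumZ (-1) h4)))) => i /=.
have mx (a : R) : (Num.max (1 * a) 0)%:C + (-1) * (Num.max (-1 * a) 0)%:C = a%:C.
  by rewrite mulN1r -rmorphB /= mul1r mulN1r; congr (_%:C); case: (leP a 0);
     case: (leP (- a) 0); lra.
by rewrite !mx -complexE.
Qed.

Lemma tsumP f : absum f -> hsum f (tsum f).
Proof. by move=> /absum_hsum [S h]; rewrite (tsumE h). Qed.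

Lemma eq_tsum f g : f =1 g -> tsum f = tsum g.
Proof. by move=> /funext ->. Qed.

Lemma eq_absum f g : f =1 g -> absum f -> absum g.
Proof. by move=> /funext ->. Qed.

Lemma tsumD f g : absum f -> absum g ->
  tsum (fun i => f i + g i) = tsum f + tsum g.
Proof. by move=> /tsumP h /tsumP k; apply/tsumE/hsumD. Qed.

Lemma tsumZ a f : absum f -> tsum (fun i => a * f i) = a * tsum f.
Proof. by move=> /tsumP h; apply/tsumE/hsumZ. Qed.

Lemma absumN f : absum f -> absum (fun i => - f i).
Proof. by move/(absumZ (-1)); apply: eq_absum => i; rewrite mulN1r. Qed.

Lemma tsumN f : absum f -> tsum (fun i => - f i) = - tsum f.
Proof. by move/(tsumZ (-1)); rewrite mulN1r => <-; apply: eq_tsum => i; rewrite mulN1r. Qed.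

Lemma absumB f g : absum f -> absum g -> absum (fun i => f i - g i).
Proof. by move=> af /absumN; exact: absumD. Qed.

Lemma tsumB f g : absum f -> absum g ->
  tsum (fun i => f i - g i) = tsum f - tsum g.
Proof. by move=> af ag; rewrite tsumD ?tsumN //; exact: absumN. Qed.

Lemma hsum_cabs_le f S (M : R) : hsum f S ->
  (forall s, uniq s -> \sum_(i <- s) cabs (f i) <= M) -> cabs S <= M.
Proof.
move=> h hM; apply/ler_addgt0Pr => e /h [A hA].
have := hA (undup A) (undup_uniq _); set T := \sum_(i <- _) _ => hT.
have {}hT : cabs (T - S) < e by apply: hT => x; rewrite mem_undup.
have k : cabs T <= M by apply: le_trans (cabs_sum _ _) (hM _ (undup_uniq _)).
have := cabsB T (T - S); rewrite subKr; lra.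
Qed.

Lemma tsum0 : tsum (fun _ : I => 0 : C) = 0 :> C.
Proof.
by apply: tsumE => e e0; exists [::] => B _ _; rewrite big1 // subrr cabs0.
Qed.

Lemma absum_fin f (s : seq I) : (forall i, i \notin s -> f i = 0) -> absum f.
Proof.
move=> fs; exists (\sum_(i <- undup s) cabs (f i)) => t ut.
rewrite (bigID (mem s)) /= [X in _ + X]big1 ?addr0; last first.
  by move=> i /fs ->; rewrite cabs0.
rewrite -big_filter [leRHS](bigID (mem t)) /= -[leLHS]addr0 lerD //.
  rewrite -[leRHS]big_filter le_eqVlt; apply/orP; left; apply/eqP; apply: perm_big.
  apply: uniq_perm; rewrite ?filter_uniq ?undup_uniq // => x.
  by rewrite !mem_filter mem_undup andbC.
by apply: sumr_ge0 => i _; exact: cabs_ge0.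
Qed.

Lemma tsum_fin f (s : seq I) : uniq s -> (forall i, i \notin s -> f i = 0) ->
  tsum f = \sum_(i <- s) f i.
Proof.
move=> us fs; apply: tsumE => e e0; exists s => B uB sB.
rewrite (bigID (mem s)) /= [X in _ + X - _]big1 ?addr0; last by move=> i /fs ->.
rewrite -big_filter (perm_big s) ?subrr ?cabs0 //.
apply: uniq_perm; rewrite ?filter_uniq // => x; rewrite mem_filter.
by case: (boolP (x \in s)) => // /sB ->.
Qed.

End Basic.

Section Reindex.
Variables (I J : choiceType) (h : J -> I).
Hypothesis hinj : injective h.
Implicit Types f : I -> C.

Lemma absum_comp f : absum f -> absum (f \o h).
Proof.
move=> [M hM]; exists M => s us.
by rewrite -(big_map h predT (fun i => cabs (f i))) hM ?map_inj_uniq.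
Qed.

(** A partial inverse of [h], chosen classically, to pull a finite list of [I] back to [J]. *)
Let pinv (i : I) : option J :=
  if pselect (exists j, h j = i) is left e then Some (projT1 (cid e)) else None.

Let pinvK : pcancel h pinv.
Proof.
move=> j; rewrite /pinv; case: pselect => [e|[]]; last by exists j.
by congr Some; apply: hinj; rewrite (projT2 (cid e)).
Qed.

Let pinvP i j : pinv i = Some j -> h j = i.
Proof. by rewrite /pinv; case: pselect => // e [<-]; rewrite (projT2 (cid e)). Qed.

Let pinvN i : pinv i = None -> forall j, h j != i.
Proof.
rewrite /pinv; case: pselect => // e _ j; apply/eqP => hj; by apply: e; exists j.
Qed.

Let big_pinv (V : nmodType) (f : I -> V) (B : seq I) :
  (forall i, (forall j, h j != i) -> f i = 0) ->
  \sum_(j <- pmap pinv B) f (h j) = \sum_(i <- B) f i.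
Proof.
move=> f0; elim: B => [|i B IH]; first by rewrite !big_nil.
rewrite big_cons /=; case E: (pinv i) => [j|] /=.
  by rewrite big_cons IH (pinvP E).
by rewrite IH f0 ?add0r //; exact: pinvN.
Qed.

Let uniq_pinv (B : seq I) : uniq B -> uniq (pmap pinv B).
Proof.
elim: B => //= i B IH /andP[iB uB]; case E: (pinv i) => [j|] /=; last exact: IH.
rewrite IH // andbT; apply: contra iB; rewrite mem_pmap => /mapP [i' i'B e].
by rewrite -(pinvP E) (pinvP (esym e)).
Qed.

Lemma hsum_inj f S : (forall i, (forall j, h j != i) -> f i = 0) ->
  hsum (f \o h) S -> hsum f S.
Proof.
move=> f0 hs e /hs [A hA]; exists (map h A) => B uB sB.
rewrite -(big_pinv _ f0); apply: hA; first exact: uniq_pinv.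
move=> j jA; rewrite mem_pmap -pinvK; apply: map_f.
by apply: sB; apply: map_f.
Qed.

Lemma absum_inj f : (forall i, (forall j, h j != i) -> f i = 0) ->
  absum (f \o h) -> absum f.
Proof.
move=> f0 [M hM]; exists M => s us.
rewrite -(@big_pinv _ (fun i => cabs (f i))); first by apply: hM; exact: uniq_pinv.
by move=> i /f0 ->; rewrite cabs0.
Qed.

Lemma tsum_inj f : (forall i, (forall j, h j != i) -> f i = 0) ->
  absum (f \o h) -> tsum f = tsum (f \o h).
Proof. by move=> f0 af; apply/tsumE/hsum_inj => //; exact: tsumP. Qed.

End Reindex.

(** The possible sums of both families form the same set, so [xget] returns the same value for both,
    the default included. *)
Lemma tsum_bij (I J : choiceType) (h : J -> I) (g : I -> J) (f : I -> C) :
  cancel h g -> cancel g h -> tsum f = tsum (f \o h).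
Proof.
move=> hg gh; have E : forall S, hsum f S <-> hsum (f \o h) S.
  move=> S; split=> k; last first.
    apply: (hsum_inj (can_inj hg)) k => i /(_ (g i)); by rewrite gh eqxx.
  apply: (hsum_inj (can_inj gh)); first by move=> j /(_ (h j)); rewrite hg eqxx.
  by apply: eq_hsum k => i /=; rewrite gh.
by rewrite tsum.unlock; congr xget; apply/seteqP; split=> S /=; apply E.
Qed.

Section Fubini.
Variables (I J : choiceType).
Implicit Types f : I * J -> C.

Lemma absum_slice f i : absum f -> absum (fun j => f (i, j)).
Proof. by move=> af; apply: (@absum_comp _ _ (pair i) _ f) => // j j' []. Qed.

Lemma hsum_pair f S : absum f -> hsum f S -> hsum (fun i => tsum (fun j => f (i, j))) S.
Proof.
move=> af h e e0; have e2 : 0 < e / 2 by lra.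
have [A hA] := h _ e2; exists (map fst A) => B uB sB.
(* Each row in [B] may contribute an error [d]; the total then stays within e / 2. *)
pose d := e / 2 / (size B).+1%:R.
have d0 : 0 < d by rewrite divr_gt0 // ltr0n.
have ex i : exists Ai : seq J, [/\ uniq Ai, forall j, (i, j) \in A -> j \in Ai &
    cabs (\sum_(j <- Ai) f (i, j) - tsum (fun j => f (i, j))) < d].
  have [Ai hAi] := tsumP (absum_slice i af) d0.
  exists (undup (Ai ++ map snd A)); split; first exact: undup_uniq.
    move=> j ijA; rewrite mem_undup mem_cat; apply/orP; right.
    exact: (map_f snd ijA).
  apply: hAi; first exact: undup_uniq.
  by move=> j jA; rewrite mem_undup mem_cat jA.
have {ex} [F hF] := choice ex.
have k : cabs (\sum_(x <- [seq (i, j) | i <- B, j <- F i]) f x - S) < e / 2.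
  apply: hA.
    apply: allpairs_uniq_dep => // [i _|[i j] [i' j'] _ _ [-> ->]//].
    by have [] := hF i.
  move=> [i j] ijA; apply/allpairsPdep; exists i, j; split => //.
    by apply: sB; exact: (map_f fst ijA).
  by have [_ /(_ _ ijA)] := hF i.
rewrite big_allpairs_dep in k.
have k' : cabs (\sum_(i <- B) (\sum_(j <- F i) f (i, j) - tsum (fun j => f (i, j)))) <= e / 2.
  apply: le_trans (cabs_sum _ _) _.
  apply: (@le_trans _ _ (\sum_(i <- B) d)).
    by apply: ler_sum => i _; have [_ _ /ltW] := hF i.
  rewrite big_const_seq count_predT iter_addr_0 -[d *+ _]mulr_natr /d.
  by rewrite mulrAC ler_pdivrMr ?ltr0n // ler_pM2l // ler_nat.
rewrite sumrB in k'.
set X := \sum_(i <- B) \sum_(j <- F i) _ in k k'.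
set Y := \sum_(i <- B) tsum _ in k' *.
have -> : Y - S = (X - S) - (X - Y) by ring.
have := cabsB (X - S) (X - Y); lra.
Qed.

Lemma tsum_pair f : absum f -> tsum f = tsum (fun i => tsum (fun j => f (i, j))).
Proof. by move=> af; apply/esym/tsumE/hsum_pair => //; exact: tsumP. Qed.

(** Any finite set of pairs lies in the rectangle of its projections, whose rows are bounded by
    [g]. *)
Lemma absum_pair f (g : I -> R) : absum (fun i => (g i)%:C) ->
  (forall i (s : seq J), uniq s -> \sum_(j <- s) cabs (f (i, j)) <= g i) -> absum f.
Proof.
move=> [M hM] h; exists M => s us.
pose A := undup (map fst s); pose B := undup (map snd s).
apply: (@le_trans _ _ (\sum_(x <- [seq (i, j) | i <- A, j <- B]) cabs (f x))).
  have uAB : uniq [seq (i, j) | i <- A, j <- B].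
    by apply: allpairs_uniq; rewrite ?undup_uniq // => -[? ?] [? ?] _ _ /= [-> ->].
  rewrite [leRHS](bigID (mem s)) /= -[leLHS]addr0 lerD //; last first.
    by apply: sumr_ge0 => i _; exact: cabs_ge0.
  rewrite -[leRHS]big_filter le_eqVlt; apply/orP; left; apply/eqP; apply: perm_big.
  apply: uniq_perm => //; first exact: filter_uniq.
  move=> [i j]; rewrite mem_filter; case: (boolP ((i, j) \in s)) => //= ijs.
  apply/esym/allpairsP; exists (i, j) => /=; rewrite !mem_undup; split => //.
    exact: (map_f fst ijs).
  exact: (map_f snd ijs).
rewrite big_allpairs; apply: le_trans (hM A (undup_uniq _)).
apply: ler_sum => i _; apply: le_trans (h i B (undup_uniq _)) _.
by rewrite cabs_real ler_norm.
Qed.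

Lemma absum_outer f : absum f -> absum (fun i => tsum (fun j => f (i, j))).
Proof.
move=> af; have [M hM] := af; exists M => B uB.
apply/ler_addgt0Pr => e e0.
pose d := e / (size B).+1%:R.
have d0 : 0 < d by rewrite divr_gt0 // ltr0n.
have ex i : exists Ai : seq J, uniq Ai /\
    cabs (\sum_(j <- Ai) f (i, j) - tsum (fun j => f (i, j))) < d.
  have [Ai hAi] := tsumP (absum_slice i af) d0.
  exists (undup Ai); split; first exact: undup_uniq.
  by apply: hAi; [exact: undup_uniq|move=> j; rewrite mem_undup].
have {ex} [F hF] := choice ex.
have uF : uniq [seq (i, j) | i <- B, j <- F i].
  apply: allpairs_uniq_dep => // [i _|[i j] [i' j'] _ _ [-> ->]//].
  by have [] := hF i.
have := hM _ uF; rewrite big_allpairs_dep => k.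
apply: (@le_trans _ _ (\sum_(i <- B) (\sum_(j <- F i) cabs (f (i, j)) + d))).
  apply: ler_sum => i _; have [_ hi] := hF i.
  set T := tsum _ in hi *; have := cabs_sum (F i) (fun j => f (i, j)).
  set X := \sum_(j <- F i) f _ in hi *.
  have := cabsB X (X - T); rewrite subKr; lra.
rewrite big_split lerD //= big_const_seq count_predT iter_addr_0 -[d *+ _]mulr_natr /d.
by rewrite mulrAC ler_pdivrMr ?ltr0n // ler_pM2l // ler_nat.
Qed.

Lemma absum_mul (f : I -> C) (g : J -> C) : absum f -> absum g ->
  absum (fun x : I * J => f x.1 * g x.2).
Proof.
move=> af [N hN]; apply: (@absum_pair _ (fun i => cabs (f i) * `|N|)).
  have [M hM] := af; exists (M * `|N|) => s us.
  under eq_bigr do rewrite cabs_real normrM normr_id ger0_norm ?cabs_ge0 //.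
  by rewrite -mulr_suml ler_wpM2r ?hM.
move=> i s us /=; under eq_bigr do rewrite cabsM.
rewrite -mulr_sumr ler_wpM2l ?cabs_ge0 //.
exact: le_trans (hN s us) (ler_norm _).
Qed.

Lemma tsum_mul (f : I -> C) (g : J -> C) : absum f -> absum g ->
  tsum f * tsum g = tsum (fun x : I * J => f x.1 * g x.2).
Proof.
move=> af ag; rewrite tsum_pair; last exact: absum_mul.
rewrite mulrC -tsumZ //; apply: eq_tsum => i /=.
by rewrite tsumZ // mulrC.
Qed.

End Fubini.

Lemma tsum_swap (I J : choiceType) (f : I * J -> C) : absum f ->
  tsum (fun i => tsum (fun j => f (i, j))) = tsum (fun j => tsum (fun i => f (i, j))).
Proof.
move=> af; rewrite -tsum_pair //.
pose sw (x : J * I) := (x.2, x.1); pose sw' (x : I * J) := (x.2, x.1).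
have c1 : cancel sw sw' by case.
have c2 : cancel sw' sw by case.
rewrite (tsum_bij _ c1 c2) tsum_pair //.
exact: absum_comp (can_inj c1) _ af.
Qed.

(** Dominated convergence for sums: a finite set [A] carries all but a small part of the dominating
    sum, and on [A] only finitely many limits have to be taken together. *)
Lemma tannery (I : choiceType) (f : nat -> I -> C) (f0 g : I -> C) : absum g ->
  (forall n i, cabs (f n i) <= cabs (g i)) ->
  (forall i, clim (f ^~ i) (f0 i)) -> clim (fun n => tsum (f n)) (tsum f0).
Proof.
move=> ag fg lf.
have f0g i : cabs (f0 i) <= cabs (g i) by apply: clim_cabs_le (lf i).
have af0 : absum f0 by exact: le_asum ag.
have af n : absum (f n) by exact: le_asum ag.
(* With e' = 2 e there is room for e / 4 on [A], twice e / 2 off [A], and e / 8 for replacing the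
   full sum by a finite one. *)
move=> e' e0'; pose e := e' / 2; have e0 : 0 < e by rewrite /e; lra.
have e4 : 0 < e / 4 by lra.
have e8 : 0 < e / 8 by lra.
have ag' : absum (fun i => (cabs (g i))%:C).
  by apply: le_asum ag => i; rewrite cabs_real ger0_norm ?cabs_ge0.
have [A0 hA0] := tsumP ag' e4.
pose A := undup A0; have uA : uniq A by exact: undup_uniq.
have tail (s : seq I) : uniq s -> \sum_(i <- s | i \notin A) cabs (g i) <= e / 2.
  move=> us; set t := [seq i <- s | i \notin A].
  have ut : uniq (A ++ t).
    rewrite cat_uniq uA filter_uniq // andbT /=; apply/hasPn => x.
    by rewrite mem_filter => /andP[].
  have h1 : cabs (\sum_(i <- A) (cabs (g i))%:C - tsum (fun i => (cabs (g i))%:C)) < e / 4.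
    by apply: hA0 => // x; rewrite mem_undup.
  have h2 : cabs (\sum_(i <- A ++ t) (cabs (g i))%:C - tsum (fun i => (cabs (g i))%:C)) < e / 4.
    by apply: hA0 => // x; rewrite mem_cat mem_undup => ->.
  rewrite -big_filter -/t.
  move: h1 h2; rewrite big_cat /=; set X := \sum_(i <- A) _; set Y := \sum_(i <- t) _.
  set T := tsum _ => h1 h2.
  have h3 : cabs Y < e / 2.
    have -> : Y = (X + Y - T) - (X - T) by ring.
    have := cabsB (X + Y - T) (X - T); lra.
  apply: le_trans (ltW h3); rewrite /Y -rmorph_sum cabs_real; exact: ler_norm.
have near (s : seq I) : exists N, forall n, (N <= n)%N ->
    \sum_(i <- s) cabs (f n i - f0 i) < e / 4.
  elim: s (e / 4) e4 => [|i s IH] d d0; first by exists 0%N => n _; rewrite big_nil.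
  have d2 : 0 < d / 2 by lra.
  have [N1 h1] := lf i _ d2; have [N2 h2] := IH _ d2.
  exists (maxn N1 N2) => n; rewrite geq_max => /andP[/h1 k1 /h2 k2].
  rewrite big_cons; lra.
have [N hN] := near A; exists N => n /hN hn.
rewrite -tsumB //.
have aB : absum (fun i => f n i - f0 i) by exact: absumB.
have [A2 hA2] := tsumP aB e8.
have A2h := hA2 (undup (A ++ A2)) (undup_uniq _).
set B := undup (A ++ A2) in A2h.
have uB : uniq B by exact: undup_uniq.
have {}A2h : cabs (\sum_(i <- B) (f n i - f0 i) - tsum (fun i => f n i - f0 i)) < e / 8.
  by apply: A2h => x xA; rewrite mem_undup mem_cat xA orbT.
have hB : cabs (\sum_(i <- B) (f n i - f0 i)) <= e / 4 + e / 2 * 2.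
  apply: le_trans (cabs_sum _ _) _; rewrite (bigID (mem A)) /= lerD //.
    rewrite -big_filter (perm_big A) ?(ltW hn) //.
    apply: uniq_perm; rewrite ?filter_uniq // => x; rewrite mem_filter.
    by rewrite /B mem_undup mem_cat; case: (x \in A).
  apply: (@le_trans _ _ (\sum_(i <- B | i \notin A) (cabs (g i) *+ 2))).
    apply: ler_sum => i _; rewrite mulr2n.
    have := cabsB (f n i) (f0 i); have := fg n i; have := f0g i; lra.
  rewrite sumrMnl mulr2n; have := tail B uB; lra.
set X := \sum_(i <- B) _ in A2h hB; set T := tsum _ in A2h *.
have := cabsB X (X - T); rewrite subKr /e in A2h hB *; lra.
Qed.

End Summation.

(** * From unordered sums to the limits used in the definitions *)

Section Bridges.
Variable R : realType.
Local Notation C := R[i].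

Lemma hsum_series (f : nat -> C) S : hsum f S -> clim (series (f : nat -> C^o)) S.
Proof.
move=> h e /h [A hA]; exists (\max_(i <- A) i).+1 => n hn.
rewrite /series /= ; apply: hA; first exact: iota_uniq.
move=> i iA; rewrite mem_index_iota /=; apply: leq_trans hn; rewrite ltnS.
exact: leq_bigmax_seq.
Qed.

Lemma csum_tsum (f : nat -> C) : absum f -> csum f = tsum f.
Proof. by move=> /tsumP/hsum_series/clim_lim. Qed.

Section Split.
Variables (I J1 J2 : choiceType) (h1 : J1 -> I) (h2 : J2 -> I) (p : pred I).
Hypotheses (i1 : injective h1) (i2 : injective h2).
Hypotheses (p1 : forall j, p (h1 j)) (p2 : forall j, ~~ p (h2 j)).
Hypotheses (s1 : forall i, p i -> exists j, h1 j = i).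
Hypotheses (s2 : forall i, ~~ p i -> exists j, h2 j = i).
Variable f : I -> C.

Let f1 i : C := if p i then f i else 0.
Let f2 i : C := if p i then 0 else f i.
Let f12 i : f1 i + f2 i = f i. Proof. by rewrite /f1 /f2; case: (p i); rewrite ?addr0 ?add0r. Qed.
Let f1E : f1 \o h1 =1 f \o h1. Proof. by move=> j; rewrite /f1 /= p1. Qed.
Let f2E : f2 \o h2 =1 f \o h2. Proof. by move=> j; rewrite /f2 /= (negPf (p2 j)). Qed.
Let f1s i : (forall j, h1 j != i) -> f1 i = 0.
Proof. by move=> h; rewrite /f1; case: ifP => // /s1 [j /eqP]; rewrite (negPf (h j)). Qed.
Let f2s i : (forall j, h2 j != i) -> f2 i = 0.
Proof.
by move=> h; rewrite /f2; case: ifP => // /negbT /s2 [j /eqP]; rewrite (negPf (h j)).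
Qed.

Lemma absum_split : absum (f \o h1) -> absum (f \o h2) -> absum f.
Proof.
move=> a1 a2; apply: (eq_absum f12); apply: absumD.
  by apply: (absum_inj f1s); apply: eq_absum a1 => j; rewrite f1E.
by apply: (absum_inj f2s); apply: eq_absum a2 => j; rewrite f2E.
Qed.

Lemma tsum_split : absum f -> tsum f = tsum (f \o h1) + tsum (f \o h2).
Proof.
move=> af; have a1 := absum_comp i1 af; have a2 := absum_comp i2 af.
rewrite -(eq_tsum f12) tsumD.
- rewrite (tsum_inj i1 f1s) ?(tsum_inj i2 f2s) ?(eq_tsum f1E) ?(eq_tsum f2E) //.
    by apply: eq_absum a2 => j; rewrite f2E.
  by apply: eq_absum a1 => j; rewrite f1E.
- by apply: (absum_inj f1s); apply: eq_absum a1 => j; rewrite f1E.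
by apply: (absum_inj f2s); apply: eq_absum a2 => j; rewrite f2E.
Qed.

End Split.

Definition nonnegz : pred int := fun n => 0 <= n.

Lemma absum_int (f : int -> C) :
  absum (fun n => f (Posz n)) -> absum (fun n => f (Negz n)) -> absum f.
Proof.
apply: (@absum_split _ _ _ Posz Negz nonnegz) => //; try by move=> ? ? [].
by case=> // n _; exists n.
by case=> // n _; exists n.
Qed.

Lemma tsum_int (f : int -> C) : absum f ->
  tsum f = tsum (fun n => f (Posz n)) + tsum (fun n => f (Negz n)).
Proof.
apply: (@tsum_split _ _ _ Posz Negz nonnegz) => //; try by move=> ? ? [].
by case=> // n _; exists n.
by case=> // n _; exists n.
Qed.

Lemma absum_Posz (f : int -> C) : absum f -> absum (fun n => f (Posz n)).
Proof. by apply: (@absum_comp R _ _ Posz) => ? ? []. Qed.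

Lemma absum_Negz (f : int -> C) : absum f -> absum (fun n => f (Negz n)).
Proof. by apply: (@absum_comp R _ _ Negz) => ? ? []. Qed.

Lemma zsum_tsum (f : int -> C) : absum f -> zsum f = tsum f.
Proof.
move=> af; rewrite tsum_int // /zsum !csum_tsum //; first exact: absum_Negz.
exact: absum_Posz.
Qed.

Lemma has_zsum_tsum (f : int -> C) : absum f -> has_zsum f (tsum f).
Proof.
move=> af; exists (tsum (fun n => f (Posz n))), (tsum (fun n => f (Negz n))).
rewrite -tsum_int //; split => //; apply/climP; apply: hsum_series; apply: tsumP.
  exact: absum_Posz.
exact: absum_Negz.
Qed.

Lemma has_zsum_unique (f : int -> C) S : absum f -> has_zsum f S -> S = tsum f.
Proof.
move=> af [a [b [/climP ha /climP hb ->]]].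
rewrite tsum_int // (clim_unique ha (hsum_series (tsumP (absum_Posz af)))).
by rewrite (clim_unique hb (hsum_series (tsumP (absum_Negz af)))).
Qed.

End Bridges.

Section Growth.
Variable R : realType.
Local Notation C := R[i].

Lemma exprn_small (a e : R) : 0 <= a < 1 -> 0 < e -> exists N, forall n, (N <= n)%N -> a ^+ n < e.
Proof.
move=> /andP[a0 a1] e0.
have h : ((fun n => a ^+ n) @ \oo --> (0 : R))%classic.
  by apply: cvg_expr; rewrite ger0_norm.
have /cvgrPdist_lt/(_ _ e0) [N _ hN] := h.
by exists N => n /hN /=; rewrite sub0r normrN ger0_norm ?exprn_ge0.
Qed.

Lemma geom_le (r : R) n : 0 <= r < 1 -> \sum_(i < n) r ^+ i <= (1 - r)^-1.
Proof.
move=> /andP[r0 r1]; have d0 : 0 < 1 - r by lra.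
rewrite -(ler_pM2l d0) divff ?gt_eqF // -opprB mulNr -subrX1 opprB.
by rewrite gerBl exprn_ge0.
Qed.

Lemma absum_geom (f : nat -> C) (M r : R) : 0 <= r < 1 ->
  (forall n, cabs (f n) <= M * r ^+ n) -> absum f.
Proof.
move=> hr hf; have /andP[r0 r1] := hr; exists (`|M| * (1 - r)^-1) => s us.
apply: (@le_trans _ _ (\sum_(i <- s) `|M| * r ^+ i)).
  apply: ler_sum => i _; apply: le_trans (hf i) _.
  by rewrite ler_wpM2r ?exprn_ge0 // ler_norm.
rewrite -mulr_sumr ler_wpM2l //.
pose N := (\max_(i <- s) i).+1.
apply: le_trans (geom_le N hr); rewrite -(big_mkord xpredT (fun i => r ^+ i)).
rewrite [leRHS](bigID (mem s)) /= -[leLHS]addr0 lerD //; last first.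
  by apply: sumr_ge0 => i _; exact: exprn_ge0.
rewrite -[leRHS]big_filter le_eqVlt; apply/orP; left; apply/eqP; apply: perm_big.
apply: uniq_perm; rewrite ?filter_uniq ?iota_uniq // => i.
rewrite mem_filter mem_index_iota /=; case: (boolP (i \in s)) => //= iS.
by rewrite /N ltnS leq_bigmax_seq.
Qed.

(** Consecutive terms have ratio q^n x, which eventually drops below any r > 0; the constant is the
    sum of the normalized terms up to that point. *)
Lemma gauss_bound (q x r : R) : 0 <= q < 1 -> 0 <= x -> 0 < r ->
  exists M, forall n, q ^+ 'C(n, 2) * x ^+ n <= M * r ^+ n.
Proof.
move=> hq x0 r0; have /andP[q0 q1] := hq.
pose a n := q ^+ 'C(n, 2) * x ^+ n.
have a0 n : 0 <= a n by rewrite mulr_ge0 ?exprn_ge0.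
have aS n : a n.+1 = a n * (q ^+ n * x).
  by rewrite /a binS bin1 addnC exprD exprSr; ring.
have d0 : 0 < r / (x + 1) by rewrite divr_gt0 //; lra.
have [N hN] := exprn_small hq d0.
have small n : (N <= n)%N -> q ^+ n * x <= r.
  move=> /hN; rewrite ltr_pdivlMr; last by lra.
  have := exprn_ge0 n q0; nra.
exists (\sum_(i < N.+1) a i / r ^+ i) => n; rewrite -/(a n).
have term i : (i < N.+1)%N -> a i <= (\sum_(i < N.+1) a i / r ^+ i) * r ^+ i.
  move=> iN; rewrite -ler_pdivrMr ?exprn_gt0 // (bigD1 (Ordinal iN)) //= lerDl.
  by apply: sumr_ge0 => j _; rewrite divr_ge0 // exprn_ge0 // ltW.
have [/term//|] := ltnP n N.+1.
elim: n => // n IH; rewrite leq_eqVlt => /orP[/eqP <-|nN].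
  have h := term _ (ltnSn N); rewrite aS exprSr [leRHS]mulrA.
  apply: ler_pM => //; first by rewrite mulr_ge0 ?exprn_ge0.
  exact: small.
rewrite aS exprSr [leRHS]mulrA; apply: ler_pM => //.
- by rewrite mulr_ge0 ?exprn_ge0.
- exact: IH.
by apply: small; exact: ltnW nN.
Qed.

End Growth.

(** * Laurent series and theta functions *)

Definition tri (n : int) : int := ((n * (n - 1)) %/ 2)%Z.

Lemma int_parity (n : int) : exists m, n = 2 * m \/ n = 2 * m + 1.
Proof. exists (n %/ 2)%Z; lia. Qed.

Lemma triE n : 2 * tri n = n * (n - 1).
Proof.
rewrite /tri; have [m [->|->]] := int_parity n; first by rewrite -!mulrA mulKz.
by rewrite addrK mulrCA mulKz.
Qed.

Lemma triD m n : tri (m + n) = tri m + tri n + m * n.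
Proof. have := triE m; have := triE n; have := triE (m + n); lia. Qed.

Lemma triN n : tri (- n) = tri n + n.
Proof. have := triE n; have := triE (- n); lia. Qed.

Lemma tri_refl n : tri (1 - n) = tri n.
Proof. have := triE n; have := triE (1 - n); lia. Qed.

Lemma triS n : tri (n + 1) = tri n + n.
Proof. have := triE n; have := triE (n + 1); lia. Qed.

Lemma tri_nat (n : nat) : tri n%:Z = ('C(n, 2))%:Z.
Proof.
elim: n => // n IH; rewrite binS bin1 (_ : n.+1%:Z = n%:Z + 1); last by lia.
rewrite triS IH; lia.
Qed.

Section IntSums.
Variable R : realType.
Local Notation C := R[i].
Implicit Types f : int -> C.

Lemma tsum_shift m f : tsum f = tsum (fun n => f (n + m)).
Proof.
apply: (@tsum_bij _ _ _ (fun n => n + m) (fun n => n - m) f) => n.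
  exact: addrK.
exact: subrK.
Qed.

Lemma tsum_refl m f : tsum f = tsum (fun n => f (m - n)).
Proof.
by apply: (@tsum_bij _ _ _ (fun n => m - n) (fun n => m - n) f) => n; rewrite subKr.
Qed.

Lemma absum_shift m f : absum f -> absum (fun n => f (n + m)).
Proof. by move=> af; apply: (@absum_comp _ _ _ (fun n => n + m)) => //; exact: addIr. Qed.

Lemma absum_refl m f : absum f -> absum (fun n => f (m - n)).
Proof.
by move=> af; apply: (@absum_comp _ _ _ (fun n => m - n)) => // x y /addrI/oppr_inj.
Qed.

Lemma tsum_antisym m f : absum f -> (forall n, f (m - n) = - f n) -> tsum f = 0.
Proof.
move=> af h; have : tsum f = - tsum f.
  by rewrite -tsumN // {1}(tsum_refl m); apply: eq_tsum.
by move/eqP; rewrite -addr_eq0 -mulr2n mulrn_eq0 /= => /eqP.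
Qed.

Lemma sgnzD (m n : int) : (-1 : C) ^ (m + n) = (-1) ^ m * (-1) ^ n.
Proof. by rewrite expfzDr // oppr_eq0 oner_eq0. Qed.

Lemma sgnzN (m : int) : (-1 : C) ^ (- m) = (-1) ^ m.
Proof. by rewrite -exprz_inv invrN invr1. Qed.

Lemma sgnz2 (m : int) : (-1 : C) ^ (2 * m) = 1.
Proof. by rewrite -exprz_exp -exprnP sqrrN expr1n exp1rz. Qed.

Lemma sgnzz (m : int) : (-1 : C) ^ m * (-1) ^ m = 1.
Proof. by rewrite -sgnzD -mulr2n -mulr_natl sgnz2. Qed.

Lemma cabs_qz (q : C) (n : int) : 0 <= n -> cabs q < 1 -> cabs (q ^ n) <= 1.
Proof.
case: n => // n _ q1; rewrite -exprnP cabsX exprn_ile1 ?cabs_ge0 //; exact: ltW.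
Qed.

End IntSums.

Definition lterm (R : realType) (c : int -> R[i]) x (n : int) : R[i] := c n * x ^ n.

HB.lock Definition lau (R : realType) (c : int -> R[i]) x : R[i] := tsum (lterm c x).

(** The coefficients of j(x;q), so that [lau (th q) x] is j(x;q). *)
HB.lock Definition th (R : realType) (q : R[i]) (n : int) : R[i] := (-1) ^ n * q ^ tri n.

Section Laurent.
Variable R : realType.
Local Notation C := R[i].
Implicit Types (a b c : int -> C) (x : C).

(** Coefficients of a Laurent series that converges on the whole punctured plane, as theta series
    do. *)
Definition rapid c := forall x, x != 0 -> absum (lterm c x).

Lemma lauD a b x : absum (lterm a x) -> absum (lterm b x) ->
  lau (fun n => a n + b n) x = lau a x + lau b x.
Proof. by move=> h k; rewrite lau.unlock -tsumD //; apply: eq_tsum => n; rewrite /lterm mulrDl. Qed.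

Lemma lauZ (l : C) a x : absum (lterm a x) -> lau (fun n => l * a n) x = l * lau a x.
Proof. by move=> h; rewrite lau.unlock -tsumZ //; apply: eq_tsum => n; rewrite /lterm mulrA. Qed.

Lemma rapid_absum c : rapid c -> absum c.
Proof. by move/(_ 1 (oner_neq0 _)); apply: eq_absum => n; rewrite /lterm exp1rz mulr1. Qed.

Lemma rapid_scale c y : y != 0 -> rapid c -> rapid (lterm c y).
Proof.
move=> y0 h x x0; have := h (y * x); rewrite mulf_neq0 // => /(_ isT).
by apply: eq_absum => n; rewrite /lterm exprzMl ?unitfE // mulrA.
Qed.

Lemma rapid_bd b c (B : R) : (forall n, cabs (b n) <= B) -> rapid c ->
  absum (fun n => b n * c n).
Proof. by move=> hb /rapid_absum; exact: absum_bdM. Qed.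

Lemma rapid_refl m c : rapid c -> rapid (fun n => c (m - n)).
Proof.
move=> h x x0; have := h x^-1; rewrite invr_eq0 => /(_ x0) /(absum_refl m).
move/(absumZ (x ^ m)); apply: eq_absum => n; rewrite /lterm exprz_inv opprB.
by rewrite mulrCA -expfzDr // addrCA subrr addr0.
Qed.

Lemma lau_tsum_mul a b x z : absum (lterm a x) -> absum (lterm b z) ->
  lau a x * lau b z = tsum (fun p : int * int => lterm a x p.1 * lterm b z p.2).
Proof. by move=> ha hb; rewrite lau.unlock tsum_mul. Qed.

Definition conv a b (i : int) : C := tsum (fun n => a n * b (i - n)).

Section Cauchy.
Variables (a b : int -> C) (x : C).
Hypotheses (x0 : x != 0) (ha : absum (lterm a x)) (hb : absum (lterm b x)).

Let F (p : int * int) := a p.2 * b (p.1 - p.2) * x ^ p.1.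

Let aF : absum F.
Proof.
have := absum_mul ha hb.
move/(@absum_comp _ _ _ (fun p : int * int => (p.2, p.1 - p.2))) => h.
have {}h : absum ((fun p : int * int => lterm a x p.1 * lterm b x p.2)
                  \o (fun p : int * int => (p.2, p.1 - p.2))).
  by apply: h => -[u v] [u' v'] [-> /addIr ->].
apply: eq_absum h => -[i n] /=; rewrite /F /lterm /= mulrACA -expfzDr //.
by rewrite addrCA subrr addr0.
Qed.

Let sl i : tsum (fun n => F (i, n)) = lterm (conv a b) x i.
Proof.
have h : absum (fun n => a n * b (i - n)).
  have := absum_slice i aF => /(absumZ (x ^ (- i))); apply: eq_absum => n.
  by rewrite /F /= mulrCA -expfzDr // addNr mulr1.
rewrite /lterm /conv mulrC -tsumZ //; apply: eq_tsum => n.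
by rewrite /F /= mulrC.
Qed.

Lemma absum_conv_term : absum (lterm (conv a b) x).
Proof. by have := absum_outer aF; apply: eq_absum. Qed.

Lemma lau_conv : lau a x * lau b x = lau (conv a b) x.
Proof.
rewrite lau.unlock tsum_mul // (@tsum_bij _ _ _ (fun p : int * int => (p.2, p.1 - p.2))
   (fun p : int * int => (p.1 + p.2, p.1))); last 2 first.
- by move=> [i n] /=; rewrite addrC subrK.
- by move=> [u v] /=; rewrite addrC addKr.
transitivity (tsum F).
  apply: eq_tsum => -[i n] /=; rewrite /F /lterm /= mulrACA -expfzDr //.
  by rewrite addrCA subrr addr0.
by rewrite tsum_pair //; apply: eq_tsum.
Qed.

End Cauchy.

End Laurent.

Section Theta.
Variable R : realType.
Local Notation C := R[i].
Variable q : C.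
Hypotheses (q0 : q != 0) (q1 : cabs q < 1).

Local Notation th := (th q).

Lemma thE n : th n = (-1) ^ n * q ^ tri n. Proof. by rewrite th.unlock. Qed.

Lemma rapid_th : rapid th.
Proof.
have hq : 0 <= cabs q < 1 by rewrite cabs_ge0.
have h2 : 0 <= (2^-1 : R) < 1 by lra.
have hnat (y : C) : absum (fun n : nat => q ^+ 'C(n, 2) * y ^+ n).
  have [M hM] := @gauss_bound _ (cabs q) (cabs y) 2^-1 hq (cabs_ge0 y) ltac:(lra).
  by apply: (absum_geom h2 (M := M)) => n; rewrite cabsM !cabsX.
move=> x x0; apply: absum_int.
  have := hnat x; apply: le_asum => n.
  by rewrite /lterm !thE !cabsM cabs_signz mul1r tri_nat -!exprnP.
have := @absum_comp _ _ _ S succn_inj _ (hnat (q * x^-1)); apply: le_asum => n /=.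
rewrite /lterm !thE !cabsM cabs_signz mul1r NegzE triN tri_nat -exprz_inv -PoszD -!exprnP.
by rewrite exprMn exprD !cabsM mulrA.
Qed.

Lemma th0 : th 0 = 1.
Proof. by rewrite !thE /tri mul0r div0z !expr0z mulr1. Qed.

Lemma thD m n : th (m + n) = th m * th n * q ^ (m * n).
Proof. by rewrite !thE sgnzD triD !expfzDr //; ring. Qed.

Lemma thS n : th (n + 1) = - (q ^ n * th n).
Proof. by rewrite !thE sgnzD triS expfzDr // expr1z; ring. Qed.

Lemma th_opp n : th (- n) = q ^ n * th n.
Proof. by rewrite !thE sgnzN triN expfzDr //; ring. Qed.

Lemma th_refl n : th (1 - n) = - th n.
Proof. by rewrite !thE tri_refl sgnzD sgnzN expr1z; ring. Qed.

Lemma th_neq0 n : th n != 0.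
Proof. by rewrite !thE mulf_neq0 // expfz_neq0 // oppr_eq0 oner_eq0. Qed.

(** This is j(1;q) = 0: the terms n and 1 - n cancel. *)
Lemma tsum_th : tsum th = 0.
Proof. by apply: (tsum_antisym (m := 1) (rapid_absum rapid_th)) => n; exact: th_refl. Qed.

(** Quasi-periodicity: shifting the index by m carries the zero at 1 to q^m. *)
Lemma lau_th_qz m : lau th (q ^ m) = 0.
Proof.
apply: (mulfI (th_neq0 m)); rewrite mulr0 lau.unlock -tsumZ; last first.
  by apply: rapid_th; exact: expfz_neq0.
rewrite -[RHS]tsum_th [RHS](tsum_shift m); apply: eq_tsum => n.
by rewrite /lterm exprz_exp addrC thD; ring.
Qed.

Lemma lau_th1 : lau th 1 = 0.
Proof. by rewrite -(expr0z q) lau_th_qz. Qed.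

End Theta.

(** Pairs of equal parity are the (m - n, m + n), pairs of opposite parity the (m - n + 1, m + n).
    In these coordinates the quadratic form of a product of two theta functions with the same base
    is again diagonal. *)
Definition rot (p : int * int) : int * int := (p.1 - p.2, p.1 + p.2).
Definition rotS (p : int * int) : int * int := (p.1 - p.2 + 1, p.1 + p.2).
Definition evenp : pred (int * int) := fun p => ((p.1 + p.2) %% 2)%Z == 0.

Lemma rot_inj : injective rot.
Proof. by move=> [m n] [m' n'] [] e1 e2; congr (_, _); lia. Qed.

Lemma rotS_inj : injective rotS.
Proof. by move=> [m n] [m' n'] [] e1 e2; congr (_, _); lia. Qed.

Lemma rot_even p : evenp (rot p).
Proof. by case: p => m n; rewrite /evenp /rot /=; lia. Qed.

Lemma rotS_odd p : ~~ evenp (rotS p).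
Proof. by case: p => m n; rewrite /evenp /rotS /=; lia. Qed.

Lemma rot_onto p : evenp p -> exists p', rot p' = p.
Proof.
case: p => a b; rewrite /evenp /= => e; exists ((a + b) %/ 2, (b - a) %/ 2)%Z.
by rewrite /rot /=; congr (_, _); lia.
Qed.

Lemma rotS_onto p : ~~ evenp p -> exists p', rotS p' = p.
Proof.
case: p => a b; rewrite /evenp /= => e; exists ((a + b) %/ 2, (b - a + 1) %/ 2)%Z.
by rewrite /rotS /=; congr (_, _); lia.
Qed.

(** * The addition formula for theta functions *)

Section TwoTerm.
Variable R : realType.
Local Notation C := R[i].
Variable q : C.
Hypotheses (q0 : q != 0) (q1 : cabs q < 1).

Lemma cabs_sqr1 : cabs (q ^+ 2) < 1.
Proof. by rewrite cabsX exprn_ilt1 // cabs_ge0. Qed.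

Let Q0 : q ^+ 2 != 0. Proof. by rewrite expf_neq0. Qed.

Lemma exprzNl (x : C) n : x != 0 -> (- x) ^ n = (-1) ^ n * x ^ n.
Proof. by move=> x0; rewrite -[- x]mulN1r exprzMl ?unitfE ?oppr_eq0 ?oner_eq0. Qed.

(** The double series is split by the parity of the sum of its two indices; [rot] and [rotS] turn
    each half into a product of two theta functions with base q^2. *)
Lemma jtheta_mul x z : x != 0 -> z != 0 ->
  lau (th q) x * lau (th q) z =
    lau (th (q ^+ 2)) (- (x * z)) * lau (th (q ^+ 2)) (- (q * z / x))
    - x * (lau (th (q ^+ 2)) (- (q * x * z)) * lau (th (q ^+ 2)) (- (z / x))).
Proof.
move=> x0 z0; have aT (y : C) : y != 0 -> absum (lterm (th q) y) by exact: rapid_th.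
have aT2 (y : C) : y != 0 -> absum (lterm (th (q ^+ 2)) y).
  by apply: rapid_th => //; exact: cabs_sqr1.
have aG := absum_mul (aT _ x0) (aT _ z0).
have m1 : x * z != 0 by rewrite mulf_neq0.
have m2 : q * z / x != 0 by rewrite !mulf_neq0 ?invr_eq0.
have m3 : q * x * z != 0 by rewrite !mulf_neq0.
have m4 : z / x != 0 by rewrite !mulf_neq0 ?invr_eq0.
have n1 : - (x * z) != 0 by rewrite oppr_eq0 mulf_neq0.
have n2 : - (q * z / x) != 0 by rewrite oppr_eq0 !mulf_neq0 ?invr_eq0.
have n3 : - (q * x * z) != 0 by rewrite oppr_eq0 !mulf_neq0.
have n4 : - (z / x) != 0 by rewrite oppr_eq0 !mulf_neq0 ?invr_eq0.
transitivity (tsum (fun p : int * int => lterm (th q) x p.1 * lterm (th q) z p.2)).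
  exact: lau_tsum_mul (aT _ x0) (aT _ z0).
have a34 := absum_mul (aT2 _ n3) (aT2 _ n4).
rewrite (@tsum_split _ _ _ _ rot rotS evenp); last exact: aG.
- congr (_ + _).
  + etransitivity; last exact: esym (lau_tsum_mul (aT2 _ n1) (aT2 _ n2)).
    apply: eq_tsum => -[m n] /=; rewrite /lterm !th.unlock /rot /=.
    (* The cross terms cancel: tri (m - n) + tri (m + n) = 2 tri m + 2 tri n + n. *)
    have Eq : q ^ tri (m - n) * q ^ tri (m + n) =
        (q ^ tri m * q ^ tri m) * (q ^ tri n * q ^ tri n) * q ^ n.
      rewrite -!expfzDr //; congr (_ ^ _).
      by rewrite !triD triN; ring.
    rewrite (exprzNl m m1) (exprzNl n m2) !exprzMl ?unitfE ?mulf_neq0 ?invr_eq0 //.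
    rewrite exprz_inv !(expfzDr, sgnzD, sgnzN) //.
    move: Eq; move: (q ^ tri m) (q ^ tri n) (q ^ tri (m - n)) (q ^ tri (m + n)).
    move: ((-1) ^ m) ((-1) ^ n) (x ^ m) (x ^ (- n)) (z ^ m) (z ^ n) (q ^ m) (q ^ n).
    move=> s1 s2 x1 x2 z1 z2 q2 q3 t1 t2 t3 t4 Eq.
    transitivity (s1 * s1 * (s2 * s2) * (t3 * t4) * (x1 * x2 * (z1 * z2))).
      by ring.
    by rewrite Eq; ring.
  + etransitivity; last first.
      exact: esym (congr1 (fun s => - (x * s)) (lau_tsum_mul (aT2 _ n3) (aT2 _ n4))).
    rewrite -tsumZ // -tsumN; last exact: absumZ.
    apply: eq_tsum => -[m n] /=; rewrite /lterm !th.unlock /rotS /=.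
    have Eq : q ^ tri (m - n + 1) * q ^ tri (m + n) =
        (q ^ tri m * q ^ tri m) * (q ^ tri n * q ^ tri n) * q ^ m.
      rewrite -!expfzDr //; congr (_ ^ _).
      by rewrite triS !triD triN; ring.
    rewrite (exprzNl m m3) (exprzNl n m4) !exprzMl ?unitfE ?mulf_neq0 ?invr_eq0 //.
    rewrite exprz_inv !(expfzDr, sgnzD, sgnzN, expr1z) //.
    move: Eq; move: (q ^ tri m) (q ^ tri n) (q ^ tri (m - n + 1)) (q ^ tri (m + n)).
    move: ((-1) ^ m) ((-1) ^ n) (x ^ m) (x ^ (- n)) (z ^ m) (z ^ n) (q ^ m) (q ^ n).
    move=> s1 s2 x1 x2 z1 z2 q2 q3 t1 t2 t3 t4 Eq.
    transitivity (- (s1 * s1 * (s2 * s2) * (t3 * t4) * (x * (x1 * x2) * (z1 * z2)))).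
      by ring.
    by rewrite Eq; ring.
- exact: rot_inj.
- exact: rotS_inj.
- exact: rot_even.
- exact: rotS_odd.
- exact: rot_onto.
- exact: rotS_onto.
Qed.

(** For z = - x the second product of the addition formula contains j(1;q^2) = 0. *)
Lemma jtheta_dup x : x != 0 ->
  lau (th q) x * lau (th q) (- x) = lau (th (q ^+ 2)) q * lau (th (q ^+ 2)) (x ^+ 2).
Proof.
move=> x0; have Nx0 : - x != 0 by rewrite oppr_eq0.
rewrite jtheta_mul // mulrN opprK -expr2.
have -> : - (q * - x / x) = q by field.
have -> : - (- x / x) = 1 by field.
by rewrite lau_th1 ?cabs_sqr1 // !mulr0 subr0 mulrC.
Qed.

End TwoTerm.

(** * Bailey kernels *)

Section QFact.
Variable R : realType.
Local Notation C := R[i].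
Variable q : C.
Hypotheses (q0 : q != 0) (q1 : cabs q < 1).

Definition qf n : C := \prod_(i < n) (1 - q ^+ i.+1).

Lemma qf0 : qf 0 = 1. Proof. by rewrite /qf big_ord0. Qed.
Lemma qfS n : qf n.+1 = qf n * (1 - q ^+ n.+1). Proof. by rewrite /qf big_ord_recr. Qed.

Lemma cabs_exp_lt1 n : cabs (q ^+ n.+1) < 1.
Proof. by rewrite cabsX exprn_ilt1 // cabs_ge0. Qed.

Lemma subr1X_neq0 n : 1 - q ^+ n.+1 != 0.
Proof.
by apply/eqP => /eqP; rewrite subr_eq0 => /eqP e; have := cabs_exp_lt1 n; rewrite -e cabs1 ltxx.
Qed.

Lemma qf_neq0 n : qf n != 0.
Proof. by apply/prodf_neq0 => i _; exact: subr1X_neq0. Qed.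

(** With r = |q|, both 1 + r^(n+1) and 1 / (1 - r^(n+1)) are at most exp (r^n / (1 - r)), and these
    exponents form a geometric series. *)
Lemma qf_bounds : exists B, forall n, cabs (qf n) <= B /\ cabs (qf n)^-1 <= B.
Proof.
pose r := cabs q; have r0 : 0 <= r := cabs_ge0 q; have hr : 0 <= r < 1 by rewrite r0.
have d0 : 0 < 1 - r by rewrite subr_gt0.
pose s n := \sum_(i < n) r ^+ i.
have ub n : cabs (qf n) <= expR ((1 - r)^-1 * s n) /\
            cabs (qf n)^-1 <= expR ((1 - r)^-1 * s n).
  elim: n => [|n [IH1 IH2]]; first by rewrite qf0 /s big_ord0 mulr0 expR0 invr1 cabs1.
  have rn0 : 0 <= r ^+ n.+1 by rewrite exprn_ge0.
  have rn : r ^+ n.+1 <= r by rewrite exprS ler_piMr // exprn_ile1 // ltW.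
  have rn' : r ^+ n.+1 <= r ^+ n by rewrite exprSr ler_piMr ?exprn_ge0 // ltW.
  have i1 : 1 <= (1 - r)^-1 by rewrite invf_ge1 //; lra.
  have e1 := expR_ge1Dx ((1 - r)^-1 * r ^+ n).
  have e2 : 1 + r ^+ n.+1 <= expR ((1 - r)^-1 * r ^+ n).
    apply: le_trans e1; rewrite lerD2l (le_trans rn') // ler_peMl ?exprn_ge0 //.
  have e3 : (1 - r ^+ n.+1)^-1 <= expR ((1 - r)^-1 * r ^+ n).
    have d : 0 < 1 - r ^+ n.+1 by lra.
    apply: le_trans e1; rewrite -(ler_pM2l d) divff ?gt_eqF //.
    have h : (1 - r ^+ n.+1) * (1 - r)^-1 >= 1 by rewrite ler_pdivlMr // mul1r; lra.
    have rp : 0 <= r ^+ n by rewrite exprn_ge0.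
    rewrite mulrDr mulr1 mulrA; nra.
  have c1 : cabs (1 - q ^+ n.+1) <= 1 + r ^+ n.+1.
    by apply: le_trans (cabsB _ _) _; rewrite cabs1 cabsX.
  have c2 : cabs (1 - q ^+ n.+1)^-1 <= (1 - r ^+ n.+1)^-1.
    rewrite cabsV lef_pV2 ?posrE ?cabs_gt0 ?subr1X_neq0 //; last by lra.
    have := cabsD (1 - q ^+ n.+1) (q ^+ n.+1); rewrite subrK cabs1 cabsX; lra.
  rewrite qfS /s big_ord_recr /= [(1 - r)^-1 * _]mulrDr expRD invfM !cabsM.
  split; apply: ler_pM; rewrite ?cabs_ge0 //; [exact: le_trans e2|exact: le_trans e3].
exists (expR ((1 - r)^-1 * (1 - r)^-1)) => n; have [h1 h2] := ub n.
have h : expR ((1 - r)^-1 * s n) <= expR ((1 - r)^-1 * (1 - r)^-1).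
  by rewrite ler_expR ler_pM2l ?invr_gt0 // geom_le.
by split; [exact: le_trans h|exact: le_trans h].
Qed.

(** The differences of consecutive products are bounded by a geometric series, so the limit exists;
    the uniform bound on the inverses keeps it away from 0. *)
Lemma clim_qf : clim qf (qinf q) /\ qinf q != 0.
Proof.
have [B hB] := qf_bounds.
have hr : 0 <= cabs q < 1 by rewrite cabs_ge0.
have B0 : 0 < B.
  have [h _] := hB 0%N; apply: lt_le_trans h; by rewrite qf0 cabs1.
have af : absum (fun n => qf n.+1 - qf n).
  apply: (absum_geom hr (M := B)) => n.
  rewrite qfS mulrBr mulr1 addrAC subrr add0r cabsN cabsM cabsX exprS.
  have [h _] := hB n.
  apply: ler_pM; rewrite ?cabs_ge0 ?mulr_ge0 ?exprn_ge0 ?cabs_ge0 //.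
  by rewrite ler_piMl ?exprn_ge0 ?cabs_ge0 // ltW.
have := hsum_series (tsumP af); set l := tsum _ => h.
have {}h : clim qf (1 + l).
  have := climD (@clim_cst _ 1) h; apply: clim_ext => n.
  rewrite /series /= telescope_sumr // qf0; ring.
have E : qinf q = 1 + l by rewrite /qinf /cprod; apply: clim_lim h.
rewrite E; split=> //; apply/eqP => l0.
have Bi : 0 < B^-1 by rewrite invr_gt0.
have [N /(_ N (leqnn _))] := h _ Bi; rewrite l0 subr0.
have [_] := hB N; rewrite cabsV.
have cq : 0 < cabs (qf N) by rewrite cabs_gt0 qf_neq0.
rewrite -[X in X <= _]invrK invrK -[leRHS]invrK lef_pV2 ?posrE // => h1 h2.
by have := le_lt_trans h1 h2; rewrite ltxx.
Qed.

Lemma qinf_neq0 : qinf q != 0. Proof. by have [] := clim_qf. Qed.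

(** 1 / (q)_m, set to 0 for negative m. Sums over all integers are thereby cut off by themselves,
    and [iq_pred] has no exception, since its factor 1 - q^m vanishes at m = 0. *)
Definition iq (m : int) : C := if m is Posz n then (qf n)^-1 else 0.

Lemma iq_pred m : iq (m - 1) = (1 - q ^ m) * iq m.
Proof.
case: m => [[|n]|n].
- by rewrite sub0r expr0z subrr mul0r.
- rewrite (_ : n.+1%:Z - 1 = n%:Z) /=; last by lia.
  by rewrite qfS -exprnP invfM mulrCA divff ?mulr1 // subr1X_neq0.
by rewrite (_ : Negz n - 1 = Negz n.+1) ?mulr0 //; lia.
Qed.

Lemma iq_bound : exists B, forall m, cabs (iq m) <= B.
Proof.
have [B hB] := qf_bounds; exists B; case=> n /=; first by have [] := hB n.
by rewrite cabs0; have [h _] := hB 0%N; apply: le_trans h; exact: cabs_ge0.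
Qed.

Lemma clim_qfV : clim (fun n => (qf n)^-1) (qinf q)^-1.
Proof. by apply: climV; [exact: qinf_neq0|have [] := clim_qf]. Qed.

Lemma clim_iq (g : nat -> int) (c : int) : (forall n : nat, n%:Z - c <= g n) ->
  clim (fun n => iq (g n)) (qinf q)^-1.
Proof.
move=> hg e /(clim_qfV) [N hN]; exists (N + `|c|)%N => n hn.
have := hg n; case E: (g n) => [m|m]; last by lia.
by move=> hm /=; apply: hN; lia.
Qed.

End QFact.

Section BaileyPairs.
Variable R : realType.
Local Notation C := R[i].
Variable q : C.
Hypotheses (q0 : q != 0) (q1 : cabs q < 1).
Local Notation th := (th q).
Local Notation iq := (iq q).
Local Notation qf := (qf q).
Implicit Types (x : int -> C) (n i m : int).

(* The kernels of the Bailey transform relative to 1 and to q, with the symmetry factor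
   of the theta function included. *)
Definition ub n i : C := th i * (iq (n - i) * iq (n + i)).
Definition vb n i : C := th i * (iq (n + 1 - i) * iq (n + i)).

Lemma th_pred i : th (i - 1) = - (q ^ (1 - i) * th i).
Proof.
have := thS q0 (i - 1); rewrite subrK => ->.
rewrite mulrN opprK mulrA -expfzDr // (_ : 1 - i + (i - 1) = 0) ?mul1r //; lia.
Qed.

(** With [ub_rec] this forms a ladder from [ub n] to [vb n] to [ub (n + 1)]. For a sequence whose
    shifts can be expressed through itself, the ladder computes its pairings for all n from n =
    0. *)
Lemma vb_rec n i : (1 - q ^ (2 * n + 1)) * vb n i = ub n i - q ^ n * ub n (i - 1).
Proof.
rewrite /ub /vb th_pred.
rewrite (_ : n - i = n + 1 - i - 1) ?iq_pred //; last by lia.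
rewrite (_ : n - (i - 1) = n + 1 - i); last by lia.
rewrite (_ : n + (i - 1) = n + i - 1) ?iq_pred //; last by lia.
have E1 : q ^ (n + 1 - i) = q ^ n * q ^ (1 - i) by rewrite -expfzDr //; congr (_ ^ _); lia.
have E2 : q ^ (2 * n + 1) = q ^ n * q ^ (1 - i) * q ^ (n + i).
  by rewrite -!expfzDr //; congr (_ ^ _); lia.
by rewrite E1 E2; ring.
Qed.

Lemma ub_rec n i :
  (1 - q ^ (2 * n + 2)) * ub (n + 1) i = vb n i - q ^ (n + 1) * vb n (i + 1).
Proof.
rewrite /ub /vb (thS q0).
rewrite (_ : n + i = n + 1 + i - 1) ?iq_pred //; last by lia.
rewrite (_ : n + 1 - (i + 1) = n + 1 - i - 1) ?iq_pred //; last by lia.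
rewrite (_ : n + (i + 1) = n + 1 + i); last by lia.
have E1 : q ^ (n + 1 + i) = q ^ (n + 1) * q ^ i by rewrite -expfzDr.
have E2 : q ^ (2 * n + 2) = q ^ (n + 1) * q ^ i * q ^ (n + 1 - i).
  by rewrite -!expfzDr //; congr (_ ^ _); lia.
by rewrite E1 E2; ring.
Qed.

Lemma ub_opp n i : ub n (- i) = q ^ i * ub n i.
Proof. by rewrite /ub (th_opp q0) opprK; ring. Qed.

Lemma vb_refl n i : vb n (1 - i) = - vb n i.
Proof.
rewrite /vb th_refl (_ : n + 1 - (1 - i) = n + i); last by lia.
by rewrite (_ : n + (1 - i) = n + 1 - i) ?(mulrC (iq (n + i))) ?mulNr //; lia.
Qed.

(** Every shift is included because each rung of the ladder shifts the sequence by one. *)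
Definition adm x := forall m, absum (fun i => x (i + m) * th i).

Lemma adm_bd x (B : R) : (forall i, cabs (x i) <= B) -> adm x.
Proof.
by move=> hB m; apply: (rapid_bd (B := B)) => //; exact: rapid_th.
Qed.

Lemma adm_exp t : t != 0 -> adm (fun i => t ^ i).
Proof.
move=> t0 m; have := rapid_th q1 t0 => /(absumZ (t ^ m)).
by apply: eq_absum => i; rewrite /lterm expfzDr //; ring.
Qed.

Lemma adm_int : adm (fun i => i%:~R).
Proof.
(* Since n <= 2^n, the sequence i is dominated by the two exponential ones with ratios 2 and 1/2. *)
have [a [a0 ha]] : exists a : C, a != 0 /\ forall n : nat, cabs (n%:R : C) <= cabs (a ^+ n).
  exists 2; rewrite pnatr_eq0; split=> // n.
  by rewrite cabsX !cabs_nat -natrX ler_nat ltnW // ltn_expl.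
have aV0 : a^-1 != 0 by rewrite invr_eq0.
have h1 := rapid_absum (rapid_th q1).
have ab (f : int -> C) : absum f -> absum (fun i => (cabs (f i))%:C).
  by apply: le_asum => i; rewrite cabs_real ger0_norm ?cabs_ge0.
have hnat (f g : int -> C) : (forall i, cabs (f i) <= cabs (a ^ i) \/ cabs (f i) <= cabs (a^-1 ^ i)) ->
    (forall i, g i = f i * th i) -> absum g.
  move=> hf hg.
  have := absumD (ab _ (adm_exp a0 0)) (ab _ (adm_exp aV0 0)); apply: le_asum => i.
  have c0 := cabs_ge0 (th i).
  rewrite addr0 hg -rmorphD cabs_real ger0_norm ?addr_ge0 ?cabs_ge0 //.
  rewrite (cabsM (f i)) (cabsM (a ^ i)) (cabsM (a^-1 ^ i)).
  have := cabs_ge0 (a ^ i); have := cabs_ge0 (a^-1 ^ i); have := hf i.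
  move: (cabs (f i)) (cabs (th i)) (cabs (a ^ i)) (cabs (a^-1 ^ i)) c0 => u v w z c0.
  by case=> k p1 p2; nra.
have k2 : absum (fun i : int => i%:~R * th i).
  apply: (hnat (fun i => i%:~R)) => // -[n|n].
    by left; rewrite -pmulrn -exprnP.
  by right; rewrite NegzE mulrNz cabsN -pmulrn exprz_inv opprK -exprnP.
move=> m; have := absumD k2 (absumZ (m%:~R) h1); apply: eq_absum => i.
by rewrite intrD mulrDl.
Qed.

Lemma iqq_bound : exists B, forall m n, cabs (iq m * iq n) <= B.
Proof.
have [B hB] := iq_bound q1; exists (B * B) => m n.
by rewrite cabsM ler_pM ?cabs_ge0.
Qed.

Section Admissible.
Variable x : int -> C.
Hypothesis ax : adm x.

Lemma absum_ub n m : absum (fun i => x (i + m) * ub n i).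
Proof.
have [B hB] := iqq_bound.
have := absum_bdM (fun i => hB (n - i) (n + i)) (ax m).
by apply: eq_absum => i; rewrite /ub; ring.
Qed.

Lemma absum_vb n m : absum (fun i => x (i + m) * vb n i).
Proof.
have [B hB] := iqq_bound.
have := absum_bdM (fun i => hB (n + 1 - i) (n + i)) (ax m).
by apply: eq_absum => i; rewrite /vb; ring.
Qed.

End Admissible.

Definition US x n := tsum (fun i => x i * ub n i).
Definition VS x n := tsum (fun i => x i * vb n i).

Lemma absum_ub0 x n : adm x -> absum (fun i => x i * ub n i).
Proof. by move=> ax; have := absum_ub ax n 0; apply: eq_absum => i; rewrite addr0. Qed.

Lemma absum_vb0 x n : adm x -> absum (fun i => x i * vb n i).
Proof. by move=> ax; have := absum_vb ax n 0; apply: eq_absum => i; rewrite addr0. Qed.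

Lemma eq_US x y n : x =1 y -> US x n = US y n. Proof. by move=> /funext ->. Qed.
Lemma eq_VS x y n : x =1 y -> VS x n = VS y n. Proof. by move=> /funext ->. Qed.

Lemma US_Z (c : C) x n : adm x -> US (fun i => c * x i) n = c * US x n.
Proof.
move=> ax; rewrite /US -tsumZ; last exact: absum_ub0.
by apply: eq_tsum => i; rewrite mulrA.
Qed.

Lemma VS_Z (c : C) x n : adm x -> VS (fun i => c * x i) n = c * VS x n.
Proof.
move=> ax; rewrite /VS -tsumZ; last exact: absum_vb0.
by apply: eq_tsum => i; rewrite mulrA.
Qed.

Lemma VS_D x y n : adm x -> adm y -> VS (fun i => x i + y i) n = VS x n + VS y n.
Proof.
move=> ax ay; rewrite /VS -tsumD; try exact: absum_vb0.
by apply: eq_tsum => i; rewrite mulrDl.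
Qed.

Lemma US_D x y n : adm x -> adm y -> US (fun i => x i + y i) n = US x n + US y n.
Proof.
move=> ax ay; rewrite /US -tsumD; try exact: absum_ub0.
by apply: eq_tsum => i; rewrite mulrDl.
Qed.

Lemma VS_rec x n : adm x ->
  (1 - q ^ (2 * n + 1)) * VS x n = US x n - q ^ n * US (fun i => x (i + 1)) n.
Proof.
move=> ax; have a1 := absum_ub0 n ax; have a2 := absum_ub ax n 1.
rewrite /VS /US -tsumZ; last exact: absum_vb0.
rewrite -tsumZ // (tsum_shift (-1) (fun i => _ * (_ * ub n i))) -tsumB //.
  apply: eq_tsum => i; rewrite mulrCA vb_rec subrK; ring.
by apply: (absum_shift (-1) (f := fun i => q ^ n * (x (i + 1) * ub n i))); exact: absumZ.
Qed.

Lemma US_rec x n : adm x ->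
  (1 - q ^ (2 * n + 2)) * US x (n + 1) = VS x n - q ^ (n + 1) * VS (fun i => x (i - 1)) n.
Proof.
move=> ax; have a1 := absum_vb0 n ax; have a2 := absum_vb ax n (-1).
rewrite /VS /US -tsumZ; last exact: absum_ub0.
rewrite -tsumZ // (tsum_shift 1 (fun i => _ * (_ * vb n i))) -tsumB //.
  apply: eq_tsum => i; rewrite mulrCA ub_rec addrK; ring.
by apply: (absum_shift 1 (f := fun i => q ^ (n + 1) * (x (i - 1) * vb n i))); exact: absumZ.
Qed.

Lemma US_opp x n : US x n = US (fun i => x (- i) * q ^ i) n.
Proof.
rewrite /US (tsum_refl 0); apply: eq_tsum => i.
by rewrite sub0r ub_opp mulrA.
Qed.

Lemma VS_refl x n : adm (fun i => x (1 - i)) -> VS x n = - VS (fun i => x (1 - i)) n.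
Proof.
move=> ax; rewrite /VS (tsum_refl 1) -tsumN; last exact: absum_vb0.
by apply: eq_tsum => i; rewrite vb_refl mulrN.
Qed.

Lemma US0 x : US x 0 = x 0.
Proof.
rewrite /US (@tsum_fin _ _ _ [:: 0]) // => [|i].
  by rewrite big_seq1 /ub th0 /= qf0 invr1 !mulr1.
rewrite inE => i0; rewrite /ub sub0r add0r.
by case: i i0 => [[|n]|n] //= _; rewrite ?NegzE ?opprK /= ?mul0r ?mulr0.
Qed.

Lemma subr1z_neq0 (n : int) : 0 < n -> 1 - q ^ n != 0.
Proof. by case: n => [[|n]|n] // _; exact: subr1X_neq0. Qed.

(** The kernel [vb] is odd under i -> 1 - i, the constant sequence even. *)
Lemma VS_1 n : VS (fun=> 1) n = 0.
Proof.
have a1 : adm (fun=> 1) by apply: (@adm_bd _ 1) => i; rewrite cabs1.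
have := @VS_refl (fun=> 1) n a1; move/eqP; rewrite -addr_eq0 -mulr2n mulrn_eq0 /=.
by move/eqP.
Qed.

Lemma US_1 (n : nat) : US (fun=> 1) n = (n == 0%N)%:R.
Proof.
have a1 : adm (fun=> 1) by apply: (@adm_bd _ 1) => i; rewrite cabs1.
case: n => [|n]; first by rewrite US0.
have := US_rec n%:Z a1; rewrite !VS_1 mulr0 subrr (_ : n%:Z + 1 = n.+1%:Z); last by lia.
by move/eqP; rewrite mulf_eq0 (negPf (subr1z_neq0 _)) //= => /eqP.
Qed.

Lemma VS_qz (n : nat) : VS (fun i => q ^ i) n = (n == 0%N)%:R.
Proof.
have a1 : adm (fun i => q ^ i) by exact: adm_exp.
have E : US (fun i => q ^ i) n = US (fun=> 1) n.
  rewrite US_opp; apply: eq_US => i; rewrite -expfzDr // addNr //.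
have := VS_rec n%:Z a1; rewrite (@eq_US (fun i => q ^ (i + 1)) (fun i => q * q ^ i)); last first.
  by move=> i; rewrite expfzDr // expr1z mulrC.
rewrite US_Z // E US_1; case: n {E} => [|n] /=.
  rewrite mulr1n mulr1 mul1r mulr0 add0r expr1z.
  have := subr1X_neq0 q1 0; rewrite expr1 => h.
  by rewrite -[RHS]mulr1 => /(mulfI h).
by rewrite !mulr0 subr0 => /eqP; rewrite mulf_eq0 (negPf (subr1z_neq0 _)) //= => /eqP.
Qed.

(** The finite form of the Jacobi triple product. A shift multiplies t^i by a power of t only, so
    the two ladder relations close up. *)
Lemma US_VS_exp t : t != 0 -> forall n : nat,
  US (fun i => t ^ i) n = (\prod_(i < n) (1 - q ^+ i * t) * \prod_(i < n) (1 - q ^+ i.+1 / t))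
                          / qf (2 * n).
Proof.
move=> t0; have a1 := adm_exp t0; elim=> [|n IH].
  by rewrite US0 !big_ord0 muln0 qf0 invr1 !mulr1.
have h1 := VS_rec n%:Z a1; have h2 := US_rec n%:Z a1.
rewrite (@eq_US (fun i => t ^ (i + 1)) (fun i => t * t ^ i)) in h1; last first.
  by move=> i; rewrite expfzDr // expr1z mulrC.
rewrite (@eq_VS (fun i => t ^ (i - 1)) (fun i => t^-1 * t ^ i)) in h2; last first.
  by move=> i; rewrite expfzDr // exprN1 mulrC.
rewrite US_Z // IH in h1; rewrite VS_Z // in h2.
have d1 : 1 - q ^ (2 * n%:Z + 1) != 0 by apply: subr1z_neq0; lia.
have d2 : 1 - q ^ (2 * n%:Z + 2) != 0 by apply: subr1z_neq0; lia.
rewrite (_ : n%:Z + 1 = n.+1%:Z) in h2; last by lia.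
apply: (mulfI d2); rewrite h2; apply: (mulfI d1).
have -> : forall a b : C, (1 - q ^ (2 * n%:Z + 1)) * (a - b * (t^-1 * a)) =
   ((1 - q ^ (2 * n%:Z + 1)) * a) * (1 - b / t) by move=> *; ring.
rewrite h1 mulnS !addSn add0n !qfS !big_ord_recr /= !invfM.
rewrite (_ : (2 * n%:Z + 1) = (2 * n).+1%:Z); last by lia.
rewrite (_ : (2 * n%:Z + 2) = (2 * n).+2%:Z) -?exprnP; last by lia.
have k1 := subr1X_neq0 q1 (2 * n); have k2 := subr1X_neq0 q1 (2 * n).+1.
have k3 := qf_neq0 q1 (2 * n).
by field; rewrite t0 k1 k2 k3.
Qed.

(** A finite form of Jacobi's series for (q)_oo^3. A shift changes the sequence i by a constant,
    whose pairings are known from [US_1] and [VS_1]. *)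
Lemma VS_int (n : nat) : VS (fun i => i%:~R) n = - (qf n ^+ 2 / qf (2 * n).+1).
Proof.
have a1 := adm_int; have a0 : adm (fun=> 1) by apply: (@adm_bd _ 1) => i; rewrite cabs1.
have shU m : US (fun i => (i + 1)%:~R) m = US (fun i => i%:~R) m + US (fun=> 1) m.
  by rewrite -US_D //; apply: eq_US => i; rewrite intrD.
have shV m : VS (fun i => (i - 1)%:~R) m = VS (fun i => i%:~R) m.
  rewrite (@eq_VS (fun i => (i - 1)%:~R) (fun i => i%:~R + (-1) * 1)); last by move=> i; rewrite intrD mulr1.
  have a2 : adm (fun=> (-1) * 1) by apply: (@adm_bd _ 1) => i; rewrite mulr1 cabsN cabs1.
  by rewrite VS_D // VS_Z // VS_1 mulr0 addr0.
elim: n => [|n IH].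
  have := VS_rec 0 a1; rewrite shU US0 (US_1 0) expr0z mul1r mulr0z add0r sub0r.
  rewrite expr1z eqxx add0r mulr1n => h.
  rewrite muln0 qf0 qfS qf0 expr1n !mul1r expr1.
  have k := subr1X_neq0 q1 0; rewrite expr1 in k.
  by apply: (mulfI k); rewrite h mulrN divff.
have h1 := VS_rec n.+1%:Z a1; rewrite shU US_1 addr0 in h1.
have h2 := US_rec n%:Z a1; rewrite shV IH (_ : n%:Z + 1 = n.+1%:Z) in h2; last by lia.
have d1 : 1 - q ^ (2 * n.+1%:Z + 1) != 0 by apply: subr1z_neq0; lia.
have d2 : 1 - q ^ (2 * n%:Z + 2) != 0 by apply: subr1z_neq0; lia.
apply: (mulfI d1); rewrite h1; apply: (mulfI d2).
have -> : forall c a b : C, c * (a - b * a) = (c * a) * (1 - b) by move=> *; ring.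
rewrite h2 mulnS !addSn add0n !qfS.
rewrite (_ : (2 * n.+1%:Z + 1) = (2 * n).+3%:Z); last by lia.
rewrite (_ : (2 * n%:Z + 2) = (2 * n).+2%:Z) -?exprnP; last by lia.
have k1 := subr1X_neq0 q1 (2 * n); have k2 := subr1X_neq0 q1 (2 * n).+1.
have k4 := subr1X_neq0 q1 (2 * n).+2.
have k3 := qf_neq0 q1 (2 * n).
by field; rewrite k1 k2 k3 k4.
Qed.

(** For fixed i both arguments tend to infinity with n, so each factor [iq] tends to 1 / (q)_oo;
    their uniform bound allows the limit under the sum. *)
Lemma clim_iqq x (g h : nat -> int -> int) : adm x ->
  (forall (n : nat) i, n%:Z - `|i| <= g n i) -> (forall (n : nat) i, n%:Z - `|i| <= h n i) ->
  clim (fun n : nat => tsum (fun i => x i * (th i * (iq (g n i) * iq (h n i)))))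
       (tsum (fun i => x i * th i) / qinf q ^+ 2).
Proof.
move=> ax hg hh; have [B hB] := iqq_bound.
have a0 : absum (fun i => x i * th i).
  by have := ax 0; apply: eq_absum => i; rewrite addr0.
rewrite mulrC -tsumZ //; apply: (tannery (g := fun i => B%:C * (x i * th i))).
- exact: absumZ.
- move=> n i; rewrite mulrA [leLHS]cabsM mulrC [leRHS]cabsM cabs_real.
  by rewrite ler_wpM2r ?cabs_ge0 // (le_trans (hB _ _)) // ler_norm.
move=> i; rewrite mulrC.
have h1 := clim_iq q0 q1 (c := `|i|) (hg^~ i).
have h2 := clim_iq q0 q1 (c := `|i|) (hh^~ i).
have := climM (@clim_cst _ (x i * th i)) (climM h1 h2); rewrite -invfM -expr2.
by apply: clim_ext => n; ring.
Qed.

Lemma clim_US x : adm x ->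
  clim (fun n : nat => US x n) (tsum (fun i => x i * th i) / qinf q ^+ 2).
Proof. by move=> ax; apply: (clim_iqq ax) => n i; lia. Qed.

Lemma clim_VS x : adm x ->
  clim (fun n : nat => VS x n) (tsum (fun i => x i * th i) / qinf q ^+ 2).
Proof. by move=> ax; apply: (clim_iqq ax) => n i; lia. Qed.

Lemma clim_qf_sub (g : nat -> nat) : (forall n : nat, (n <= g n)%N) ->
  clim (fun n : nat => qf (g n)) (qinf q).
Proof. by move=> h; apply: (clim_sub h); have [] := clim_qf q1. Qed.

Lemma jacobi_cube : tsum (fun i : int => i%:~R * th i) = - qinf q ^+ 3.
Proof.
have Q0 := qinf_neq0 q1.
have h1 := clim_VS adm_int.
have h2 : clim (fun n : nat => VS (fun i => i%:~R) n) (- (qinf q ^+ 2 / qinf q)).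
  have c1 : clim qf (qinf q) by apply: clim_qf_sub.
  have c2 : clim (fun n : nat => (qf (2 * n).+1)^-1) (qinf q)^-1.
    by apply: climV => //; apply: (clim_qf_sub (g := fun n : nat => (2 * n).+1)) => n; lia.
  have := climM (@clim_cst _ (-1)) (climM (climM c1 c1) c2).
  rewrite mulN1r -expr2; apply: clim_ext => n.
  by rewrite VS_int mulN1r expr2.
have := clim_unique h1 h2 => e.
have -> : tsum (fun i : int => i%:~R * th i)
  = tsum (fun i : int => i%:~R * th i) / qinf q ^+ 2 * qinf q ^+ 2 by field.
by rewrite e; field.
Qed.

End BaileyPairs.

Section NatSums.
Variable R : realType.
Local Notation C := R[i].

Lemma tsum_natS (f : nat -> C) : absum f -> tsum f = f 0%N + tsum (fun n => f n.+1).
Proof.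
move=> af; rewrite (@tsum_split _ _ _ _ (fun _ : unit => 0%N) S (pred1 0%N)) //.
- congr (_ + _); rewrite (@tsum_fin _ _ _ [:: tt]) ?big_seq1 //.
- by move=> [] [].
- exact: succn_inj.
- by move=> n /eqP ->; exists tt.
- by case=> // n _; exists n.
Qed.

Lemma absum_natS (f : nat -> C) : absum f -> absum (fun n => f n.+1).
Proof. by move=> af; apply: (@absum_comp _ _ _ S) => //; exact: succn_inj. Qed.

Lemma tsum_telescope (T : nat -> C) : absum T -> tsum (fun n => T n.+1 - T n) = - T 0%N.
Proof.
by move=> aT; rewrite tsumB ?(tsum_natS aT) ?opprD ?addrA ?(addrAC _ (- T 0%N)) ?subrr ?add0r //;
  exact: absum_natS.
Qed.

Lemma gauss_absum (q : C) (f : nat -> C) (M : R) : cabs q < 1 ->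
  (forall n, cabs (f n) <= M * cabs q ^+ 'C(n, 2)) -> absum f.
Proof.
move=> q1 hf; have hq : 0 <= cabs q < 1 by rewrite cabs_ge0.
have r0 : 0 < (2^-1 : R) by rewrite invr_gt0.
have [M' hM'] := gauss_bound hq ler01 r0.
have h2 : 0 <= (2^-1 : R) < 1 by lra.
apply: (absum_geom h2 (M := `|M| * M')) => n; apply: le_trans (hf n) _.
have := hM' n; rewrite expr1n mulr1 => h.
rewrite -mulrA; apply: (@le_trans _ _ (`|M| * cabs q ^+ 'C(n, 2))).
  by rewrite ler_wpM2r ?exprn_ge0 ?cabs_ge0 // ler_norm.
by rewrite ler_wpM2l.
Qed.

End NatSums.

(* kpair n = (k_n, k_(n+1)). *)
Fixpoint kpair (R : realType) (q : R[i]) (n : nat) : R[i] * R[i] :=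
  if n is n'.+1 then ((kpair q n').2, 2 + q ^+ n'.+1 * (kpair q n').1) else (1, 2).

HB.lock Definition kz (R : realType) (q : R[i]) (i : int) : R[i] :=
  match i with Posz n => (kpair q n).1 | Negz n => 2 - (kpair q n.+1).1 end.

Lemma leq_mulSn (m n : nat) : (n <= m.+1 * n)%N.
Proof. lia. Qed.

Lemma clim_qf_mul (R : realType) (q : R[i]) (m : nat) : cabs q < 1 ->
  clim (fun n => qf q (m.+1 * n)) (qinf q).
Proof. by move=> q1; apply: (clim_qf_sub q1); exact: leq_mulSn. Qed.

Lemma clim_qf_mulV (R : realType) (q : R[i]) (m : nat) : cabs q < 1 ->
  clim (fun n => (qf q (m.+1 * n))^-1) (qinf q)^-1.
Proof. by move=> q1; apply: climV; [exact: qinf_neq0|exact: clim_qf_mul]. Qed.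

Section KSeq.
Variable R : realType.
Local Notation C := R[i].
Variable q : C.
Hypotheses (q0 : q != 0) (q1 : cabs q < 1).

Local Notation kz := (kz q).

Lemma kz_nat (n : nat) : kz n = (kpair q n).1. Proof. by rewrite kz.unlock. Qed.
Lemma kz_rec (n : nat) : kz n.+2 = 2 + q ^+ n.+1 * kz n. Proof. by rewrite !kz_nat. Qed.
Lemma kz0 : kz 0 = 1. Proof. by rewrite kz_nat. Qed.
Lemma kz1 : kz 1 = 2. Proof. by rewrite kz_nat. Qed.
Lemma kz_Negz (n : nat) : kz (Negz n) = 2 - kz n.+1.
Proof. by rewrite kz.unlock. Qed.

Lemma kz_opp i : kz (- i) = 2 - kz i.
Proof.
case: i => [[|n]|n]; first by rewrite oppr0 kz0; ring.
  by rewrite -NegzE kz_Negz.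
by rewrite kz_Negz NegzE opprK subKr.
Qed.

(** The recursion and the reflection k_(-i) = 2 - k_i in a single relation, valid for all integers.
    It also shows the geometric decay of k_i as i tends to minus infinity. *)
Lemma kz_refl i : kz (- i) = - (q ^ (i - 1) * kz (i - 2)).
Proof.
have pos (n : nat) : kz (- n.+2%:Z) = - (q ^+ n.+1 * kz n).
  by rewrite kz_opp kz_rec opprD addrA subrr add0r.
have [i2|i2] := leP 2 i.
  have [n ->] : exists n : nat, i = n.+2%:Z by exists `|i - 2|%N; lia.
  have e1 : n.+2%:Z - 1 = n.+1%:Z by lia.
  have e2 : n.+2%:Z - 2 = n%:Z by lia.
  by rewrite e1 e2 pos -exprnP.
have [->|i1] := eqVneq i 1.
  have e2 : 1 - 2 = - 1 :> int by lia.
  by rewrite subrr expr0z mul1r e2 kz_opp kz1 subrr oppr0.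
have [m ->] : exists m : nat, i = - m%:Z by exists `|i|%N; lia.
have e1 : - m%:Z - 2 = - m.+2%:Z by lia.
have e2 : - m%:Z - 1 = - m.+1%:Z by lia.
rewrite opprK e1 e2 pos mulrN opprK mulrA exprnP -expfzDr // addNr expr0z mul1r //.
Qed.

Lemma kz_bound : exists B, forall i, cabs (kz i) <= B.
Proof.
(* The witness 2 / (1 - |q|) is the fixed point of the bound that the recursion propagates. *)
have [B [B2 Bq]] : exists B, 2 <= B /\ 2 + cabs q * B = B.
  have c0 := cabs_ge0 q; move: (cabs q) c0 q1 => c c0 c1.
  have d0 : 0 < 1 - c by lra.
  exists (2 / (1 - c)); rewrite ler_pdivlMr //; split; first by lra.
  by field; rewrite gt_eqF.
have two : cabs (2 : C) = 2 by rewrite cabs_nat.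
have h n : cabs (kpair q n).1 <= B /\ cabs (kpair q n).2 <= B.
  elim: n => [|n [h1 h2]] /=; first by rewrite two cabs1; split => //; lra.
  split=> //; apply: le_trans (cabsD _ _) _; rewrite two -[leRHS]Bq lerD2l cabsM.
  apply: ler_pM; rewrite ?cabs_ge0 // cabsX exprS ler_piMr ?exprn_ile1 ?cabs_ge0 //.
  exact: ltW.
exists (2 + B) => -[n|n]; have [h1 h2] := h n; first by rewrite kz_nat; lra.
rewrite kz_Negz kz_nat; by apply: le_trans (cabsB _ _) _; rewrite two lerD2l.
Qed.

Lemma adm_kz j : adm q (fun i => kz (j - i)).
Proof. by have [B hB] := kz_bound; apply: (adm_bd q1 (B := B)). Qed.

Let a1 : adm q (fun=> 1). Proof. by apply: (adm_bd q1 (B := 1)) => i; rewrite cabs1. Qed.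

Local Notation US j n := (US q (fun i => kz (j - i)) n).
Local Notation VS j n := (VS q (fun i => kz (j - i)) n).

(** Under i -> - i the kernel gains the factor q^i and, by [kz_refl], the sequence gains - q^(-i):
    the pairing equals its own negative. *)
Lemma US_kzN1 n : US (-1) n = 0.
Proof.
suff e : US (-1) n = - US (-1) n.
  by apply/eqP; move/eqP: e; rewrite -addr_eq0 -mulr2n mulrn_eq0.
rewrite {1}US_opp // -[RHS]mulN1r -US_Z //; last exact: adm_kz.
apply: eq_US => i; rewrite opprK.
rewrite (_ : -1 - i = - (i + 1)) ?kz_refl; last by lia.
rewrite addrK (_ : i + 1 - 2 = -1 + i); last by lia.
by ring.
Qed.

Lemma shk j m : (fun i => kz (j - (i + m))) = (fun i => kz (j - m - i)).
Proof. by apply/funext => i; congr kz; rewrite opprD addrA addrAC. Qed.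

Lemma VS_kz0_rec n : (1 - q ^ (2 * n + 1)) * VS 0 n = US 0 n.
Proof.
rewrite VS_rec //; last exact: adm_kz.
by rewrite shk sub0r US_kzN1 mulr0 subr0.
Qed.

(** Under i -> 1 - i the kernel changes sign and k_i becomes 2 - k_(-i); the constant 2 pairs to
    0. *)
Lemma VS_kz1 n : VS 1 n = VS 0 n.
Proof.
rewrite [LHS]VS_refl //; last by under eq_fun do rewrite subKr; have [B hB] := kz_bound;
  apply: (adm_bd q1 (B := B)).
rewrite (@eq_VS _ _ _ (fun i => (-1) * kz (0 - i) + 2 * 1)); last first.
  by move=> i; rewrite subKr sub0r kz_opp; ring.
have := adm_kz 0 => a0.
have b1 : adm q (fun i => (-1) * kz (0 - i)).
  have [B hB] := kz_bound; apply: (adm_bd q1 (B := B)) => i.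
  by rewrite mulN1r cabsN.
have b2 : adm q (fun i => 2 * 1).
  by apply: (adm_bd q1 (B := 2)) => i; rewrite mulr1 cabs_nat.
by rewrite VS_D // !VS_Z // VS_1 // mulr0 addr0 mulN1r opprK.
Qed.

Lemma US_kz0_rec n : (1 - q ^ (2 * n + 2)) * US 0 (n + 1) = (1 - q ^ (n + 1)) * VS 0 n.
Proof.
rewrite US_rec //; last exact: adm_kz.
by rewrite shk opprK add0r VS_kz1; ring.
Qed.

(** The ladder closes because [US_kzN1] and [VS_kz1] eliminate the two shifted sequences. *)
Lemma US_kz0 (n : nat) : US 0 n = qf q n / qf q (2 * n).
Proof.
elim: n => [|n IH]; first by rewrite US0 subr0 kz0 muln0 qf0 divr1.
have d1 : 1 - q ^ (2 * n%:Z + 1) != 0 by apply: (subr1z_neq0 q1); lia.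
have d2 : 1 - q ^ (2 * n%:Z + 2) != 0 by apply: (subr1z_neq0 q1); lia.
have h1 := VS_kz0_rec n; have h2 := US_kz0_rec n; rewrite IH in h1.
rewrite (_ : n%:Z + 1 = n.+1%:Z) in h2; last by lia.
apply: (mulfI d2); rewrite h2; apply: (mulfI d1); rewrite mulrCA h1.
rewrite mulnS !addSn add0n !qfS.
rewrite (_ : 2 * n%:Z + 1 = (2 * n).+1%:Z); last by lia.
rewrite (_ : 2 * n%:Z + 2 = (2 * n).+2%:Z) -?exprnP; last by lia.
have k1 := subr1X_neq0 q1 (2 * n); have k2 := subr1X_neq0 q1 (2 * n).+1.
have k3 := qf_neq0 q1 (2 * n).
by field; rewrite k1 k2 k3.
Qed.

Lemma VS_kz0 (n : nat) : VS 0 n = qf q n / qf q (2 * n).+1.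
Proof.
have d1 : 1 - q ^ (2 * n%:Z + 1) != 0 by apply: (subr1z_neq0 q1); lia.
apply: (mulfI d1); rewrite VS_kz0_rec US_kz0 qfS.
rewrite (_ : 2 * n%:Z + 1 = (2 * n).+1%:Z) -?exprnP; last by lia.
have k1 := subr1X_neq0 q1 (2 * n); have k3 := qf_neq0 q1 (2 * n).
by field; rewrite k1 k3.
Qed.

Lemma US_kz1 (n : nat) : US 1 n = (1 + q ^+ n) * (qf q n / qf q (2 * n)).
Proof.
have := @VS_rec _ _ q0 q1 _ n (adm_kz 1).
by rewrite shk subrr VS_kz1 VS_kz0_rec US_kz0 -exprnP => h; rewrite mulrDl mul1r {1}h subrK.
Qed.

Lemma VS_kzN1 (n : nat) : VS (-1) n = q ^+ n.+1 * (qf q n / qf q (2 * n).+1).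
Proof.
have d1 : 1 - q ^ (2 * n%:Z + 1) != 0 by apply: (subr1z_neq0 q1); lia.
apply: (mulfI d1); rewrite VS_rec //; last exact: adm_kz.
rewrite US_kzN1 sub0r shk mulrCA -VS_kz0 VS_kz0_rec.
have -> : US (-1 - 1) n = - q * US 0 n.
  rewrite [in RHS]US_opp // -US_Z //; last first.
    have [B hB] := kz_bound.
    have := adm_exp q1 q0; move=> h m; have := absum_bdM (fun i => hB (0 - - (i + m))) (h m).
    by apply: eq_absum => i; rewrite mulrA.
  apply: eq_US => i; rewrite opprK add0r (_ : -1 - 1 - i = - (i + 2)) ?kz_refl; last by lia.
  rewrite addrK (_ : i + 2 - 1 = i + 1); last by lia.
  by rewrite expfzDr // expr1z; ring.
by rewrite -exprnP exprSr; ring.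
Qed.

(** The limit of [US_kz0]. It is the coefficient at 0 of K(x;q) j(x;q), by which that product is
    normalized later. *)
Lemma clim_kz_theta : tsum (fun i => kz (- i) * th q i) = qinf q ^+ 2.
Proof.
have Q0 := qinf_neq0 q1.
have h1 := clim_US q0 q1 (adm_kz 0).
have h2 : clim (fun n : nat => US 0 n) (qinf q / qinf q).
  have c1 : clim (qf q) (qinf q) by apply: clim_qf_sub.
  have c2 := clim_qf_mulV 1 q1.
  by apply: clim_ext (climM c1 c2) => n; rewrite US_kz0.
have := clim_unique h1 h2; rewrite divff // => /(congr1 (fun y => y * qinf q ^+ 2)).
rewrite divfK ?expf_neq0 // mul1r => <-; apply: eq_tsum => i; by rewrite sub0r.
Qed.

End KSeq.

(** * Euler's pentagonal number theorem *)

Section Pentagonal.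
Variable R : realType.
Local Notation C := R[i].
Variable q : C.
Hypotheses (q0 : q != 0) (q1 : cabs q < 1).

(** The finite triple product with base q^3 and t = q^2: its two products and (q^3;q^3)_n are the
    three residue classes modulo 3 in (q)_(3n). *)
Lemma pentagonal : tsum (fun i : int => q ^ (3 * tri i + 2 * i) * (-1) ^ i) = qinf q.
Proof.
have Q0 : q ^+ 3 != 0 by rewrite expf_neq0.
have Q1 : cabs (q ^+ 3) < 1 by rewrite cabs_exp_lt1.
have t0 : q ^+ 2 != 0 by rewrite expf_neq0.
have hQ := qinf_neq0 Q1.
have h1 := clim_US Q0 Q1 (adm_exp Q1 t0).
have split3 (n : nat) : \prod_(i < n) (1 - (q ^+ 3) ^+ i * q ^+ 2)
    * \prod_(i < n) (1 - (q ^+ 3) ^+ i.+1 / q ^+ 2) * qf (q ^+ 3) n = qf q (3 * n).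
  elim: n => [|n IH]; first by rewrite !big_ord0 muln0 !qf0 !mulr1.
  rewrite mulnS !addSn add0n !qfS -IH !big_ord_recr /=.
  have -> : (q ^+ 3) ^+ n.+1 / q ^+ 2 = q ^+ (3 * n).+1.
    by rewrite -exprM (_ : (3 * n.+1 = (3 * n).+1 + 2)%N) ?exprD ?mulfK //; lia.
  by rewrite -!exprM -exprD (_ : (3 * n + 2 = (3 * n).+2)%N) ?addn2 // mulnS; ring.
have h2 : clim (fun n : nat => US (q ^+ 3) (fun i => (q ^+ 2) ^ i) n)
               (qinf q * ((qinf (q ^+ 3))^-1 * (qinf (q ^+ 3))^-1)).
  have c1 := clim_qf_mul 2 q1.
  have c2 : clim (fun n : nat => (qf (q ^+ 3) n)^-1) (qinf (q ^+ 3))^-1 by exact: clim_qfV.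
  have c3 := clim_qf_mulV 1 Q1.
  apply: clim_ext (climM c1 (climM c2 c3)) => n.
  rewrite (US_VS_exp Q0 Q1 t0) -split3.
  have := qf_neq0 Q1 n; have := qf_neq0 Q1 (2 * n) => k1 k2.
  by field; rewrite k1 k2.
have := clim_unique h1 h2 => /(congr1 (fun y => y * qinf (q ^+ 3) ^+ 2)).
rewrite divfK ?expf_neq0 // => e.
have -> : qinf q = qinf q * ((qinf (q ^+ 3))^-1 * (qinf (q ^+ 3))^-1) * qinf (q ^+ 3) ^+ 2.
  by move: (qinf q) (qinf _) hQ => y z z0; field.
rewrite -e; apply: eq_tsum => i; rewrite th.unlock !exprnP !exprz_exp expfzDr //; ring.
Qed.

End Pentagonal.

Lemma cabs_sign (R : realType) n : cabs ((-1) ^+ n : R[i]) = 1.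
Proof. by rewrite cabsX cabsN cabs1 expr1n. Qed.

(** * The mock theta functions as sums over k *)

Section Limits.
Variable R : realType.
Local Notation C := R[i].

(** Dominated convergence where only the term n = 0 survives. It evaluates the constants of the two
    conjugate Bailey pairs below. *)
Lemma clim_head (f : nat -> nat -> C) (c : C) (M : R) (L : C) : cabs c < 1 ->
  (forall m n, cabs (f m n) <= M * cabs c ^+ 'C(n, 2)) ->
  (forall m n, cabs (f m n.+1) <= M * cabs c ^+ m) ->
  clim (f ^~ 0%N) L -> clim (fun m => tsum (f m)) L.
Proof.
move=> c1 h1 h2 h0; have M0 : 0 <= M.
  by have := h1 0%N 0%N; rewrite expr0 mulr1; apply: le_trans; exact: cabs_ge0.
pose f0 n := if n == 0%N then L else 0.
have -> : L = tsum f0.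
  rewrite (@tsum_fin _ _ _ [:: 0%N]) ?big_seq1 // => i.
  by rewrite inE /f0 => /negPf ->.
apply: (tannery (g := fun n => M%:C * c ^+ 'C(n, 2))).
- apply: (@gauss_absum _ c _ M c1) => n.
  by rewrite cabsM cabs_real cabsX ger0_norm.
- by move=> m n; rewrite cabsM cabs_real cabsX ger0_norm.
case=> [|n]; first exact: h0.
apply: (clim_squeeze (a := fun m => M * cabs c ^+ m)).
  by move=> m; rewrite subr0.
move=> e e0; have e1 : 0 < e / (M + 1) by rewrite divr_gt0 // ltr_wpDl.
have hc : 0 <= cabs c < 1 by rewrite cabs_ge0.
have [N hN] := exprn_small hc e1; exists N => m /hN.
rewrite ltr_pdivlMr ?ltr_wpDl // => h; apply: le_lt_trans h.
by rewrite mulrDr mulr1 mulrC lerDl exprn_ge0 // cabs_ge0.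
Qed.

End Limits.

Section Bailey.
Variable R : realType.
Local Notation C := R[i].
Variable q : C.
Hypotheses (q0 : q != 0) (q1 : cabs q < 1).

(** The Bailey transform, that is, an exchange of the sums over n and i. *)
Lemma bailey_sum (d : nat -> C) (w x : int -> C) (c : nat -> int -> C) (B : R) :
  absum d -> adm q x -> (forall n i, cabs (c n i) <= B) ->
  (forall i, tsum (fun n => d n * c n i) = w i) ->
  tsum (fun n => d n * tsum (fun i => x i * (th q i * c n i)))
    = tsum (fun i => x i * (th q i * w i)).
Proof.
move=> ad ax hB hw.
have ax0 : absum (fun i => x i * th q i).
  by have := ax 0; apply: eq_absum => i; rewrite addr0.
pose F (p : nat * int) := d p.1 * (x p.2 * (th q p.2 * c p.1 p.2)).
have aF : absum F.
  have := absum_bdM (fun p : nat * int => hB p.1 p.2) (absum_mul ad ax0).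
  by apply: eq_absum => -[n i]; rewrite /F /=; ring.
transitivity (tsum (fun n => tsum (fun i => F (n, i)))).
  apply: eq_tsum => n; rewrite -tsumZ //.
  have := absum_bdM (hB n) ax0; apply: eq_absum => i; ring.
rewrite tsum_swap //; apply: eq_tsum => i.
rewrite -hw -tsumZ; last by have := absum_bdM (hB^~ i) ad; apply: eq_absum => n; ring.
rewrite -tsumZ; first by apply: eq_tsum => n; rewrite /F /=; ring.
by apply: absumZ; have := absum_bdM (hB^~ i) ad; apply: eq_absum => n; ring.
Qed.

End Bailey.

Section MockX.
Variable R : realType.
Local Notation C := R[i].
Variable s : C.
Hypotheses (s0 : s != 0) (s1 : cabs s < 1).
Local Notation q := (s ^+ 2).
Let q0 : q != 0. Proof. by rewrite expf_neq0. Qed.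
Let q1 : cabs q < 1. Proof. exact: cabs_sqr1. Qed.
Local Notation iq := (iq q).

(** Since (-s;s)_(2n) = (q)_(2n) / (s;s)_(2n) with q = s^2, the n-th term of X_10(s) is [dX n] times
    the value found in [US_kz0]. *)
Definition dX (n : nat) : C := (-1) ^+ n * s ^+ (n ^ 2) * (qf s (2 * n) / qf q n).

Definition aX : C := qinf s / qinf q ^+ 2.

Lemma dXS n : dX n.+1 = - (s ^+ (2 * n).+1 * (1 - s ^+ (2 * n).+1)) * dX n.
Proof.
rewrite /dX mulnS !addSn add0n !qfS.
have -> : s ^+ (n.+1 ^ 2) = s ^+ (n ^ 2) * s ^+ (2 * n).+1.
  by rewrite -exprD; congr (_ ^+ _); lia.
have -> : 1 - q ^+ n.+1 = 1 - s ^+ (2 * n).+2.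
  by rewrite -exprM mulnS.
have k1 := subr1X_neq0 s1 (2 * n).+1; have k3 := qf_neq0 q1 n.
rewrite exprS; move: (s ^+ _) (s ^+ _) (s ^+ _) (qf _ _) (qf _ _) ((-1) ^+ n) k1 k3.
by move=> a b c d e f k1 k3; field; rewrite k1 k3.
Qed.

Lemma dX_bound : exists M, forall n, cabs (dX n) <= M * cabs s ^+ (n ^ 2).
Proof.
have [B hB] := qf_bounds s1; have [B' hB'] := qf_bounds q1; exists (B * B') => n.
rewrite /dX !cabsM cabs_sign mul1r cabsX mulrC ler_wpM2r ?exprn_ge0 ?cabs_ge0 //.
by rewrite ler_pM ?cabs_ge0 //; [have [] := hB (2 * n)%N|have [] := hB' n].
Qed.

Lemma exp_bin_le (c : C) (n m : nat) : cabs c < 1 -> ('C(n, 2) <= m)%N ->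
  cabs c ^+ m <= cabs c ^+ 'C(n, 2).
Proof. by move=> c1 h; apply: ler_wiXn2l; rewrite ?cabs_ge0 // ltW. Qed.

Lemma bin2_le_sqr (n m : nat) : ('C(n, 2) <= n ^ 2 + m)%N.
Proof.
apply: leq_trans (leq_addr _ _); elim: n => // n IH; rewrite binS bin1; lia.
Qed.

Lemma absum_dX : absum dX.
Proof.
have [M hM] := dX_bound; apply: (@gauss_absum _ s _ `|M| s1) => n.
apply: le_trans (hM n) _; apply: (@le_trans _ _ (`|M| * cabs s ^+ (n ^ 2))).
  by rewrite ler_wpM2r ?exprn_ge0 ?cabs_ge0 // ler_norm.
by rewrite ler_wpM2l // exp_bin_le // -[X in (_ <= X)%N]addn0 bin2_le_sqr.
Qed.

Definition GX (i : int) : C := tsum (fun n : nat => dX n * (iq (n%:Z - i) * iq (n%:Z + i))).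

Lemma absum_dX_iq (g h : nat -> int) : absum (fun n => dX n * (iq (g n) * iq (h n))).
Proof.
have [B hB] := iqq_bound q1.
by have := absum_bdM (fun n => hB (g n) (h n)) absum_dX; apply: eq_absum => n; rewrite mulrC.
Qed.

(* Zeilberger-style telescoping: the combination of summands is a difference in n. *)
Lemma GX_rec (m : nat) : GX m.+1 = - s ^+ (2 * m).+1 * GX m.
Proof.
pose T (n : nat) := dX n * (iq (n%:Z - m%:Z - 1) * iq (n%:Z + m%:Z)).
have aT : absum T by exact: absum_dX_iq.
have T0 : T 0%N = 0.
  by rewrite /T (_ : 0%:Z - m%:Z - 1 = Negz m) ?mul0r ?mulr0 //; lia.
have a1 := absum_dX_iq (fun n => n%:Z - m.+1%:Z) (fun n => n%:Z + m.+1%:Z).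
have a2 := absum_dX_iq (fun n => n%:Z - m%:Z) (fun n => n%:Z + m%:Z).
apply/eqP; rewrite mulNr -addr_eq0 /GX -tsumZ // -tsumD //; last exact: absumZ.
apply/eqP; transitivity (tsum (fun n => - (1 + s ^+ (2 * m).+1) * (T n.+1 - T n))).
  apply: eq_tsum => n; rewrite /T dXS.
  have -> : n%:Z - m.+1%:Z = n%:Z - m%:Z - 1 by lia.
  have -> : n%:Z + m%:Z = n%:Z + m.+1%:Z - 1 by lia.
  have -> : n.+1%:Z - m%:Z - 1 = n%:Z - m%:Z by lia.
  have -> : n.+1%:Z + m%:Z = n%:Z + m.+1%:Z by lia.
  rewrite !(iq_pred q0 q1).
  have E1 : q ^ (n%:Z - m%:Z) = s ^+ (2 * n) / s ^+ (2 * m).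
    by rewrite expfzDr // -invr_expz -!exprnP -!exprM.
  have E2 : q ^ (n%:Z + m.+1%:Z) = s ^+ (2 * n) * (s ^+ (2 * m) * (s * s)).
    by rewrite expfzDr // -!exprnP -!exprM mulnS !exprD expr2; ring.
  have k : s ^+ (2 * m) != 0 by rewrite expf_neq0.
  rewrite E1 E2 (exprS s (2 * n)) (exprS s (2 * m)); move: (s ^+ (2 * n)) (s ^+ (2 * m)) (dX n) (iq _) (iq _) k.
  by move=> X Y d a b k; field; rewrite k.
rewrite tsumZ; first by rewrite tsum_telescope // T0 oppr0 mulr0.
by apply: absumB => //; exact: absum_natS.
Qed.

Lemma GX_nat (m : nat) : GX m = (-1) ^+ m * s ^+ (m ^ 2) * GX 0.
Proof.
elim: m => [|m IH]; first by rewrite !expr0 !mul1r.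
rewrite GX_rec IH (_ : (m.+1 ^ 2 = (2 * m).+1 + m ^ 2)%N); last by lia.
by rewrite exprD (exprS (-1) m); ring.
Qed.

(** The nonzero terms of [GX m], after division by the factor (-1)^m s^(m^2) that the recursion
    predicts. *)
Definition HX (m n : nat) : C :=
  (-1) ^+ n * s ^+ (n ^ 2 + 2 * m * n) * (qf s (2 * (m + n)) / qf q (m + n))
    * ((qf q n)^-1 * (qf q (2 * m + n))^-1).

Lemma GX_HX (m : nat) : GX m = (-1) ^+ m * s ^+ (m ^ 2) * tsum (HX m).
Proof.
have a1 := absum_dX_iq (fun n => n%:Z - m%:Z) (fun n => n%:Z + m%:Z).
have E n : dX (m + n) * (iq ((m + n)%N%:Z - m%:Z) * iq ((m + n)%N%:Z + m%:Z))
           = (-1) ^+ m * s ^+ (m ^ 2) * HX m n.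
  have -> : (m + n)%N%:Z - m%:Z = n by lia.
  have -> : (m + n)%N%:Z + m%:Z = (2 * m + n)%N by lia.
  rewrite /dX /HX /= (_ : ((m + n) ^ 2 = m ^ 2 + (n ^ 2 + 2 * m * n))%N); last by lia.
  by rewrite !exprD; ring.
have inj : injective (addn m) by exact: addnI.
have aC := absum_comp inj a1.
rewrite /GX (tsum_inj (h := addn m)) //.
  rewrite -tsumZ; first by apply: eq_tsum => n /=; exact: E.
  have k : (-1) ^+ m * s ^+ (m ^ 2) != 0 by rewrite mulf_neq0 ?signr_eq0 ?expf_neq0.
  have := absumZ ((-1) ^+ m * s ^+ (m ^ 2))^-1 aC.
  by apply: eq_absum => n /=; rewrite E mulKf.
move=> i hi; case: (leqP m i) => him; first by have := hi (i - m)%N; rewrite subnKC ?eqxx.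
have -> : i%:Z - m%:Z = Negz (m - i.+1) by lia.
by rewrite mul0r mulr0.
Qed.

(* tsum (HX m) is independent of m by GX_HX and GX_nat; only its term n = 0 survives
   as m tends to infinity. *)
Lemma GX0 : GX 0 = aX.
Proof.
have e m : tsum (HX m) = GX 0.
  have k : (-1) ^+ m * s ^+ (m ^ 2) != 0 by rewrite mulf_neq0 ?signr_eq0 ?expf_neq0.
  by apply: (mulfI k); rewrite -GX_HX GX_nat.
have [B hB] := qf_bounds s1; have [B' hB'] := qf_bounds q1.
have B0 : 0 <= B by have [h _] := hB 0%N; apply: le_trans h; exact: cabs_ge0.
have B'0 : 0 <= B' by have [h _] := hB' 0%N; apply: le_trans h; exact: cabs_ge0.
pose M := B * B' * (B' * B').
have hM m n : cabs (HX m n) <= M * cabs s ^+ (n ^ 2 + 2 * m * n).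
  rewrite /HX !cabsM cabs_sign mul1r [in leLHS]cabsX.
  rewrite -mulrA mulrC ler_wpM2r ?exprn_ge0 ?cabs_ge0 //.
  have [h1 _] := hB (2 * (m + n))%N; have [_ h2] := hB' (m + n)%N.
  have [_ h3] := hB' n; have [_ h4] := hB' (2 * m + n)%N.
  by rewrite /M; repeat apply: ler_pM; rewrite ?mulr_ge0 ?cabs_ge0.
have M0 : 0 <= M by rewrite /M !mulr_ge0.
apply: (@clim_unique _ (fun m => tsum (HX m))).
  by apply: clim_ext (@clim_cst _ (GX 0)) => m; rewrite e.
apply: (@clim_head _ _ s M _ s1).
- move=> m n; apply: le_trans (hM m n) _; rewrite ler_wpM2l //.
  by rewrite exp_bin_le // bin2_le_sqr.
- move=> m n; apply: le_trans (hM m n.+1) _; rewrite ler_wpM2l //.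
  apply: ler_wiXn2l; rewrite ?cabs_ge0 ?(ltW s1) //; nia.
have c1 := clim_qf_mul 1 s1; have c2 := clim_qf_mulV 0 q1; have c3 := clim_qf_mulV 1 q1.
have -> : aX = qinf s * (qinf q)^-1 * (qinf q)^-1 by rewrite /aX expr2 invfM mulrA.
apply: clim_ext (climM (climM c1 c2) c3) => m; rewrite /HX !muln0 !addn0 expr0 mul1r exp0n // expr0 mul1r.
by rewrite qf0 invr1 mul1r mul1n.
Qed.

Lemma GXE (i : int) : GX i = aX * ((-1) ^ i * s ^ (i * i)).
Proof.
have hn (n : nat) : GX n = aX * ((-1) ^ n%:Z * s ^ (n%:Z * n%:Z)).
  by rewrite GX_nat GX0 -PoszM -!exprnP mulnn; ring.
have hN j : GX (- j) = GX j.
  by apply: eq_tsum => n; rewrite opprK [X in _ * X]mulrC.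
case: i => n; first exact: hn.
by rewrite NegzE hN hn sgnzN mulrNN.
Qed.

Lemma sum_dX_US x : adm q x ->
  tsum (fun n : nat => dX n * US q x n) = aX * tsum (fun i => x i * s ^ (2 * (i * i) - i)).
Proof.
move=> ax; have [B hB] := iqq_bound q1.
have hB' (n : nat) i : cabs (iq (n%:Z - i) * iq (n%:Z + i)) <= B by exact: hB.
rewrite (bailey_sum absum_dX ax hB' GXE).
have E i : th q i * ((-1) ^ i * s ^ (i * i)) = s ^ (2 * (i * i) - i).
  have -> : s ^ (2 * (i * i) - i) = q ^ tri i * s ^ (i * i).
    by rewrite exprnP exprz_exp -expfzDr //; congr (_ ^ _); have := triE i; lia.
  have := sgnzz R i; rewrite thE; move: ((-1) ^ i) (q ^ _) (s ^ _) => a b c h.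
  by rewrite -[RHS]mul1r -h; ring.
rewrite -tsumZ; first by apply: eq_tsum => i; rewrite -E; ring.
have ax0 : absum (fun i => x i * th q i).
  by have := ax 0; apply: eq_absum => i; rewrite addr0.
have b1 i : cabs ((-1) ^ i * s ^ (i * i)) <= 1.
  by rewrite cabsM cabs_signz mul1r cabs_qz // -expr2 sqr_ge0.
have := absum_bdM b1 ax0; apply: eq_absum => i; rewrite -E; ring.
Qed.

Lemma qpochN m : qpoch (- s) s m * qf s m = qf q m.
Proof.
rewrite /qpoch /qf -big_split /=; apply: eq_bigr => i _.
by rewrite -exprM mulnC exprM exprSr; ring.
Qed.

Lemma qpochN_neq0 m : qpoch (- s) s m != 0.
Proof. by have := qf_neq0 q1 m; rewrite -qpochN mulf_eq0 negb_or => /andP[]. Qed.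

Lemma qpochNE n : (-1) ^+ n * s ^+ (n ^ 2) / qpoch (- s) s (2 * n)
  = dX n * (qf q n / qf q (2 * n)).
Proof.
rewrite /dX -(qpochN (2 * n)).
have := qf_neq0 s1 (2 * n); have := qf_neq0 q1 n; have := qpochN_neq0 (2 * n).
move: (qpoch (- s) s (2 * n)) (qf s (2 * n)) (qf q n) ((-1) ^+ n) (s ^+ (n ^ 2)) => a b c d e.
move=> a0 b0 c0.
by field; rewrite a0 b0 c0.
Qed.

Lemma absum_dX_bd (u : nat -> C) (B : R) : (forall n, cabs (u n) <= B) ->
  absum (fun n => dX n * u n).
Proof.
by move=> hB; have := absum_bdM hB absum_dX; apply: eq_absum => n; rewrite mulrC.
Qed.

Lemma qf_ratio_bound : exists B, forall n, cabs (qf q n / qf q (2 * n)) <= B.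
Proof.
have [B hB] := qf_bounds q1; exists (B * B) => n.
rewrite cabsM; have [h1 _] := hB n; have [_ h2] := hB (2 * n)%N.
by apply: ler_pM; rewrite ?cabs_ge0.
Qed.

Lemma X10E : X10 s = aX * tsum (fun i => kz q (- i) * s ^ (2 * (i * i) - i)).
Proof.
have [B hB] := qf_ratio_bound; have aD := absum_dX_bd hB.
rewrite /X10 csum_tsum; last by apply: eq_absum aD => n; rewrite qpochNE.
under eq_tsum do rewrite qpochNE -(US_kz0 q0 q1).
rewrite (sum_dX_US (adm_kz q1 0)); congr (_ * _).
by apply: eq_tsum => i; rewrite sub0r.
Qed.

Lemma qpochNS n : (-1) ^+ n * s ^+ (n.+1 ^ 2) / qpoch (- s) s (2 * n).+1
  = - (dX n.+1 * ((1 + q ^+ n.+1) * (qf q n.+1 / qf q (2 * n.+1)))).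
Proof.
rewrite mulrCA -qpochNE mulnS !addSn add0n.
have P : qpoch (- s) s (2 * n).+2 = qpoch (- s) s (2 * n).+1 * (1 + q ^+ n.+1).
  rewrite /qpoch big_ord_recr /=; congr (_ * _).
  by rewrite mulrN opprK -exprSr -exprM mulnS.
have := qpochN_neq0 (2 * n).+2; rewrite P mulf_eq0 negb_or => /andP[].
rewrite (exprS (-1) n).
move: (qpoch (- s) s (2 * n).+1) (1 + q ^+ n.+1) ((-1) ^+ n) (s ^+ (n.+1 ^ 2)) => a b c d a0 b0.
by field; rewrite a0 b0.
Qed.

(** The 2 is the term n = 0 of the sum of [dX n] times [US_kz1]; the later terms are those of chi_10
    with opposite sign, moved by one index. *)
Lemma chi10E : 2 - chi10 s = aX * tsum (fun i => kz q (1 - i) * s ^ (2 * (i * i) - i)).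
Proof.
have [B hB] := qf_ratio_bound.
pose u n := (1 + q ^+ n) * (qf q n / qf q (2 * n)).
have hu n : cabs (u n) <= 2 * B.
  rewrite /u cabsM; apply: ler_pM; rewrite ?cabs_ge0 //.
  apply: le_trans (cabsD _ _) _; rewrite cabs1 cabsX.
  have : cabs q ^+ n <= 1 by rewrite exprn_ile1 ?cabs_ge0 // ltW.
  by rewrite mulr2n lerD2l.
have aD := absum_dX_bd hu; have aDS := absum_natS aD.
rewrite -(sum_dX_US (adm_kz q1 1)).
under [RHS]eq_tsum do rewrite (US_kz1 q0 q1).
rewrite (tsum_natS aD) {1}/u muln0 expr0 qf0 divr1 {1}/dX muln0 !qf0 divr1 !expr0.
rewrite !mulr1 /chi10 csum_tsum; last first.
  by apply: eq_absum (absumN aDS) => n; rewrite qpochNS.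
under eq_tsum do rewrite qpochNS.
by rewrite tsumN // opprK mul1r.
Qed.

(** The constant sequence pairs to 0 except at n = 0. This is Gauss's product for the series over
    the triangular numbers. *)
Lemma aX_norm : aX * tsum (fun i => s ^ (2 * (i * i) - i)) = 1.
Proof.
have a1 : adm q (fun=> 1) by apply: (adm_bd q1 (B := 1)) => i; rewrite cabs1.
have := sum_dX_US a1; under [in RHS]eq_tsum do rewrite mul1r.
move=> <-; under eq_tsum do rewrite (US_1 q0 q1).
rewrite (@tsum_fin _ _ _ [:: 0%N]) ?big_seq1 //.
  by rewrite /dX muln0 !qf0 divr1 !expr0 !mulr1.
by move=> n; rewrite inE => /negPf ->; rewrite mulr0.
Qed.

End MockX.

Section MockPhi.
Variable R : realType.
Local Notation C := R[i].
Variable q : C.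
Hypotheses (q0 : q != 0) (q1 : cabs q < 1).
Local Notation Q := (q ^+ 2).
Let Q0 : Q != 0. Proof. by rewrite expf_neq0. Qed.
Let Q1 : cabs Q < 1. Proof. exact: cabs_sqr1. Qed.
Local Notation iq := (iq q).

(** This is q^(n(n+1)/2) (-q;q)_n; multiplied by the value in [VS_kz0] it is the n-th term of
    phi_10. *)
Definition dP (n : nat) : C := q ^+ 'C(n.+1, 2) * (qf Q n / qf q n).

Definition aP : C := qinf Q / qinf q ^+ 2.

Lemma dPS n : dP n.+1 = q ^+ n.+1 * (1 + q ^+ n.+1) * dP n.
Proof.
rewrite /dP binS bin1 addnC exprD !qfS.
have -> : 1 - Q ^+ n.+1 = (1 - q ^+ n.+1) * (1 + q ^+ n.+1).
  by rewrite -exprM mulnC exprM; ring.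
have k1 := subr1X_neq0 q1 n; have k3 := qf_neq0 q1 n.
move: (q ^+ n.+1) (q ^+ 'C(n.+1, 2)) (qf Q n) (qf q n) k1 k3 => a b c d k1 k3.
by field; rewrite k1 k3.
Qed.

Lemma dP_bound : exists M, forall n, cabs (dP n) <= M * cabs q ^+ 'C(n.+1, 2).
Proof.
have [B hB] := qf_bounds Q1; have [B' hB'] := qf_bounds q1; exists (B * B') => n.
rewrite /dP !cabsM [cabs (q ^+ _)]cabsX mulrC ler_wpM2r ?exprn_ge0 ?cabs_ge0 //.
by rewrite ler_pM ?cabs_ge0 //; [have [] := hB n|have [] := hB' n].
Qed.

Lemma bin2_leS (n m : nat) : ('C(n, 2) <= 'C(n.+1, 2) + m)%N.
Proof. by apply: leq_trans (leq_addr _ _); rewrite binS leq_addr. Qed.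

Lemma absum_dP : absum dP.
Proof.
have [M hM] := dP_bound; apply: (@gauss_absum _ q _ `|M| q1) => n.
apply: le_trans (hM n) _; apply: (@le_trans _ _ (`|M| * cabs q ^+ 'C(n.+1, 2))).
  by rewrite ler_wpM2r ?exprn_ge0 ?cabs_ge0 // ler_norm.
by rewrite ler_wpM2l // exp_bin_le // -[X in (_ <= X)%N]addn0 bin2_leS.
Qed.

Definition GP (i : int) : C :=
  tsum (fun n : nat => dP n * (iq (n%:Z + 1 - i) * iq (n%:Z + i))).

Lemma absum_dP_iq (g h : nat -> int) : absum (fun n => dP n * (iq (g n) * iq (h n))).
Proof.
have [B hB] := iqq_bound q1.
by have := absum_bdM (fun n => hB (g n) (h n)) absum_dP; apply: eq_absum => n; rewrite mulrC.
Qed.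

(** Telescoping in n as for [GX_rec], with [T] as certificate. The recursion starts at index 1
    because [GP] is symmetric under i -> 1 - i. *)
Lemma GP_rec (m : nat) : GP m.+2 = q ^+ m.+1 * GP m.+1.
Proof.
pose T (n : nat) := dP n * (iq (n%:Z - m.+1%:Z) * iq (n%:Z + m.+1%:Z)).
have aT : absum T by exact: absum_dP_iq.
have T0 : T 0%N = 0.
  by rewrite /T (_ : 0%:Z - m.+1%:Z = Negz m) ?mul0r ?mulr0 //; lia.
have a1 := absum_dP_iq (fun n => n%:Z + 1 - m.+2%:Z) (fun n => n%:Z + m.+2%:Z).
have a2 := absum_dP_iq (fun n => n%:Z + 1 - m.+1%:Z) (fun n => n%:Z + m.+1%:Z).
apply/eqP; rewrite -subr_eq0 /GP -tsumZ // -tsumB //; last exact: absumZ.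
apply/eqP; transitivity (tsum (fun n => - (1 - q ^+ m.+1) * (T n.+1 - T n))).
  apply: eq_tsum => n; rewrite /T dPS.
  have -> : n%:Z + 1 - m.+2%:Z = n%:Z + 1 - m.+1%:Z - 1 by lia.
  have -> : n%:Z - m.+1%:Z = n%:Z + 1 - m.+1%:Z - 1 by lia.
  have -> : n%:Z + m.+1%:Z = n%:Z + m.+2%:Z - 1 by lia.
  have -> : n.+1%:Z - m.+1%:Z = n%:Z + 1 - m.+1%:Z by lia.
  have -> : n.+1%:Z + m.+1%:Z = n%:Z + m.+2%:Z by lia.
  rewrite !(iq_pred q0 q1).
  have E1 : q ^ (n%:Z + 1 - m.+1%:Z) = q ^+ n.+1 / q ^+ m.+1.
    by rewrite -PoszD addn1 expfzDr // -invr_expz -!exprnP.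
  have E2 : q ^ (n%:Z + m.+2%:Z) = q ^+ n.+1 * q ^+ m.+1.
    by rewrite -PoszD -exprnP -exprD; congr (_ ^+ _); lia.
  have k : q ^+ m.+1 != 0 by rewrite expf_neq0.
  rewrite E1 E2; move: (q ^+ n.+1) (q ^+ m.+1) (dP n) (iq _) (iq _) k.
  by move=> X Y d a b k; field; rewrite k.
rewrite tsumZ; first by rewrite tsum_telescope // T0 oppr0 mulr0.
by apply: absumB => //; exact: absum_natS.
Qed.

Lemma GP_nat (m : nat) : GP m.+1 = q ^+ 'C(m.+1, 2) * GP 1.
Proof.
elim: m => [|m IH]; first by rewrite binS bin1 expr0 mul1r.
by rewrite GP_rec IH (binS m.+1 1) bin1 addnC exprD mulrA.
Qed.

Definition HP (m n : nat) : C :=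
  q ^+ ('C(n.+1, 2) + m * n) * (qf Q (m + n) / qf q (m + n))
    * ((qf q n)^-1 * (qf q (2 * m + n).+1)^-1).

Lemma bin2D (m n : nat) : 'C((m + n).+1, 2) = ('C(m.+1, 2) + ('C(n.+1, 2) + m * n))%N.
Proof.
elim: m => [|m IH]; first by rewrite mul0n addn0.
by rewrite addSn binS bin1 IH (binS m.+1 1) bin1; lia.
Qed.

Lemma GP_HP (m : nat) : GP m.+1 = q ^+ 'C(m.+1, 2) * tsum (HP m).
Proof.
have a1 := absum_dP_iq (fun n => n%:Z + 1 - m.+1%:Z) (fun n => n%:Z + m.+1%:Z).
have E n : dP (m + n) * (iq ((m + n)%N%:Z + 1 - m.+1%:Z) * iq ((m + n)%N%:Z + m.+1%:Z))
           = q ^+ 'C(m.+1, 2) * HP m n.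
  have -> : (m + n)%N%:Z + 1 - m.+1%:Z = n by lia.
  have -> : (m + n)%N%:Z + m.+1%:Z = (2 * m + n).+1 by lia.
  rewrite /dP /HP /= bin2D (exprD q 'C(m.+1, 2)).
  by rewrite -!mulrA.
have inj : injective (addn m) by exact: addnI.
have aC := absum_comp inj a1.
rewrite /GP (tsum_inj (h := addn m)) //.
  rewrite -tsumZ; first by apply: eq_tsum => n /=; exact: E.
  have k : q ^+ 'C(m.+1, 2) != 0 by rewrite expf_neq0.
  have := absumZ (q ^+ 'C(m.+1, 2))^-1 aC.
  by apply: eq_absum => n /=; rewrite E mulKf.
move=> i hi; case: (leqP m i) => him; first by have := hi (i - m)%N; rewrite subnKC ?eqxx.
have -> : i%:Z + 1 - m.+1%:Z = Negz (m - i.+1) by lia.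
by rewrite mul0r mulr0.
Qed.

Lemma GP1 : GP 1 = aP.
Proof.
have e m : tsum (HP m) = GP 1.
  have k : q ^+ 'C(m.+1, 2) != 0 by rewrite expf_neq0.
  by apply: (mulfI k); rewrite -GP_HP GP_nat.
have [B hB] := qf_bounds Q1; have [B' hB'] := qf_bounds q1.
have B0 : 0 <= B by have [h _] := hB 0%N; apply: le_trans h; exact: cabs_ge0.
have B'0 : 0 <= B' by have [h _] := hB' 0%N; apply: le_trans h; exact: cabs_ge0.
pose M := B * B' * (B' * B').
have hM m n : cabs (HP m n) <= M * cabs q ^+ ('C(n.+1, 2) + m * n).
  rewrite /HP !cabsM [cabs (q ^+ _)]cabsX.
  rewrite -mulrA mulrC ler_wpM2r ?exprn_ge0 ?cabs_ge0 //.
  have [h1 _] := hB (m + n)%N; have [_ h2] := hB' (m + n)%N.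
  have [_ h3] := hB' n; have [_ h4] := hB' (2 * m + n).+1.
  by rewrite /M; repeat apply: ler_pM; rewrite ?mulr_ge0 ?cabs_ge0.
have M0 : 0 <= M by rewrite /M !mulr_ge0.
apply: (@clim_unique _ (fun m => tsum (HP m))).
  by apply: clim_ext (@clim_cst _ (GP 1)) => m; rewrite e.
apply: (@clim_head _ _ q M _ q1).
- move=> m n; apply: le_trans (hM m n) _; rewrite ler_wpM2l //.
  by rewrite exp_bin_le // bin2_leS.
- move=> m n; apply: le_trans (hM m n.+1) _; rewrite ler_wpM2l //.
  apply: ler_wiXn2l; rewrite ?cabs_ge0 ?(ltW q1) // mulnS; lia.
have c1 := clim_qf_mul 0 Q1; have c2 := clim_qf_mulV 0 q1.
have c3 : clim (fun n => (qf q (2 * n).+1)^-1) (qinf q)^-1.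
  by apply: (clim_sub (g := fun n : nat => (2 * n).+1) _ (clim_qfV q1)) => n; lia.
have -> : aP = qinf Q * (qinf q)^-1 * (qinf q)^-1 by rewrite /aP expr2 invfM mulrA.
apply: clim_ext (climM (climM c1 c2) c3) => m.
by rewrite /HP !muln0 !addn0 expr0 mul1r qf0 invr1 mul1r !mul1n.
Qed.

Lemma GPE (i : int) : GP i = aP * q ^ tri i.
Proof.
have hn (n : nat) : GP n.+1 = aP * q ^ tri n.+1.
  by rewrite GP_nat GP1 tri_nat -exprnP mulrC.
have hN j : GP (1 - j) = GP j.
  apply: eq_tsum => n; rewrite [X in _ * X]mulrC; congr (_ * (iq _ * iq _)); lia.
case: i => [[|n]|n]; last 2 first.
- exact: hn.
- have -> : Negz n = 1 - n.+2%:Z by lia.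
  by rewrite hN hn tri_refl.
have -> : 0%:Z = 1 - 1%:Z by lia.
by rewrite hN hn tri_refl.
Qed.

Lemma sum_dP_VS x : adm q x ->
  tsum (fun n : nat => dP n * VS q x n) = aP * tsum (fun i => x i * ((-1) ^ i * q ^ (i * i - i))).
Proof.
move=> ax; have [B hB] := iqq_bound q1.
have hB' (n : nat) i : cabs (iq (n%:Z + 1 - i) * iq (n%:Z + i)) <= B by exact: hB.
rewrite (bailey_sum absum_dP ax hB' GPE).
have E i : th q i * q ^ tri i = (-1) ^ i * q ^ (i * i - i).
  by rewrite thE -mulrA -expfzDr //; congr (_ * _ ^ _); have := triE i; lia.
rewrite -tsumZ; first by apply: eq_tsum => i; rewrite -E; ring.
have ax0 : absum (fun i => x i * th q i).
  by have := ax 0; apply: eq_absum => i; rewrite addr0.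
have b1 i : cabs (q ^ tri i) <= 1 by apply: cabs_qz => //; have := triE i; nia.
have := absum_bdM b1 ax0; apply: eq_absum => i; rewrite -E; ring.
Qed.

Lemma qpoch_odd m : qpoch q Q m * qf Q m = qf q (2 * m).
Proof.
elim: m => [|m IH]; first by rewrite /qpoch !big_ord0 muln0 !qf0 mulr1.
rewrite mulnS !addSn add0n !qfS -IH /qpoch big_ord_recr /=.
rewrite (_ : Q ^+ m * q = q ^+ (2 * m).+1) 1?(_ : Q ^+ m.+1 = q ^+ (2 * m).+2); first by ring.
  by rewrite -exprM mulnS.
by rewrite -exprM exprSr.
Qed.

Lemma qpoch_oddE n (c : C) : c * q ^+ 'C(n.+1, 2) / qpoch q Q n.+1
  = dP n * (c * (qf q n / qf q (2 * n).+1)).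
Proof.
have := qpoch_odd n.+1; rewrite mulnS !addSn add0n !qfS.
have -> : Q ^+ n.+1 = q ^+ (2 * n).+2 by rewrite -exprM mulnS.
have k1 := subr1X_neq0 q1 (2 * n).+1; have k2 := subr1X_neq0 q1 (2 * n).
have k3 := qf_neq0 q1 (2 * n); have k4 := qf_neq0 Q1 n; have k5 := qf_neq0 q1 n.
rewrite /dP; move: (qpoch _ _ _) (1 - q ^+ (2 * n).+2) k1 => p e k1.
rewrite mulrA => /(mulIf k1) E.
have p0 : p != 0.
  by apply/eqP => p0; move: E; rewrite p0 mul0r => /esym/eqP; rewrite mulf_eq0 (negPf k3) (negPf k2).
rewrite -E; move: (qf q n) (qf Q n) (q ^+ _) k4 k5 => a b d k4 k5.
by field; rewrite p0 k4 k5.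
Qed.

Lemma absum_dP_bd (u : nat -> C) (B : R) : (forall n, cabs (u n) <= B) ->
  absum (fun n => dP n * u n).
Proof.
by move=> hB; have := absum_bdM hB absum_dP; apply: eq_absum => n; rewrite mulrC.
Qed.

Lemma qf_ratioS_bound : exists B, forall n, cabs (qf q n / qf q (2 * n).+1) <= B.
Proof.
have [B hB] := qf_bounds q1; exists (B * B) => n.
rewrite cabsM; have [h1 _] := hB n; have [_ h2] := hB (2 * n).+1.
by apply: ler_pM; rewrite ?cabs_ge0.
Qed.

Lemma phi10E : phi10 q = aP * tsum (fun i => kz q (- i) * ((-1) ^ i * q ^ (i * i - i))).
Proof.
have [B hB] := qf_ratioS_bound; have aD := absum_dP_bd hB.
have E n : q ^+ 'C(n.+1, 2) / qpoch q Q n.+1 = dP n * (qf q n / qf q (2 * n).+1).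
  by have := qpoch_oddE n 1; rewrite !mul1r.
rewrite /phi10 csum_tsum; last by apply: eq_absum aD => n; rewrite E.
under eq_tsum do rewrite E -(VS_kz0 q0 q1).
rewrite (sum_dP_VS (adm_kz q1 0)); congr (_ * _).
by apply: eq_tsum => i; rewrite sub0r.
Qed.

Lemma psi10E : psi10 q = aP * tsum (fun i => kz q (-1 - i) * ((-1) ^ i * q ^ (i * i - i))).
Proof.
have [B hB] := qf_ratioS_bound.
have E n : q ^+ 'C(n.+2, 2) / qpoch q Q n.+1 = dP n * (q ^+ n.+1 * (qf q n / qf q (2 * n).+1)).
  by rewrite -qpoch_oddE (binS n.+1 1) bin1 addnC exprD.
have hu n : cabs (q ^+ n.+1 * (qf q n / qf q (2 * n).+1)) <= B.
  apply: le_trans (hB n); rewrite cabsM ler_piMl ?cabs_ge0 //.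
  by rewrite ltW // cabs_exp_lt1.
have aD := absum_dP_bd hu.
rewrite /psi10 csum_tsum; last by apply: eq_absum aD => n; rewrite E.
under eq_tsum do rewrite E -(VS_kzN1 q0 q1).
exact: sum_dP_VS (adm_kz q1 (-1)).
Qed.

(** The sequence q^i pairs to 0 except at n = 0, which gives Gauss's product for the alternating
    series over the squares. *)
Lemma aP_norm : aP * tsum (fun i => (-1) ^ i * q ^ (i * i)) = 1.
Proof.
have a1 := adm_exp q1 q0; have := sum_dP_VS a1.
have E i : q ^ i * ((-1) ^ i * q ^ (i * i - i)) = (-1) ^ i * q ^ (i * i).
  by rewrite mulrCA -expfzDr //; congr (_ * _ ^ _); lia.
under [in RHS]eq_tsum do rewrite E.
move=> <-; under eq_tsum do rewrite (VS_qz q0 q1).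
rewrite (@tsum_fin _ _ _ [:: 0%N]) ?big_seq1 //.
  by rewrite /dP !qf0 divr1 binS bin1 expr0 !mulr1.
by move=> n; rewrite inE => /negPf ->; rewrite mulr0.
Qed.

End MockPhi.

(** * The reciprocal of the theta function *)

Section Reciprocal.
Variable R : realType.
Local Notation C := R[i].
Variable q : C.
Hypotheses (q0 : q != 0) (q1 : cabs q < 1).
Local Notation th := (th q).

(** Here - th (n + 1) is (-1)^n q^(n(n+1)/2). *)
Definition rho (i : int) : C := tsum (fun n : nat => - (th n.+1 * (q ^ i) ^+ n)).

Lemma absum_rho i : absum (fun n : nat => - (th n.+1 * (q ^ i) ^+ n)).
Proof.
have k : q ^ i != 0 by rewrite expfz_neq0.
have := absum_natS (absum_Posz (rapid_th q1 k)) => /(absumZ (- (q ^ i)^-1)).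
apply: eq_absum => n; rewrite /lterm -exprnP exprSr.
by move: (q ^ i) (th _) k => x y x0; field.
Qed.

Lemma th1 : th 1 = -1.
Proof. by have := thS q0 0; rewrite add0r th0 // expr0z mulr1. Qed.

Lemma th_succ n : th (n + 1) = - (q ^ n * th n).
Proof. exact: thS. Qed.

Lemma rho_rec i : rho i = 1 - q ^ (i + 1) * rho (i + 1).
Proof.
rewrite /rho (tsum_natS (absum_rho i)) expr0 mulr1 th1 opprK -tsumZ; last exact: absum_rho.
rewrite -tsumN; last by apply: absumZ; exact: absum_rho.
congr (_ + _); apply: eq_tsum => n.
rewrite (_ : n.+2%:Z = n.+1%:Z + 1) ?th_succ; last by lia.
rewrite expfzDr // expr1z exprMn exprS -exprnP (exprS q n).
by move: (q ^ i) ((q ^ i) ^+ n) (q ^+ n) (th _) => *; ring.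
Qed.

(** The vanishing series j(q^i;q), divided by - q^i and shifted by one, is cut into nonnegative and
    negative indices: the halves are [rho i] and a multiple of [rho (- i)]. *)
Lemma rho_opp i : rho i = q ^ (- i) * rho (- i).
Proof.
have k : q ^ i != 0 by rewrite expfz_neq0.
pose g (n : int) : C := - (th (n + 1) * (q ^ i) ^ n).
have ag : absum g.
  have := absumZ (- (q ^ i)^-1) (absum_shift 1 (rapid_th q1 k)).
  apply: eq_absum => n; rewrite /lterm /g expfzDr // expr1z.
  by move: (q ^ i) (_ ^ n) (th _) k => x y z x0; field.
have g0 : tsum g = 0.
  have := lau_th_qz q0 q1 i; rewrite lau.unlock (tsum_shift 1) => h.
  apply: (mulfI (_ : - q ^ i != 0)); first by rewrite oppr_eq0.
  rewrite mulr0 -h -tsumZ //; apply: eq_tsum => n.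
  by rewrite /g /lterm expfzDr // expr1z; ring.
move: g0; rewrite tsum_int // => /eqP; rewrite addr_eq0 => /eqP g0.
have E1 : rho i = tsum (fun n => g (Posz n)).
  by apply: eq_tsum => n; rewrite /g -exprnP (_ : n%:Z + 1 = n.+1) //; lia.
rewrite E1 g0 -tsumZ; last exact: absum_rho.
rewrite -tsumN; last exact: absum_Negz.
apply: eq_tsum => n; rewrite /g opprK.
rewrite (_ : Negz n + 1 = - n%:Z); last by lia.
rewrite (th_opp q0) (_ : n.+1%:Z = n%:Z + 1) ?th_succ; last by lia.
rewrite NegzE -invr_expz -(exprnP (q ^ i)) -[q ^ (- i)]invr_expz exprVn.
rewrite exprS invfM.
by move: ((q ^ i)^-1) (((q ^ i) ^+ n)^-1) (q ^ _) (th _) => *; ring.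
Qed.

Lemma rho_refl i : rho i + rho (- i - 1) = 1.
Proof. by rewrite [rho (- i - 1)]rho_rec subrK -rho_opp addrCA subrr addr0. Qed.

(** The second bound gives geometric decay at negative indices, by [rho_opp]; together the two
    bounds give convergence on |q| < |z| < 1. *)
Lemma rho_bound : exists B, 0 <= B /\ forall i, cabs (rho i) <= B /\ cabs (rho i) <= B * cabs q ^ (- i).
Proof.
have [M hM] := absum_natS (absum_Posz (rapid_absum (rapid_th q1))).
have M0 : 0 <= M by have := hM [::] isT; rewrite big_nil.
have c0 : 0 < cabs q by rewrite cabs_gt0.
have pos (i : int) : 0 <= i -> cabs (rho i) <= M.
  move=> i0; apply: (hsum_cabs_le (tsumP (absum_rho i))) => s us.
  apply: le_trans (hM s us); apply: ler_sum => n _.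
  rewrite cabsN cabsM cabsX ler_piMr ?cabs_ge0 // exprn_ile1 ?cabs_ge0 //.
  exact: cabs_qz.
exists M; split=> // i; have [i0|i0] := leP 0 i.
  split; first exact: pos.
  apply: le_trans (pos _ i0) _; rewrite ler_peMr // -exprz_inv.
  case: i i0 => // n _; rewrite -exprnP exprn_ege1 // invf_ge1 //; exact: ltW.
have h : cabs (rho i) <= M * cabs q ^ (- i).
  rewrite rho_opp cabsM cabsXz mulrC ler_wpM2r ?exprz_ge0 ?cabs_ge0 //.
  by apply: pos; lia.
split=> //; apply: le_trans h _; rewrite ler_piMr //.
by rewrite -cabsXz cabs_qz //; lia.
Qed.

Lemma absum_th_rho i : absum (fun n => th n * rho (i - n)).
Proof.
have [B [_ hB]] := rho_bound.
have := rapid_bd (fun n => proj1 (hB (i - n))) (rapid_th q1).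
by apply: eq_absum => n; rewrite mulrC.
Qed.

(* For i != 0 the convolution is its own multiple by q^i; for i = 0 summation by parts
   leads to Jacobi's series for (q)_oo^3. *)
Lemma conv_th_rho i : conv th rho i = if i == 0 then qinf q ^+ 3 else 0.
Proof.
case: eqVneq => [->|i0]; last first.
  have e : q ^ i * conv th rho i = conv th rho i.
    rewrite {1}/conv -tsumZ; last exact: absum_th_rho.
    have -> : conv th rho i = tsum (fun n => th n * rho (i - n)) - tsum th.
      by rewrite tsum_th // subr0.
    rewrite -tsumB; [|exact: absum_th_rho|exact/rapid_absum/rapid_th].
    rewrite [RHS](tsum_shift 1); apply: eq_tsum => n.
    rewrite th_succ (rho_rec (i - (n + 1))).
    have -> : i - (n + 1) + 1 = i - n by lia.
    have -> : q ^ i = q ^ n * q ^ (i - n) by rewrite -expfzDr //; congr (_ ^ _); lia.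
    by move: (q ^ n) (q ^ (i - n)) (th n) (rho _) => *; ring.
  have k : q ^ i != 1.
    apply/eqP => e1; case: (ltrgtP i 0) i0 => // hi _.
      have := @subr1z_neq0 _ q q1 (- i); rewrite oppr_gt0 => /(_ hi).
      by rewrite -invr_expz e1 invr1 subrr eqxx.
    by have := @subr1z_neq0 _ q q1 i hi; rewrite e1 subrr eqxx.
  by apply/eqP; move/eqP: e; rewrite -subr_eq0 -{2}[conv _ _ _]mul1r -mulrBl mulf_eq0 subr_eq0 (negPf k).
have aV : absum (fun n => n%:~R * (th n * rho (- n))).
  have [B [_ hB]] := rho_bound; have := adm_int q1 0 => h.
  have := absum_bdM (fun n => proj1 (hB (- n))) h; apply: eq_absum => n.
  by rewrite addr0; ring.
have aS : absum (fun n => th n * rho (- n)).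
  by have := absum_th_rho 0; apply: eq_absum => n; rewrite sub0r.
have aS1 := absum_shift (-1) aS; have aV1 := absum_shift (-1) aV.
have ai : absum (fun n => n%:~R * th n).
  by have := adm_int q1 0; apply: eq_absum => n; rewrite addr0.
have e : tsum (fun n => n%:~R * (th n * rho (- n)) - (n - 1)%:~R * (th (n - 1) * rho (- (n - 1)))) = 0.
  by rewrite tsumB // [X in X - _](tsum_shift (-1)) subrr.
have := jacobi_cube q0 q1 => /(congr1 -%R); rewrite opprK => <-.
rewrite /conv (tsum_shift (-1)); apply/eqP; rewrite -addr_eq0; apply/eqP.
transitivity (tsum (fun n => th (n - 1) * rho (0 - (n - 1)) + n%:~R * th n)).
  rewrite tsumD; [by [] | by apply: eq_absum aS1 => n; rewrite sub0r | exact: ai].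
rewrite -[RHS]e; apply: eq_tsum => n; rewrite sub0r (rho_rec (- n)) (th_pred q0 q1 n).
have -> : - n + 1 = - (n - 1) by lia.
have -> : 1 - n = - (n - 1) by lia.
rewrite intrB.
by move: (q ^ _) (th n) (rho _) (n%:~R) => *; ring.
Qed.

Lemma absum_lterm_rho x : cabs q < cabs x -> cabs x < 1 -> absum (lterm rho x).
Proof.
move=> qx x1; have [B [B0 hB]] := rho_bound; have c0 : 0 < cabs q by rewrite cabs_gt0.
have x0 : 0 < cabs x by apply: lt_trans qx.
apply: absum_int.
  apply: (absum_geom (r := cabs x) (M := B)); first by rewrite x1 ltW.
  move=> n; rewrite /lterm cabsM cabsXz -exprnP.
  by rewrite ler_wpM2r ?exprn_ge0 ?cabs_ge0 //; have [] := hB n%:Z.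
apply: (absum_geom (r := cabs q / cabs x) (M := B)).
  by rewrite divr_ge0 ?cabs_ge0 //= ltr_pdivrMr // mul1r.
move=> n; rewrite /lterm cabsM cabsXz NegzE.
have [_ h] := hB (- n.+1%:Z); rewrite opprK -exprnP in h.
rewrite -invr_expz -exprnP.
apply: (@le_trans _ _ (B * cabs q ^+ n.+1 * (cabs x ^+ n.+1)^-1)).
  by rewrite ler_wpM2r // invr_ge0 exprn_ge0 // ltW.
rewrite -mulrA -expr_div_n ler_wpM2l // exprS ler_piMl ?exprn_ge0 //.
  by rewrite divr_ge0 // ltW.
by rewrite ler_pdivrMr // mul1r ltW.
Qed.

Lemma lau_th_rho x : cabs q < cabs x -> cabs x < 1 ->
  lau th x * lau rho x = qinf q ^+ 3.
Proof.
move=> qx x1; have x0 : x != 0.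
  by rewrite -cabs_gt0; apply: le_lt_trans qx; exact: cabs_ge0.
rewrite lau_conv //; [|exact: rapid_th|exact: absum_lterm_rho].
rewrite lau.unlock (@tsum_fin _ _ _ [:: 0]) //.
  by rewrite big_seq1 /lterm conv_th_rho eqxx expr0z mulr1.
by move=> i; rewrite inE /lterm conv_th_rho => /negPf ->; rewrite mul0r.
Qed.

Lemma lau_th_neq0 x : cabs q < cabs x -> cabs x < 1 -> lau th x != 0.
Proof.
move=> qx x1; have := lau_th_rho qx x1 => e.
have : qinf q ^+ 3 != 0 by rewrite expf_neq0 ?qinf_neq0.
by rewrite -e mulf_eq0 negb_or => /andP[].
Qed.

End Reciprocal.

Lemma tri_ge0 n : 0 <= tri n. Proof. by have := triE n; nia. Qed.

(** * Quintuple product recursions *)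

Section Lattice.
Variable R : realType.
Local Notation C := R[i].
Variables (a c : int -> C) (x : C) (p r : int) (f1 f2 g1 g2 : int -> int -> int).
Hypotheses (x0 : x != 0) (ha : absum (lterm a (x ^ p))) (hc : absum (lterm c (x ^ r))).
Hypotheses (fg1 : forall m l, f1 (g1 m l) (g2 m l) = m)
           (fg2 : forall m l, f2 (g1 m l) (g2 m l) = l)
           (gf1 : forall i k, g1 (f1 i k) (f2 i k) = i)
           (gf2 : forall i k, g2 (f1 i k) (f2 i k) = k)
           (hdeg : forall i k, p * f1 i k + r * f2 i k = i).

(** For fixed i, the pair ([f1 i k], [f2 i k]) runs through the solutions (m, l) of p m + r l = i,
    each exactly once. This is the Cauchy product of a series in x^p with a series in x^r. *)
Definition lconv (i : int) : C := tsum (fun k => a (f1 i k) * c (f2 i k)).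

Let h (z : int * int) := (f1 z.1 z.2, f2 z.1 z.2).
Let g (z : int * int) := (g1 z.1 z.2, g2 z.1 z.2).
Let hg : cancel g h. Proof. by case=> m l; rewrite /h /g /= fg1 fg2. Qed.
Let gh : cancel h g. Proof. by case=> m l; rewrite /h /g /= gf1 gf2. Qed.
Let F (z : int * int) := a (f1 z.1 z.2) * c (f2 z.1 z.2) * x ^ z.1.
Let G (z : int * int) := lterm a (x ^ p) z.1 * lterm c (x ^ r) z.2.

Let GF z : G (h z) = F z.
Proof.
case: z => i k; rewrite /G /F /h /lterm /= mulrACA !exprz_exp -expfzDr //.
by rewrite hdeg.
Qed.

Let aG : absum G. Proof. exact: absum_mul. Qed.

Let aF : absum F.
Proof. by have := absum_comp (can_inj gh) aG; apply: eq_absum => z; rewrite /= GF. Qed.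

Lemma absum_lconv_slice i : absum (fun k => a (f1 i k) * c (f2 i k)).
Proof.
have := absum_slice i aF => /(absumZ (x ^ (- i))); apply: eq_absum => n.
by rewrite /F /= mulrCA -expfzDr // addNr mulr1.
Qed.

Let sl i : tsum (fun k => F (i, k)) = lterm lconv x i.
Proof.
rewrite /lterm /lconv mulrC -tsumZ; last exact: absum_lconv_slice.
by apply: eq_tsum => n; rewrite /F /= mulrC.
Qed.

Lemma absum_lconv : absum (lterm lconv x).
Proof. by have := absum_outer aF; apply: eq_absum. Qed.

Lemma lau_lattice : lau a (x ^ p) * lau c (x ^ r) = lau lconv x.
Proof.
rewrite lau_tsum_mul // (tsum_bij G gh hg) (eq_tsum GF) tsum_pair //.
by rewrite lau.unlock; apply: eq_tsum.
Qed.

End Lattice.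

Section Lattices.
Variable R : realType.
Local Notation C := R[i].
Variables (a c : int -> C) (x : C).
Hypothesis x0 : x != 0.

Section L21.
Hypotheses (ha : absum (lterm a (x ^+ 2))) (hc : absum (lterm c x)).

Definition conv21 (i : int) : C := tsum (fun k => a k * c (i - 2 * k)).

Let f1 (i k : int) := k. Let f2 (i k : int) := i - 2 * k.
Let g1 (m l : int) := 2 * m + l. Let g2 (m l : int) := m.
Let fg1 m l : f1 (g1 m l) (g2 m l) = m. Proof. by []. Qed.
Let fg2 m l : f2 (g1 m l) (g2 m l) = l. Proof. by rewrite /f2 /g1 /g2 addrC addKr. Qed.
Let gf1 i k : g1 (f1 i k) (f2 i k) = i. Proof. by rewrite /f2 /g1 /f1 addrCA subrr addr0. Qed.
Let gf2 i k : g2 (f1 i k) (f2 i k) = k. Proof. by []. Qed.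
Let hd i k : 2 * f1 i k + 1 * f2 i k = i.
Proof. by rewrite /f2 /f1 mul1r addrCA subrr addr0. Qed.
Let ha' : absum (lterm a (x ^ 2)). Proof. exact: ha. Qed.
Let hc' : absum (lterm c (x ^ 1)). Proof. by rewrite expr1z. Qed.

Lemma lau_conv21 : lau a (x ^+ 2) * lau c x = lau conv21 x.
Proof.
have := lau_lattice x0 ha' hc' fg1 fg2 gf1 gf2 hd.
by rewrite expr1z exprnP.
Qed.

Lemma absum_conv21 : absum (lterm conv21 x).
Proof. exact: (absum_lconv x0 ha' hc' gf1 gf2 hd). Qed.

End L21.

Section L23.
Hypotheses (ha : absum (lterm a (x ^+ 2))) (hc : absum (lterm c (x ^+ 3))).

(** The solutions of 2 m + 3 l = i are m = 3 k - i, l = i - 2 k. *)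
Definition conv23 (i : int) : C := tsum (fun k => a (3 * k - i) * c (i - 2 * k)).

Let f1 (i k : int) := 3 * k - i. Let f2 (i k : int) := i - 2 * k.
Let g1 (m l : int) := 2 * m + 3 * l. Let g2 (m l : int) := m + l.
Let fg1 m l : f1 (g1 m l) (g2 m l) = m. Proof. by rewrite /f1 /g1 /g2; ring. Qed.
Let fg2 m l : f2 (g1 m l) (g2 m l) = l. Proof. by rewrite /f2 /g1 /g2; ring. Qed.
Let gf1 i k : g1 (f1 i k) (f2 i k) = i. Proof. by rewrite /f1 /f2 /g1; ring. Qed.
Let gf2 i k : g2 (f1 i k) (f2 i k) = k. Proof. by rewrite /f1 /f2 /g2; ring. Qed.
Let hd i k : 2 * f1 i k + 3 * f2 i k = i. Proof. by rewrite /f1 /f2; ring. Qed.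
Let ha' : absum (lterm a (x ^ 2)). Proof. exact: ha. Qed.
Let hc' : absum (lterm c (x ^ 3)). Proof. exact: hc. Qed.

Lemma lau_conv23 : lau a (x ^+ 2) * lau c (x ^+ 3) = lau conv23 x.
Proof.
by have := lau_lattice x0 ha' hc' fg1 fg2 gf1 gf2 hd; rewrite -!exprnP.
Qed.

Lemma absum_conv23 : absum (lterm conv23 x).
Proof. exact: (absum_lconv x0 ha' hc' gf1 gf2 hd). Qed.
End L23.

Lemma lau_mulx : absum (lterm a x) -> x * lau a x = lau (fun i => a (i - 1)) x.
Proof.
move=> ha; rewrite lau.unlock -tsumZ // [RHS](tsum_shift 1); apply: eq_tsum => n.
by rewrite /lterm addrK expfzDr // expr1z; ring.
Qed.

Lemma absum_mulx : absum (lterm a x) -> absum (lterm (fun i => a (i - 1)) x).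
Proof.
move=> /(absumZ x) /(absum_shift (-1)); apply: eq_absum => n.
by rewrite /lterm mulrCA -{1}(expr1z x) -expfzDr // addrCA subrr addr0.
Qed.

End Lattices.

Section Twists.
Variable R : realType.
Local Notation C := R[i].
Variable q : C.
Hypotheses (q0 : q != 0) (q1 : cabs q < 1).

(** The coefficients of j(-x;q); those of [sqc] belong to j(q x;q^2). *)
Definition trc (n : int) : C := q ^ tri n.
Definition sqc (n : int) : C := (-1) ^ n * q ^ (n * n).

Lemma trcE n : trc n = th q n * (-1) ^ n.
Proof. by rewrite thE mulrAC sgnzz mul1r. Qed.

Lemma sqcE n : sqc n = th (q ^+ 2) n * q ^ n.
Proof.
rewrite thE exprnP exprz_exp -mulrA -expfzDr //; congr (_ * _ ^ _).
by have := triE n; lia.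
Qed.

Lemma trc_term x n : x != 0 -> lterm trc x n = lterm (th q) (- x) n.
Proof. by move=> x0; rewrite /lterm trcE (exprzNl n x0) mulrA. Qed.

Lemma sqc_term x n : x != 0 -> lterm sqc x n = lterm (th (q ^+ 2)) (q * x) n.
Proof. by move=> x0; rewrite /lterm sqcE exprzMl ?unitfE // mulrA. Qed.

Lemma rapid_trc : rapid trc.
Proof.
move=> x x0; have := rapid_th q1 (_ : - x != 0); rewrite oppr_eq0 => /(_ x0).
by apply: eq_absum => n; rewrite trc_term.
Qed.

Lemma rapid_sqc : rapid sqc.
Proof.
move=> x x0; have := rapid_th (cabs_sqr1 q1) (mulf_neq0 q0 x0).
by apply: eq_absum => n; rewrite sqc_term.
Qed.

Lemma lau_trc x : x != 0 -> lau trc x = lau (th q) (- x).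
Proof. by move=> x0; rewrite lau.unlock; apply: eq_tsum => n; rewrite trc_term. Qed.

Lemma lau_sqc x : x != 0 -> lau sqc x = lau (th (q ^+ 2)) (q * x).
Proof. by move=> x0; rewrite lau.unlock; apply: eq_tsum => n; rewrite sqc_term. Qed.

End Twists.

Lemma int_ind2 (P : int -> Prop) (d : nat) : (0 < d)%N ->
  (forall r : nat, (r < d)%N -> P r) ->
  (forall i, P i -> P (i + d%:Z)) -> (forall i, P (i + d%:Z) -> P i) -> forall i, P i.
Proof.
move=> d0 base up down i.
have h (m : nat) (r : nat) : (r < d)%N -> P (r%:Z + m%:Z * d%:Z) /\ P (r%:Z - m%:Z * d%:Z).
  move=> rd; elim: m => [|m [IH1 IH2]].
    by rewrite mul0r addr0 ?subr0; split; exact: base.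
  split.
    have -> : r%:Z + m.+1%:Z * d%:Z = r%:Z + m%:Z * d%:Z + d%:Z by lia.
    exact: up.
  apply: down.
  by have -> : r%:Z - m.+1%:Z * d%:Z + d%:Z = r%:Z - m%:Z * d%:Z by lia.
have dn0 : d%:Z != 0 by lia.
have rd : (`|(i %% d)%Z| < d)%N.
  by have := ltz_mod i dn0; have := modz_ge0 i dn0; lia.
have [h1 h2] := h `|(i %/ d)%Z|%N _ rd.
have E := divz_eq i d; have r0 := modz_ge0 i dn0.
have [k|k] := leP 0 (i %/ d)%Z.
  move: h1; rewrite (_ : _ + _ = i) //; rewrite [RHS]E addrC; congr (_ * _ + _); lia.
move: h2; rewrite (_ : _ - _ = i) //; rewrite [RHS]E addrC -mulNr; congr (_ * _ + _); lia.
Qed.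

Section Quintuple.
Variable R : realType.
Local Notation C := R[i].

(* Such a sequence vanishes at 2 and is fixed by its value at 0. *)
Definition quint (b : C) (l : int -> C) : Prop :=
  (forall i, l (i + 3) = - (b ^ (i + 1) * l i)) /\ (forall i, l (- i) = l (i + 1)).

Lemma quint_unique b l f : b != 0 -> quint b l -> quint b f ->
  forall i, f 0 * l i = l 0 * f i.
Proof.
move=> b0 [l3 lN] [f3 fN].
have one (g : int -> C) : (forall i, g (- i) = g (i + 1)) -> g 1 = g 0.
  by move=> gN; have := gN 0; rewrite oppr0 add0r.
have two (g : int -> C) : (forall i, g (i + 3) = - (b ^ (i + 1) * g i)) ->
    (forall i, g (- i) = g (i + 1)) -> g 2 = 0.
  move=> g3 gN; have := g3 (-1); rewrite addNr expr0z mul1r (gN 1).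
  rewrite (_ : -1 + 3 = 2) // (_ : 1 + 1 = 2 :> int) // => /eqP.
  by rewrite -addr_eq0 -mulr2n mulrn_eq0 /= => /eqP.
apply: (@int_ind2 _ 3) => //.
- move=> [|[|[|]]] // _; first by rewrite mulrC.
    by rewrite (one l lN) (one f fN) mulrC.
  by rewrite (two l l3 lN) (two f f3 fN) !mulr0.
- by move=> i e; rewrite l3 f3 !mulrN mulrCA e mulrCA.
move=> i; rewrite l3 f3 !mulrN => /oppr_inj; rewrite mulrCA [RHS]mulrCA.
by apply: mulfI; rewrite expfz_neq0.
Qed.

Section KTheta.
Variable q : C.
Hypotheses (q0 : q != 0) (q1 : cabs q < 1).

Lemma absum_th_kz i : absum (fun n => th q n * kz q (i - n)).
Proof.
have [B hB] := kz_bound q1.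
have := rapid_bd (fun n => hB (i - n)) (rapid_th q1).
by apply: eq_absum => n; rewrite mulrC.
Qed.

Lemma kz_recz i : kz q i = 2 + q ^ (i - 1) * kz q (i - 2).
Proof. by have := kz_refl q0 q1 i; rewrite kz_opp => h; rewrite -[RHS]opprK opprD -h; ring. Qed.

(** Both the recursion and the reflection of k carry an inhomogeneous 2. Convolved with the theta
    coefficients it contributes a multiple of j(1;q) = 0, so homogeneous relations remain. *)
Lemma conv_th_kz_quint : quint q (conv (th q) (kz q)).
Proof.
have a0 := rapid_absum (rapid_th q1).
split=> i.
  rewrite /conv -mulNr -tsumZ; last exact: absum_th_kz.
  have -> : tsum (fun n => th q n * kz q (i + 3 - n))
      = tsum (fun n => th q n * kz q (i + 3 - n)) - 2 * tsum (th q).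
    by rewrite tsum_th // mulr0 subr0.
  rewrite -tsumZ // -tsumB; [|exact: absum_th_kz|exact: absumZ].
  rewrite [LHS](tsum_shift 1); apply: eq_tsum => n.
  rewrite (kz_recz (i + 3 - (n + 1))) (thS q0).
  have -> : i + 3 - (n + 1) - 1 = i + 1 - n by lia.
  have -> : i + 3 - (n + 1) - 2 = i - n by lia.
  have -> : q ^ (i + 1) = q ^ n * q ^ (i + 1 - n) by rewrite -expfzDr //; congr (_ ^ _); lia.
  by move: (q ^ n) (q ^ (i + 1 - n)) (th q n) (kz q _) => *; ring.
have -> : conv (th q) (kz q) (- i) = tsum (fun n => 2 * th q n - th q n * kz q (i + n)).
  by apply: eq_tsum => n; rewrite (_ : - i - n = - (i + n)) ?kz_opp; [ring|lia].
have aN : absum (fun n => th q n * kz q (i + n)).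
  have [B hB] := kz_bound q1; have := rapid_bd (fun n => hB (i + n)) (rapid_th q1).
  by apply: eq_absum => n; rewrite mulrC.
rewrite tsumB //; last exact: absumZ.
rewrite tsumZ // tsum_th // mulr0 sub0r -tsumN // (tsum_refl 1); apply: eq_tsum => n.
by rewrite th_refl mulNr opprK (_ : i + (1 - n) = i + 1 - n) //; lia.
Qed.

Lemma conv_th_kz0 : conv (th q) (kz q) 0 = qinf q ^+ 2.
Proof.
rewrite -(clim_kz_theta q0 q1); apply: eq_tsum => n.
by rewrite sub0r mulrC.
Qed.

Lemma absum_lterm_kz x : cabs q < cabs x -> cabs x < 1 -> absum (lterm (kz q) x).
Proof.
move=> qx x1; have [B hB] := kz_bound q1; have c0 : 0 < cabs q by rewrite cabs_gt0.
have x0 : 0 < cabs x by apply: lt_trans qx.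
have B0 : 0 <= B by apply: le_trans (hB 0); exact: cabs_ge0.
apply: absum_int.
  apply: (absum_geom (r := cabs x) (M := B)); first by rewrite x1 ltW.
  move=> n; rewrite /lterm cabsM cabsXz -exprnP.
  by rewrite ler_wpM2r ?exprn_ge0 ?cabs_ge0.
apply: (absum_geom (r := cabs q / cabs x) (M := B / cabs x)).
  by rewrite divr_ge0 ?cabs_ge0 //= ltr_pdivrMr // mul1r.
move=> n; rewrite /lterm cabsM cabsXz NegzE kz_refl // cabsN cabsM cabsXz.
rewrite (_ : n.+1%:Z - 1 = n) -?exprnP; last by lia.
rewrite -invr_expz -exprnP exprS invfM expr_div_n.
have := hB (n.+1%:Z - 2); have := cabs_ge0 (kz q (n.+1%:Z - 2)).
move: (cabs (kz _ _)) => k k0 kB.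
rewrite [leLHS](_ : _ = k * ((cabs x)^-1 * (cabs q ^+ n * (cabs x ^+ n)^-1))); last by ring.
rewrite [leRHS](_ : _ = B * ((cabs x)^-1 * (cabs q ^+ n * (cabs x ^+ n)^-1))); last by ring.
by rewrite ler_wpM2r // !mulr_ge0 ?invr_ge0 ?exprn_ge0 // ltW.
Qed.

End KTheta.

Lemma quint_lau b (l f : int -> C) (x : C) : b != 0 -> quint b l -> quint b f ->
  absum (lterm l x) -> absum (lterm f x) -> l 0 != 0 -> f 0 / l 0 * lau l x = lau f x.
Proof.
move=> b0 hl hf al af l0; have h := quint_unique b0 hl hf.
rewrite -lauZ // lau.unlock; apply: eq_tsum => i; rewrite /lterm; congr (_ * _).
by rewrite mulrAC h mulrC mulKf.
Qed.

Section KA.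
Variable s : C.
Hypotheses (s0 : s != 0) (s1 : cabs s < 1).
Local Notation q := (s ^+ 2).
Let q0 : q != 0. Proof. by rewrite expf_neq0. Qed.
Let q1 : cabs q < 1. Proof. exact: cabs_sqr1. Qed.

(** The coefficients of K(u;q) j(u;q) and of the theta product obey the same quintuple recursion, so
    the series are proportional. The ratio of the coefficients at 0, (s;s)_oo / (q)_oo^2, is
    [aX s]. *)
Lemma kz_theta_X u : cabs q < cabs u -> cabs u < 1 ->
  aX s * lau (kz q) u * lau (th q) u = lau (th q) (s * u) * lau (th s) (- u).
Proof.
move=> qu u1; have u0 : u != 0.
  by rewrite -cabs_gt0; apply: le_lt_trans qu; exact: cabs_ge0.
have aK := absum_lterm_kz q0 q1 qu u1; have aT := rapid_th q1 u0.
rewrite mulrAC -mulrA lau_conv //.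
rewrite -(lau_sqc s0 s1 u0) -(lau_trc s u0).
have ra := rapid_sqc s0 s1 u0; have rc := rapid_trc s1 u0.
rewrite lau_conv //; set a := sqc s in ra *; set c := trc s in rc *.
have fE i : conv a c i = tsum (fun n => (-1) ^ n * s ^ (n * n + tri (i - n))).
  by apply: eq_tsum => n; rewrite /a /sqc /c /trc expfzDr // mulrA.
(* At index 0 the exponent n^2 + tri (- n) equals 3 tri n + 2 n, the pentagonal form. *)
have f0 : conv a c 0 = qinf s.
  rewrite -(pentagonal s0 s1) fE; apply: eq_tsum => n.
  rewrite sub0r mulrC; congr (_ ^ _ * _); rewrite triN; have := triE n; lia.
have ac i : absum (fun n => (-1) ^ n * s ^ (n * n + tri (i - n))).
  have b1 n : cabs (a n) <= 1.
    by rewrite cabsM cabs_signz mul1r cabs_qz // -expr2 sqr_ge0.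
  have := rapid_bd b1 (rapid_refl i (rapid_trc s1)); apply: eq_absum => n.
  by rewrite /a /sqc /trc expfzDr // mulrA.
have hf : quint q (conv a c).
  split=> i; rewrite !fE.
    rewrite -mulNr -tsumZ // [LHS](tsum_shift 1); apply: eq_tsum => n.
    have -> : s ^ ((n + 1) * (n + 1) + tri (i + 3 - (n + 1)))
        = q ^ (i + 1) * s ^ (n * n + tri (i - n)).
      rewrite exprnP exprz_exp -expfzDr //; congr (_ ^ _).
      by have := triE (i + 3 - (n + 1)); have := triE (i - n); lia.
    by rewrite sgnzD expr1z; move: ((-1) ^ n) (q ^ _) (s ^ _) => *; ring.
  rewrite (tsum_refl 0); apply: eq_tsum => n; rewrite sub0r sgnzN mulrNN.
  by rewrite -(tri_refl (i + 1 - n)); congr (_ * _ ^ (_ + tri _)); lia.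
have hl := conv_th_kz_quint q0 q1.
have l0 : conv (th q) (kz q) 0 != 0 by rewrite conv_th_kz0 // expf_neq0 ?qinf_neq0.
have := quint_lau q0 hl hf (absum_conv_term u0 aT aK) (absum_conv_term u0 ra rc) l0.
by rewrite f0 conv_th_kz0.
Qed.

End KA.

Section KB.
Variable q : C.
Hypotheses (q0 : q != 0) (q1 : cabs q < 1).
Local Notation Q := (q ^+ 2).
Let Q0 : Q != 0. Proof. by rewrite expf_neq0. Qed.
Let Q1 : cabs Q < 1. Proof. exact: cabs_sqr1. Qed.

(** The comparison of [kz_theta_X] for another theta product, now a series in t times one in t^2.
    Its coefficient at 0 is the pentagonal series in q^2, whence the ratio [aP q]. *)
Lemma kz_theta_P t : cabs q < cabs t -> cabs t < 1 ->
  aP q * lau (kz q) t * lau (th q) t = lau (th q) (- t) * lau (th Q) (q * t ^+ 2).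
Proof.
move=> qu u1; have u0 : t != 0.
  by rewrite -cabs_gt0; apply: le_lt_trans qu; exact: cabs_ge0.
have aK := absum_lterm_kz q0 q1 qu u1; have aT := rapid_th q1 u0.
rewrite mulrAC -mulrA lau_conv //.
have t20 : t ^+ 2 != 0 by rewrite expf_neq0.
rewrite -(lau_trc q u0) -(lau_sqc q0 q1 t20).
have ra := rapid_sqc q0 q1 t20; have rc := rapid_trc q1 u0.
rewrite [RHS]mulrC (lau_conv21 u0 ra rc); have af := absum_conv21 u0 ra rc.
set a := sqc q in ra af *; set c := trc q in rc af *.
have fE i : conv21 a c i = tsum (fun n => (-1) ^ n * q ^ (n * n + tri (i - 2 * n))).
  by apply: eq_tsum => n; rewrite /a /sqc /c /trc expfzDr // mulrA.
have f0 : conv21 a c 0 = qinf Q.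
  rewrite -(pentagonal Q0 Q1) fE; apply: eq_tsum => n.
  rewrite sub0r mulrC exprnP exprz_exp; congr (_ ^ _ * _); rewrite triN.
  by have := triE n; have := triE (2 * n); lia.
have ac i : absum (fun n => (-1) ^ n * q ^ (n * n + tri (i - 2 * n))).
  have b1 n : cabs (c (i - 2 * n)) <= 1 by rewrite cabs_qz // tri_ge0.
  have := rapid_bd b1 (rapid_sqc q0 q1); apply: eq_absum => n.
  by rewrite /c /trc /sqc expfzDr //; ring.
have hf : quint q (conv21 a c).
  split=> i; rewrite !fE.
    rewrite -mulNr -tsumZ // [LHS](tsum_shift 1); apply: eq_tsum => n.
    have -> : q ^ ((n + 1) * (n + 1) + tri (i + 3 - 2 * (n + 1)))
        = q ^ (i + 1) * q ^ (n * n + tri (i - 2 * n)).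
      rewrite -expfzDr //; congr (_ ^ _).
      by have := triE (i + 3 - 2 * (n + 1)); have := triE (i - 2 * n); lia.
    by rewrite sgnzD expr1z; move: ((-1) ^ n) (q ^ (i + 1)) (q ^ _) => *; ring.
  rewrite (tsum_refl 0); apply: eq_tsum => n; rewrite sub0r sgnzN mulrNN.
  by rewrite -(tri_refl (i + 1 - 2 * n)); congr (_ * _ ^ (_ + tri _)); lia.
have hl := conv_th_kz_quint q0 q1.
have l0 : conv (th q) (kz q) 0 != 0 by rewrite conv_th_kz0 // expf_neq0 ?qinf_neq0.
have := quint_lau q0 hl hf (absum_conv_term u0 aT aK) af l0.
by rewrite f0 conv_th_kz0.
Qed.

(* The constant is left unspecified: it cancels between t and - t. *)
Lemma th_split : exists e : C, forall t, t != 0 ->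
  lau (th Q) t * lau (th Q) (q * t) = e * lau (th q) t.
Proof.
pose a := sqc q; have ra := rapid_sqc q0 q1.
have ac i : absum (fun n => th Q n * a (i - n)).
  have [M hM] := rapid_absum (rapid_refl i ra).
  have b1 n : cabs (a (i - n)) <= M.
    by have := hM [:: n] isT; rewrite big_seq1.
  have := rapid_bd b1 (rapid_th Q1); apply: eq_absum => n; ring.
exists (conv (th Q) a 0) => t t0; rewrite -(lau_sqc q0 q1 t0).
rewrite lau_conv //; [|exact: rapid_th|exact: ra].
rewrite -lauZ; last exact: rapid_th.
have rec (i : int) : conv (th Q) a (i + 1) = - (q ^ i * conv (th Q) a i).
  rewrite /conv -mulNr -tsumZ // (tsum_refl (i + 1)); apply: eq_tsum => n.
  rewrite subKr (_ : i + 1 - n = i - n + 1); last by lia.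
  rewrite /a !(sqcE q0 q1).
  rewrite (thS Q0) exprnP exprz_exp.
  have -> : q ^ i = q ^ n * q ^ (i - n) by rewrite -expfzDr //; congr (_ ^ _); lia.
  have -> : q ^ (2 * (i - n)) = q ^ (i - n) * q ^ (i - n).
    by rewrite -expfzDr //; congr (_ ^ _); lia.
  by move: (q ^ n) (q ^ (i - n)) (th _ _) (th _ _) => *; ring.
rewrite lau.unlock; apply: eq_tsum => i; rewrite /lterm; congr (_ * _).
apply: (@int_ind2 (fun i => conv (th Q) a i = conv (th Q) a 0 * th q i) 1) => //.
- by case=> // _; rewrite th0 // mulr1.
- by move=> j e; rewrite rec e (thS q0); ring.
move=> j; rewrite rec (thS q0) mulrN => /oppr_inj; rewrite mulrCA.
by apply: mulfI; rewrite expfz_neq0.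
Qed.

End KB.

End Quintuple.

(** * The generating function of the mock theta functions *)

Section Uniqueness.
Variable R : realType.
Local Notation C := R[i].
Variables (zeta : nat -> C) (U : C -> Prop).
Hypotheses (hz : forall m, zeta m ^+ (2 ^ m) = -1) (Un0 : forall y, U y -> y != 0).
Hypothesis (Uz : forall m y, U y -> U (zeta m * y)).

Let z0 m : zeta m != 0.
Proof.
apply/eqP => e; have := hz m; rewrite e expr0n expn_eq0 /= => /esym/eqP.
by rewrite oppr_eq0 oner_eq0.
Qed.

(* Averaging over the 2^m-th roots of unity removes the coefficients whose index is
   not divisible by 2^m. *)
Lemma lau_unique0 (f : int -> C) y0 : U y0 ->
  (forall y, U y -> absum (lterm f y)) -> (forall y, U y -> lau f y = 0) -> f 0 = 0.
Proof.
move=> Uy0 af lf; pose T m y (i : int) := if ((2 ^ m)%N%:Z %| i)%Z then lterm f y i else 0.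
have aT m y : U y -> absum (T m y).
  move=> /af; apply: le_asum => i; rewrite /T; case: ifP => // _.
  by rewrite cabs0 cabs_ge0.
have key m : forall y, U y -> tsum (T m y) = 0.
  elim: m => [|m IH] y Uy.
    by rewrite -(lf _ Uy) lau.unlock; apply: eq_tsum => i; rewrite /T expn0 dvd1z.
  have two0 : (2 : C) != 0 by rewrite pnatr_eq0.
  apply: (mulfI two0); rewrite mulr0.
  have Uzy := Uz m Uy.
  rewrite -tsumZ; last exact: aT.
  have -> : 0 = tsum (T m y) + tsum (T m (zeta m * y)) by rewrite !IH // addr0.
  rewrite -tsumD; [|exact: aT|exact: aT].
  apply: eq_tsum => i; rewrite /T /lterm.
  have [/dvdzP [k ->]|h] := boolP ((2 ^ m)%N%:Z %| i)%Z; last first.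
    rewrite ifF ?mulr0 ?addr0 //; apply/negP => h'; move/negP: h; apply.
    apply: dvdz_trans h'; rewrite expnS PoszM; exact: dvdz_mull.
  have m0 : (2 ^ m)%N%:Z != 0 by rewrite eqz_nat -lt0n expn_gt0.
  rewrite exprzMl ?unitfE ?(Un0 Uy) //.
  have -> : zeta m ^ (k * (2 ^ m)%N) = (-1) ^ k by rewrite mulrC -exprz_exp -exprnP hz.
  rewrite expnS PoszM dvdz_mul2r //.
  have [n [->|->]] := int_parity k.
    by rewrite dvdz_mulr // sgnz2 mul1r; ring.
  rewrite ifF; last by apply/negP => /dvdzP [c]; lia.
  by rewrite sgnzD sgnz2 expr1z; ring.
pose f0 (i : int) := if i == 0 then f 0 else 0.
have E : f 0 = tsum f0.
  rewrite (@tsum_fin _ _ _ [:: 0]) ?big_seq1 // => i.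
  by rewrite inE /f0 => /negPf ->.
rewrite E; apply: (@clim_unique _ (fun m => tsum (T m y0))); last first.
  by apply: clim_ext (@clim_cst _ 0) => m; rewrite key.
apply: (tannery (af _ Uy0)) => [m i|i].
  by rewrite /T; case: ifP => // _; rewrite cabs0 cabs_ge0.
move=> e e0; exists `|i|%N.+1 => m hm; rewrite /T /f0.
case: eqVneq => [->|i0]; first by rewrite dvdz0 /lterm expr0z mulr1 subrr cabs0.
rewrite ifF ?subrr ?cabs0 //; apply/negP; rewrite dvdzE => /dvdn_leq.
rewrite absz_gt0 => /(_ i0); rewrite absz_nat => h.
have := ltn_expl m (isT : (1 < 2)%N); lia.
Qed.

(** A shift moves the coefficient k to index 0. The set [U] is abstract because it serves two cases:
    a full circle for the product formula, and the points of a circle that have the form [epow v 1]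
    for the string function. *)
Lemma lau_unique (f : int -> C) y0 : U y0 ->
  (forall y, U y -> absum (lterm f y)) -> (forall y, U y -> lau f y = 0) -> forall k, f k = 0.
Proof.
move=> Uy0 af lf k; rewrite -[k]add0r.
have E y i : U y -> lterm (fun i => f (i + k)) y i = y ^ (- k) * lterm f y (i + k).
  move=> /Un0 y1; rewrite /lterm mulrCA -expfzDr // addrCA addNr addr0 //.
apply: (@lau_unique0 (fun i => f (i + k)) y0 Uy0) => y Uy.
  have := absumZ (y ^ (- k)) (absum_shift k (af _ Uy)).
  by apply: eq_absum => i; rewrite E.
transitivity (y ^ (- k) * lau f y); last by rewrite lf // mulr0.
rewrite lau.unlock (tsum_shift k (lterm f y)) -tsumZ; last exact: absum_shift (af _ Uy).
by apply: eq_tsum => i; rewrite E.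
Qed.

End Uniqueness.

Section MockLaurent.
Variable R : realType.
Local Notation C := R[i].
Variable q : C.
Hypotheses (q0 : q != 0) (q1 : cabs q < 1).
Local Notation Q := (q ^+ 2).
Local Notation b := (- q).
Let b0 : b != 0. Proof. by rewrite oppr_eq0. Qed.
Let b1 : cabs b < 1. Proof. by rewrite cabsN. Qed.
Let Q0 : Q != 0. Proof. by rewrite expf_neq0. Qed.
Let Q1 : cabs Q < 1. Proof. exact: cabs_sqr1. Qed.
Let QQ0 : Q ^+ 2 != 0. Proof. by rewrite expf_neq0. Qed.
Let QQ1 : cabs (Q ^+ 2) < 1. Proof. exact: cabs_sqr1. Qed.
Let bQ : b ^+ 2 = Q. Proof. exact: sqrrN. Qed.

Section Point.
Variable y : C.
Hypotheses (hy : cabs q < cabs y ^+ 2) (y1 : cabs y < 1).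
Let y0 : y != 0.
Proof.
rewrite -cabs_eq0; apply/eqP => e; move: hy; rewrite e expr0n /= => h.
by have := cabs_ge0 q; rewrite leNgt h.
Qed.
Let t : C := y ^+ 2.
Let t0 : t != 0. Proof. by rewrite expf_neq0. Qed.
Let qt : cabs q < cabs t. Proof. by rewrite cabsX. Qed.
Let t1 : cabs t < 1. Proof. by rewrite cabsX exprn_ilt1 // cabs_ge0. Qed.
Let qy : cabs q < cabs y.
Proof.
by apply: lt_le_trans hy _; rewrite expr2 ler_piMl ?cabs_ge0 // ltW.
Qed.

Let A := aX Q * lau (kz (Q ^+ 2)) (t ^+ 2) * lau (th Q) (- t).
Let B := aP b * lau (kz b) t * lau (th Q) (b * t).

(** [jtheta_dup] turns j(t;Q) j(-t;Q) into a multiple of j(t^2;Q^2), to which [kz_theta_X] applies;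
    the resulting factor j(q^2 t^2;Q^2) is split back with the same constant. *)
Let A_eq : A * lau (th Q) t =
  lau (th Q) (q * t) * lau (th Q) (- (q * t)) * lau (th Q) (- t ^+ 2).
Proof.
have u1 : cabs (Q ^+ 2) < cabs (t ^+ 2).
  by rewrite -exprM !cabsX exprM lterXn2r ?exprn_ge0 ?cabs_ge0 //= -!cabsX;
     rewrite cabsX expr2; apply: le_lt_trans qt; rewrite ler_piMl ?cabs_ge0 // ltW.
have u2 : cabs (t ^+ 2) < 1 by exact: cabs_sqr1.
have h := kz_theta_X Q0 Q1 u1 u2.
have d1 := jtheta_dup Q0 Q1 t0.
have d2 := jtheta_dup Q0 Q1 (mulf_neq0 q0 t0).
rewrite [(q * t) ^+ 2]exprMn in d2.
rewrite d2 /A.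
transitivity (aX Q * lau (kz (Q ^+ 2)) (t ^+ 2) * (lau (th Q) t * lau (th Q) (- t))).
  by move: (aX _) (lau _ _) (lau _ _) (lau _ _) => *; ring.
rewrite d1.
transitivity (lau (th (Q ^+ 2)) Q * (aX Q * lau (kz (Q ^+ 2)) (t ^+ 2) * lau (th (Q ^+ 2)) (t ^+ 2))).
  by move: (aX _) (lau _ _) (lau _ _) (lau _ _) => *; ring.
by rewrite h mulrA.
Qed.

(** [th_split] with base - q merges j(t;Q) and j(- q t;Q) into j(t;-q), [kz_theta_P] replaces K, and
    [th_split] at - t undoes the merging. *)
Let B_eq : B * lau (th Q) t =
  lau (th Q) (- t) * lau (th Q) (q * t) * lau (th Q) (- (q * t ^+ 2)).
Proof.
have [e he] := th_split b0 b1; rewrite bQ in he.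
have hq' : cabs b < cabs t by rewrite cabsN.
have h := kz_theta_P b0 b1 hq' t1; rewrite bQ in h.
have h1 := he t t0; have h2 := he (- t); rewrite oppr_eq0 in h2; have {}h2 := h2 t0.
rewrite mulrNN in h2; rewrite h2.
transitivity (aP b * lau (kz b) t * (lau (th Q) t * lau (th Q) (b * t))).
  by rewrite /B; move: (aP _) (lau _ _) (lau _ _) (lau _ _) => *; ring.
rewrite h1.
transitivity (e * (aP b * lau (kz b) t * lau (th b) t)).
  by move: (aP _) (lau _ _) (lau _ _) => *; ring.
by rewrite h mulrA mulNr.
Qed.

(* After multiplication by j(-y;q) the right-hand side is the sum of two products of
   theta functions, one for A and one for B. *)
Lemma mock_product : lau (th q) y * (A + y * B) =
  lau (th Q) q * (lau (th Q) (q * y ^+ 2) * lau (th q) (- y ^+ 3)).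
Proof.
have Ny0 : - y != 0 by rewrite oppr_eq0.
have Ny3 : - y ^+ 3 != 0 by rewrite oppr_eq0 expf_neq0.
(* At x = - y and z = - y^3 the addition formula has the arguments x z = t^2 and z / x = t, exactly
   those that occur in [A_eq] and [B_eq]. *)
have h := jtheta_mul q0 q1 Ny0 Ny3.
have e1 : - y * - y ^+ 3 = t ^+ 2 by rewrite /t; ring.
have e2 : q * - y ^+ 3 / - y = q * t by rewrite /t; field.
have e3 : q * - y * - y ^+ 3 = q * t ^+ 2 by rewrite /t; ring.
have e4 : - y ^+ 3 / - y = t by rewrite /t; field.
rewrite e1 e2 e3 e4 in h.
have d := jtheta_dup q0 q1 y0; rewrite -/t in d.
have nz : lau (th q) (- y) != 0 by apply: lau_th_neq0; rewrite ?cabsN.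
apply: (mulIf nz); rewrite -/t.
transitivity (lau (th Q) q * (A * lau (th Q) t + y * (B * lau (th Q) t))).
  transitivity (lau (th q) y * lau (th q) (- y) * (A + y * B)).
    by move: A B (lau _ _) (lau _ _) => *; ring.
  by rewrite d; move: A B (lau _ _) (lau _ _) => *; ring.
rewrite A_eq B_eq.
transitivity (lau (th Q) q * (lau (th Q) (q * t) * (lau (th q) (- y) * lau (th q) (- y ^+ 3)))).
  rewrite h.
  move: (lau (th Q) q) (lau (th Q) (q * t)) (lau (th Q) (- (q * t))).
  move: (lau (th Q) (- t)) (lau (th Q) (- t ^+ 2)) (lau (th Q) (- (q * t ^+ 2))) => *; ring.
by move: (lau (th Q) q) (lau (th Q) (q * t)) (lau (th q) (- y)) (lau (th q) (- y ^+ 3)) => *; ring.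
Qed.

End Point.
End MockLaurent.

Section Coefficients.
Variable R : realType.
Local Notation C := R[i].
Variable q : C.
Hypotheses (q0 : q != 0) (q1 : cabs q < 1).
Local Notation Q := (q ^+ 2).
Local Notation b := (- q).
Let b0 : b != 0. Proof. by rewrite oppr_eq0. Qed.
Let b1 : cabs b < 1. Proof. by rewrite cabsN. Qed.
Let Q0 : Q != 0. Proof. by rewrite expf_neq0. Qed.
Let Q1 : cabs Q < 1. Proof. exact: cabs_sqr1. Qed.
Let QQ0 : Q ^+ 2 != 0. Proof. by rewrite expf_neq0. Qed.
Let QQ1 : cabs (Q ^+ 2) < 1. Proof. exact: cabs_sqr1. Qed.
Let bQ : b ^+ 2 = Q. Proof. exact: sqrrN. Qed.

(* The coefficients of t^i in A(t) and B(t). *)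
Definition alpha (i : int) : C := aX Q * conv21 (kz (Q ^+ 2)) (trc Q) i.
Definition beta (i : int) : C := aP b * conv (sqc b) (kz b) i.

Section Point.
Variable y : C.
Hypotheses (hy : cabs q < cabs y ^+ 2) (y1 : cabs y < 1).
Let y0 : y != 0.
Proof.
rewrite -cabs_eq0; apply/eqP => e; move: hy; rewrite e expr0n /= => h.
by have := cabs_ge0 q; rewrite leNgt h.
Qed.
Let t : C := y ^+ 2.
Let t0 : t != 0. Proof. by rewrite expf_neq0. Qed.
Let qt : cabs q < cabs t. Proof. by rewrite cabsX. Qed.
Let bt : cabs b < cabs t. Proof. by rewrite cabsN. Qed.
Let t1 : cabs t < 1. Proof. by rewrite cabsX exprn_ilt1 // cabs_ge0. Qed.
Let u1 : cabs (Q ^+ 2) < cabs (t ^+ 2).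
Proof.
rewrite [cabs (Q ^+ 2)]cabsX [cabs (t ^+ 2)]cabsX ltrXn2r ?cabs_ge0 //.
by apply: le_lt_trans qt; rewrite cabsX expr2 ler_piMl ?cabs_ge0 // ltW.
Qed.
Let u2 : cabs (t ^+ 2) < 1. Proof. exact: cabs_sqr1. Qed.
Let aK := absum_lterm_kz QQ0 QQ1 u1 u2.
Let aKb := absum_lterm_kz b0 b1 bt t1.

Lemma absum_alpha : absum (lterm alpha t).
Proof.
have := absumZ (aX Q) (absum_conv21 t0 aK (rapid_trc Q1 t0)); apply: eq_absum => i.
by rewrite /lterm /alpha mulrA.
Qed.

Lemma absum_beta : absum (lterm beta t).
Proof.
have := absumZ (aP b) (absum_conv_term t0 (rapid_sqc b0 b1 t0) aKb); apply: eq_absum => i.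
by rewrite /lterm /beta mulrA.
Qed.

Lemma lau_alpha : lau alpha t = aX Q * lau (kz (Q ^+ 2)) (t ^+ 2) * lau (th Q) (- t).
Proof.
rewrite /alpha lauZ; last exact: absum_conv21 t0 aK (rapid_trc Q1 t0).
by rewrite -(lau_conv21 t0 aK (rapid_trc Q1 t0)) (lau_trc Q t0) mulrA.
Qed.

Lemma lau_beta : lau beta t = aP b * lau (kz b) t * lau (th Q) (b * t).
Proof.
rewrite /beta lauZ; last exact: absum_conv_term t0 (rapid_sqc b0 b1 t0) aKb.
by rewrite -(lau_conv t0 (rapid_sqc b0 b1 t0) aKb) (lau_sqc b0 b1 t0) bQ mulrCA mulrC.
Qed.

Let aT : absum (lterm (th q) y). Proof. exact: rapid_th. Qed.
(** The difference of the two sides of the product formula, coefficient by coefficient. *)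
Definition mock_defect (i : int) : C :=
  conv21 alpha (th q) i + conv21 beta (th q) (i - 1)
    - lau (th Q) q * conv23 (sqc q) (trc q) i.

Let y3 : y ^+ 3 != 0. Proof. by rewrite expf_neq0. Qed.
Let aN : absum (lterm (sqc q) (y ^+ 2)). Proof. exact: rapid_sqc. Qed.
Let aTq : absum (lterm (trc q) (y ^+ 3)). Proof. exact: rapid_trc. Qed.

Lemma mock_defect0 : absum (lterm mock_defect y) /\ lau mock_defect y = 0.
Proof.
have a1 := absum_conv21 y0 absum_alpha aT.
have a2 := absum_conv21 y0 absum_beta aT.
have a2' := absum_mulx y0 a2.
have a3 := absum_conv23 y0 aN aTq.
have a3' : absum (lterm (fun i => - (lau (th Q) q) * conv23 (sqc q) (trc q) i) y).
  by have := absumZ (- lau (th Q) q) a3; apply: eq_absum => i; rewrite /lterm mulrA.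
have a12 : absum (lterm (fun i => conv21 alpha (th q) i + conv21 beta (th q) (i - 1)) y).
  by have := absumD a1 a2'; apply: eq_absum => i; rewrite /lterm mulrDl.
have E : mock_defect =1 (fun i => (conv21 alpha (th q) i + conv21 beta (th q) (i - 1))
     + - lau (th Q) q * conv23 (sqc q) (trc q) i).
  by move=> i; rewrite /mock_defect mulNr.
split.
  by have := absumD a12 a3'; apply: eq_absum => i; rewrite /lterm E [RHS]mulrDl.
rewrite (funext E) lauD // lauD // lauZ // -lau_mulx //.
rewrite -(lau_conv21 y0 absum_alpha aT) -(lau_conv21 y0 absum_beta aT).
rewrite -(lau_conv23 y0 aN aTq) lau_alpha lau_beta.
have := mock_product q0 q1 hy y1.
rewrite -(lau_sqc q0 q1 t0) -(lau_trc q y3).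
move=> h; rewrite [- lau (th Q) q * _]mulNr -h -/t.
by move: (lau (th q) y) (aX Q * _ * _) (aP b * _ * _) => *; ring.
Qed.

End Point.

Lemma exists_point : exists y : C, cabs q < cabs y ^+ 2 /\ cabs y < 1.
Proof.
(* The mean of 1 and |q|: its square exceeds |q| by ((1 - |q|) / 2)^2. *)
have c0 := cabs_ge0 q; exists ((1 + cabs q) / 2)%:C.
rewrite cabs_real; move: (cabs q) c0 q1 => c c0 c1.
by rewrite ger0_norm; [split; nra | lra].
Qed.

Lemma mock_coefficient i :
  conv21 alpha (th q) i + conv21 beta (th q) (i - 1)
    = lau (th Q) q * conv23 (sqc q) (trc q) i.
Proof.
have [y [hy y1]] := exists_point.
have hz m : ((2 ^ m).-root (-1 : C)) ^+ (2 ^ m) = -1 by rewrite rootCK // expn_gt0.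
have zn m : cabs ((2 ^ m).-root (-1 : C)) = 1.
  have := hz m => /(congr1 (@cabs R)); rewrite cabsX cabsN cabs1 => /eqP.
  by rewrite pexpr_eq1 ?expn_gt0 ?cabs_ge0 // => /eqP.
apply/eqP; rewrite -subr_eq0; apply/eqP.
have Un0 z : cabs z = cabs y -> z != 0.
  rewrite -cabs_gt0 => e; have c0 := cabs_ge0 q; rewrite e lt_def cabs_ge0 andbT.
  by apply/eqP => e'; move: hy; rewrite e' expr0n /= => /(le_lt_trans c0); rewrite ltxx.
have Uz m z : cabs z = cabs y -> cabs ((2 ^ m).-root (-1 : C) * z) = cabs y.
  by move=> e; rewrite cabsM zn mul1r.
have h z : cabs z = cabs y -> absum (lterm mock_defect z) /\ lau mock_defect z = 0.
  by move=> e; apply: mock_defect0; rewrite e.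
by apply: (@lau_unique _ _ (fun z => cabs z = cabs y) hz Un0 Uz mock_defect y) => // z /h [].
Qed.

End Coefficients.

Lemma tri_dbl (j : int) : tri (2 * j) = 2 * (j * j) - j.
Proof. by have := triE (2 * j); lia. Qed.

Lemma sub_dbl_inj (i : int) : injective (fun j : int => i - 2 * j).
Proof. by move=> j j'; lia. Qed.

(** * Recursion, reflection and initial values of the mock sequence *)

Section MockSequence.
Variable R : realType.
Local Notation C := R[i].
Variable q : C.
Hypotheses (q0 : q != 0) (q1 : cabs q < 1).
Local Notation Q := (q ^+ 2).
Local Notation b := (- q).
Let b0 : b != 0. Proof. by rewrite oppr_eq0. Qed.
Let b1 : cabs b < 1. Proof. by rewrite cabsN. Qed.
Let Q0 : Q != 0. Proof. by rewrite expf_neq0. Qed.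
Let Q1 : cabs Q < 1. Proof. exact: cabs_sqr1. Qed.
Let QQ0 : Q ^+ 2 != 0. Proof. by rewrite expf_neq0. Qed.
Let QQ1 : cabs (Q ^+ 2) < 1. Proof. exact: cabs_sqr1. Qed.
Local Notation trcQ := (trc Q).
Local Notation sqcb := (sqc b).
Local Notation alpha := (alpha q).
Local Notation beta := (beta q).
Local Notation kA := (kz (Q ^+ 2)).

Lemma absum_bd_trc (x : int -> C) (B : R) i : (forall j, cabs (x j) <= B) ->
  absum (fun j => x j * trcQ (i - 2 * j)).
Proof.
move=> hB; apply: (absum_bdM hB).
have := @absum_comp _ _ _ (fun j : int => i - 2 * j) _ _ (rapid_absum (rapid_trc Q1)).
by apply; exact: sub_dbl_inj.
Qed.

Lemma absum_bd_sqc (x : int -> C) (B : R) : (forall j, cabs (x j) <= B) ->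
  absum (fun n => sqcb n * x n).
Proof.
move=> hB; have := rapid_bd hB (rapid_sqc b0 b1).
by apply: eq_absum => n; rewrite mulrC.
Qed.

Lemma trc_refl n : trcQ (1 - n) = trcQ n.
Proof. by rewrite /trc tri_refl. Qed.

(** Up to a shift or reflection of j the sum is the same for all i, and [aX_norm] gives its
    value. *)
Lemma sum_trc i : aX Q * tsum (fun j => trcQ (i - 2 * j)) = 1.
Proof.
rewrite -(aX_norm Q0 Q1); congr (_ * _).
have [m [->|->]] := int_parity i.
  rewrite (tsum_refl m); apply: eq_tsum => j; rewrite /trc; congr (_ ^ _).
  by rewrite (_ : 2 * m - 2 * (m - j) = 2 * j) ?tri_dbl //; ring.
rewrite [LHS](tsum_shift m); apply: eq_tsum => j; rewrite /trc; congr (_ ^ _).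
by rewrite (_ : 2 * m + 1 - 2 * (j + m) = 1 - 2 * j) ?tri_refl ?tri_dbl //; ring.
Qed.

(** This is k_(-j) = 2 - k_j carried through the convolution by the symmetry of the Gaussian;
    [sum_trc] evaluates what the constant 2 contributes. *)
Lemma alpha_refl i : alpha i + alpha (1 - i) = 2.
Proof.
have [B hB] := kz_bound QQ1.
have E : conv21 kA trcQ (1 - i) = tsum (fun j => (2 - kA j) * trcQ (i - 2 * j)).
  rewrite /conv21 (tsum_refl 0); apply: eq_tsum => j.
  by rewrite sub0r kz_opp -trc_refl; congr (_ * trcQ _); lia.
have h2 j : cabs (2 - kA j) <= 2 + B.
  by apply: le_trans (cabsB _ _) _; rewrite cabs_nat lerD2l.
rewrite /alpha E -mulrDr -tsumD; [|exact: absum_bd_trc hB|exact: absum_bd_trc h2].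
have -> : tsum (fun j => kA j * trcQ (i - 2 * j) + (2 - kA j) * trcQ (i - 2 * j))
    = 2 * tsum (fun j => trcQ (i - 2 * j)).
  rewrite -tsumZ; first by apply: eq_tsum => j; ring.
  have one (j : int) : cabs ((fun _ : int => 1 : C) j) <= 1 by rewrite cabs1.
  by have := absum_bd_trc i one; apply: eq_absum => j; rewrite mul1r.
by rewrite mulrCA sum_trc mulr1.
Qed.

(** This is [kz_refl] carried through the convolution. With [alpha_refl] it yields the recursion of
    step 5. *)
Lemma alpha_opp i : alpha (- i) = - (Q ^ (i - 2) * alpha (i - 4)).
Proof.
have [B hB] := kz_bound QQ1.
rewrite /alpha mulrCA -mulrN; congr (_ * _).
rewrite /conv21 -mulNr -tsumZ; last exact: absum_bd_trc hB.
rewrite (tsum_refl (-2)); apply: eq_tsum => j.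
rewrite (_ : -2 - j = - (j + 2)) ?(kz_refl QQ0 QQ1); last by lia.
rewrite addrK (_ : j + 2 - 1 = j + 1); last by lia.
rewrite /trc (_ : (Q ^+ 2) ^ (j + 1) = Q ^ (2 * (j + 1))); last by rewrite exprnP exprz_exp.
have -> : Q ^ tri (- i - 2 * - (j + 2)) = Q ^ (i - 2) * (Q ^ tri (i - 4 - 2 * j) / Q ^ (2 * (j + 1))).
  rewrite invr_expz -!expfzDr //; congr (_ ^ _).
  by have := triE (- i - 2 * - (j + 2)); have := triE (i - 4 - 2 * j); lia.
have := expfz_neq0 (2 * (j + 1)) Q0.
move: (kA j) (Q ^ (i - 2)) (Q ^ tri _) (Q ^ (2 * _)) => x y z w w0.
by field.
Qed.

Lemma alpha_rec i : alpha (i + 5) = 2 + q ^ (2 * i + 4) * alpha i.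
Proof.
have := alpha_refl (i + 5); rewrite (_ : 1 - (i + 5) = - (i + 4)); last by lia.
rewrite alpha_opp addrK (_ : i + 4 - 2 = i + 2); last by lia.
rewrite exprnP exprz_exp (_ : 2 * (i + 2) = 2 * i + 4); last by lia.
by move=> <-; rewrite subrK.
Qed.

Lemma alpha_0 : alpha 0 = X10 Q.
Proof.
rewrite (X10E Q0 Q1) /alpha; congr (_ * _).
rewrite /conv21 (tsum_refl 0); apply: eq_tsum => j; rewrite !sub0r /trc.
by rewrite (_ : - (2 * - j) = 2 * j) ?tri_dbl //; ring.
Qed.

(** [chi10E] evaluates the coefficient at 2, and the reflection moves it to -1. *)
Lemma alpha_N1 : alpha (-1) = chi10 Q.
Proof.
have := alpha_refl (-1); rewrite (_ : 1 - -1 = 2 :> int) // => h.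
have := chi10E Q0 Q1.
have -> : aX Q * tsum (fun i => kA (1 - i) * Q ^ (2 * (i * i) - i)) = alpha 2.
  rewrite /alpha; congr (_ * _).
  rewrite /conv21 [RHS](tsum_refl 1); apply: eq_tsum => j; rewrite /trc.
  by rewrite (_ : 2 - 2 * (1 - j) = 2 * j) ?tri_dbl //; ring.
by move=> e; rewrite -(subKr 2 (chi10 Q)) e -h addrK.
Qed.

Lemma sqc_opp n : sqcb (- n) = sqcb n.
Proof. by rewrite /sqc sgnzN mulrNN. Qed.

Lemma sum_sqc : aP b * tsum sqcb = 1.
Proof. by rewrite -(aP_norm b0 b1). Qed.

Lemma absum_sqc : absum sqcb.
Proof. exact/rapid_absum/rapid_sqc. Qed.

Lemma beta_refl i : beta i + beta (- i) = 2.
Proof.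
have [B hB] := kz_bound b1.
have h2 j : cabs (2 - kz b (i - j)) <= 2 + B.
  by apply: le_trans (cabsB _ _) _; rewrite cabs_nat lerD2l.
have E : conv sqcb (kz b) (- i) = tsum (fun n => sqcb n * (2 - kz b (i - n))).
  rewrite /conv (tsum_refl 0); apply: eq_tsum => n.
  by rewrite sub0r sqc_opp -kz_opp; congr (_ * kz _ _); lia.
rewrite /beta E -mulrDr -tsumD; [|exact: absum_bd_sqc (fun j => hB (i - j))|exact: absum_bd_sqc h2].
have -> : tsum (fun n => sqcb n * kz b (i - n) + sqcb n * (2 - kz b (i - n))) = 2 * tsum sqcb.
  by rewrite -tsumZ; [apply: eq_tsum => n; ring | exact: absum_sqc].
by rewrite mulrCA sum_sqc mulr1.
Qed.

Lemma sum_sqc_odd : tsum (fun n => sqcb n * b ^ (- n)) = 0.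
Proof.
have a : absum (fun n => sqcb n * b ^ (- n)).
  have := rapid_sqc b0 b1 (_ : b^-1 != 0); rewrite invr_eq0 => /(_ b0).
  by apply: eq_absum => n; rewrite /lterm exprz_inv.
apply: (tsum_antisym (m := 1) a) => n.
have e1 : (-1 : C) ^ (1 - n) = - (-1) ^ n by rewrite sgnzD expr1z sgnzN mulN1r.
have e2 : b ^ ((1 - n) * (1 - n)) * b ^ (- (1 - n)) = b ^ (n * n) * b ^ (- n).
  by rewrite -!expfzDr //; congr (_ ^ _); ring.
by rewrite /sqc e1 -!mulrA e2 mulNr.
Qed.

(** The recursion of k is applied twice. The cross term vanishes by [sum_sqc_odd], and the odd power
    of b = - q turns the remaining minus sign into a plus. *)
Lemma beta_rec i : beta (i + 5) = 2 + q ^ (2 * i + 5) * beta i.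
Proof.
have [B hB] := kz_bound b1.
have bi : b ^ (2 * i + 5) = - q ^ (2 * i + 5).
  have -> : 2 * i + 5 = 2 * (i + 2) + 1 by ring.
  by rewrite (exprzNl _ q0) sgnzD sgnz2 expr1z mul1r mulN1r.
have E n : sqcb n * kz b (i + 5 - n) =
    2 * sqcb n + (2 * b ^ (i + 4) * (sqcb n * b ^ (- n)) - b ^ (2 * i + 5) * (sqcb (n - 1) * kz b (i - (n - 1)))).
  rewrite (kz_recz b0 b1 (i + 5 - n)) (kz_recz b0 b1 (i + 5 - n - 2)).
  have -> : i + 5 - n - 2 - 2 = i - (n - 1) by lia.
  have -> : i + 5 - n - 1 = i + 4 - n by lia.
  have -> : i + 5 - n - 2 - 1 = i + 2 - n by lia.
  have e : sqcb n * (b ^ (i + 4 - n) * b ^ (i + 2 - n)) = - (b ^ (2 * i + 5) * sqcb (n - 1)).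
    have e1 : (-1 : C) ^ (n - 1) = - (-1) ^ n by rewrite sgnzD sgnzN expr1z mulrN1.
    have e2 : b ^ (n * n) * (b ^ (i + 4 - n) * b ^ (i + 2 - n)) = b ^ (2 * i + 5) * b ^ ((n - 1) * (n - 1)).
      by rewrite -!expfzDr //; congr (_ ^ _); ring.
    by rewrite /sqc e1 -mulrA e2 mulNr mulrN opprK mulrCA.
  have e2 : b ^ (i + 4 - n) = b ^ (i + 4) * b ^ (- n) by rewrite -expfzDr.
  transitivity (2 * sqcb n + 2 * (sqcb n * b ^ (i + 4 - n))
      + sqcb n * (b ^ (i + 4 - n) * b ^ (i + 2 - n)) * kz b (i - (n - 1))).
    by move: (sqcb n) (kz _ _) (b ^ _) (b ^ _) => *; ring.
  rewrite e e2.
  by move: (sqcb n) (sqcb _) (kz _ _) (b ^ (i + 4)) (b ^ (- n)) (b ^ _) => *; ring.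
have a1 := absumZ 2 absum_sqc.
have a2 : absum (fun n => sqcb n * b ^ (- n)).
  have := rapid_sqc b0 b1 (_ : b^-1 != 0); rewrite invr_eq0 => /(_ b0).
  by apply: eq_absum => n; rewrite /lterm exprz_inv.
have a2' := absumZ (2 * b ^ (i + 4)) a2.
have a3 := absum_shift (-1) (absum_bd_sqc (fun n => hB (i - n))).
have a3' := absumZ (b ^ (2 * i + 5)) a3.
rewrite /beta /conv (eq_tsum E) tsumD //; last exact: absumB.
rewrite tsumB // !tsumZ //; last exact: absum_sqc.
rewrite sum_sqc_odd mulr0 sub0r -(tsum_shift (-1) (fun n => sqcb n * kz b (i - n))) bi.
have := sum_sqc; move: (aP b) (tsum _) (tsum _) (q ^ _) => x y z w e.
by rewrite mulrDr mulrCA e; ring.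
Qed.

Lemma beta_N1 : beta (-1) = - psi10 b.
Proof.
rewrite (psi10E b0 b1) /beta -mulrN; congr (_ * _); rewrite -tsumN; last first.
  have [B hB] := kz_bound b1.
  have := rapid_bd (fun n => hB (-1 - n)) (rapid_scale (_ : b^-1 != 0) (rapid_sqc b0 b1)).
  rewrite invr_eq0 => /(_ b0); apply: eq_absum => n.
  rewrite /lterm /sqc exprz_inv -!mulrA -expfzDr //.
rewrite /conv (tsum_refl 0); apply: eq_tsum => n; rewrite sub0r sqc_opp.
rewrite (_ : -1 - - n = - (- n + 1)) ?(kz_refl b0 b1); last by lia.
rewrite addrK (_ : - n + 1 - 2 = -1 - n); last by lia.
rewrite /sqc expfzDr //.
by move: ((-1) ^ n) (b ^ (n * n)) (b ^ (- n)) (kz _ _) => *; ring.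
Qed.

Lemma beta_N2 : beta (-2) = q * phi10 b.
Proof.
rewrite (phi10E b0 b1) /beta mulrCA; congr (_ * _); rewrite -tsumZ; last first.
  have [B hB] := kz_bound b1.
  have := rapid_bd (fun n => hB (- n)) (rapid_scale (_ : b^-1 != 0) (rapid_sqc b0 b1)).
  rewrite invr_eq0 => /(_ b0); apply: eq_absum => n.
  rewrite /lterm /sqc exprz_inv -!mulrA -expfzDr //.
rewrite /conv (tsum_refl 0); apply: eq_tsum => n; rewrite sub0r sqc_opp.
have E : b ^ (n - 1) * b ^ (n * n - n) * b = b ^ (n * n).
  by rewrite -[X in _ * X](expr1z b) -!expfzDr //; congr (_ ^ _); ring.
rewrite (_ : -2 - - n = n - 2) ?(kz_refl b0 b1 n); last by ring.
rewrite /sqc -E; move: ((-1) ^ n) (b ^ (n - 1)) (b ^ (n * n - n)) (kz _ _) => *; ring.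
Qed.

(* The coefficient of y^(N+1) in A(y^2) + y B(y^2). *)
Definition cseq (N : int) : C :=
  if (N %% 2)%Z == 0 then beta (N %/ 2)%Z else alpha ((N %/ 2)%Z + 1).

Lemma cseq_even i : cseq (2 * i) = beta i.
Proof. by rewrite /cseq ifT; [congr beta; lia | lia]. Qed.

Lemma cseq_odd i : cseq (2 * i - 1) = alpha i.
Proof. by rewrite /cseq ifF; [congr alpha; lia | lia]. Qed.

Lemma parity_odd (N : int) : exists i, N = 2 * i \/ N = 2 * i - 1.
Proof. by have [m [->|->]] := int_parity N; [exists m; left | exists (m + 1); right; lia]. Qed.

Lemma cseq_refl N : cseq N + cseq (- N) = 2.
Proof.
have [i [->|->]] := parity_odd N.
  by rewrite (_ : - (2 * i) = 2 * - i) ?cseq_even ?beta_refl //; lia.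
by rewrite (_ : - (2 * i - 1) = 2 * (1 - i) - 1) ?cseq_odd ?alpha_refl //; lia.
Qed.

Lemma cseq_rec N : cseq (N + 10) = 2 + q ^ (N + 5) * cseq N.
Proof.
have [i [->|->]] := parity_odd N.
  by rewrite (_ : 2 * i + 10 = 2 * (i + 5)) ?cseq_even ?beta_rec //; lia.
rewrite (_ : 2 * i - 1 + 10 = 2 * (i + 5) - 1) ?cseq_odd ?alpha_rec; last by lia.
by rewrite (_ : 2 * i - 1 + 5 = 2 * i + 4) //; lia.
Qed.

Lemma cseq_0 : cseq 0 = 1.
Proof.
have := cseq_refl 0; rewrite oppr0 -mulr2n -[2](mulr2n (1 : C)) => h.
have two0 : (2 : C) != 0 by rewrite pnatr_eq0.
by apply: (mulfI two0); rewrite mulr1 mulr_natl h.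
Qed.

(** At N = -5 the recursion has the factor q^0 = 1, so c_5 - c_(-5) = 2, while the reflection gives
    c_5 + c_(-5) = 2. *)
Lemma cseq_5 : cseq 5 = 2.
Proof.
have h1 := cseq_refl (-5); have h2 := cseq_rec (-5).
rewrite opprK in h1; rewrite addNr expr0z mul1r (_ : -5 + 10 = 5 :> int) // in h2.
have two0 : (2 : C) != 0 by rewrite pnatr_eq0.
apply: (mulfI two0); rewrite mulr_natl mulr2n {1}h2.
by rewrite -addrA h1; ring.
Qed.

Lemma cseq_N1 : cseq (-1) = X10 Q.
Proof. by rewrite -alpha_0 -cseq_odd. Qed.

Lemma cseq_N2 : cseq (-2) = - psi10 b.
Proof. by rewrite -beta_N1 -cseq_even. Qed.

Lemma cseq_N3 : cseq (-3) = chi10 Q.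
Proof. by rewrite -alpha_N1 -cseq_odd. Qed.

Lemma cseq_N4 : cseq (-4) = q * phi10 b.
Proof. by rewrite -beta_N2 -cseq_even. Qed.

Lemma cseq_bound : exists B, forall N, cabs (cseq N) <= B.
Proof.
have [B hB] := kz_bound QQ1; have [B' hB'] := kz_bound b1.
have [M hM] := rapid_absum (rapid_trc Q1).
have [M' hM'] := rapid_absum (rapid_sqc b0 b1).
have B0 : 0 <= B by apply: le_trans (hB 0); exact: cabs_ge0.
have B'0 : 0 <= B' by apply: le_trans (hB' 0); exact: cabs_ge0.
have M0 : 0 <= M by have := hM [::] isT; rewrite big_nil.
have M'0 : 0 <= M' by have := hM' [::] isT; rewrite big_nil.
exists (cabs (aX Q) * (B * M) + cabs (aP b) * (B' * M')) => N.
have pA := cabs_ge0 (aX Q); have pP := cabs_ge0 (aP b).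
have hA := mulr_ge0 pA (mulr_ge0 B0 M0); have hP := mulr_ge0 pP (mulr_ge0 B'0 M'0).
rewrite /cseq; case: ifP => _; rewrite cabsM.
  apply: (@le_trans _ _ (cabs (aP b) * (B' * M'))); last by rewrite lerDr.
  apply: (ler_wpM2l pP).
  have a := absum_bd_sqc (fun n => hB' ((N %/ 2)%Z - n)).
  apply: (hsum_cabs_le (tsumP a)) => s us.
  apply: (@le_trans _ _ (\sum_(i <- s) B' * cabs (sqcb i))).
    by apply: ler_sum => i _; rewrite cabsM mulrC ler_wpM2r ?cabs_ge0.
  by rewrite -mulr_sumr; apply: (ler_wpM2l B'0); exact: hM'.
apply: (@le_trans _ _ (cabs (aX Q) * (B * M))); last by rewrite lerDl.
apply: (ler_wpM2l pA).
set i := (_ + 1); have a := absum_bd_trc i hB.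
apply: (hsum_cabs_le (tsumP a)) => s us.
apply: (@le_trans _ _ (\sum_(j <- s) B * cabs (trcQ (i - 2 * j)))).
  by apply: ler_sum => j _; rewrite cabsM ler_wpM2r ?cabs_ge0.
rewrite -mulr_sumr; apply: (ler_wpM2l B0).
rewrite -(big_map (fun j => i - 2 * j) predT (fun j => cabs (trcQ j))); apply: hM.
by rewrite (map_inj_uniq (@sub_dbl_inj i)).
Qed.

Lemma absum_cseq_th I : absum (fun N => cseq N * th q (I - N)).
Proof.
have [B hB] := cseq_bound.
by have := rapid_bd hB (rapid_refl I (rapid_th q1)).
Qed.

(** The coefficient of y^(I+1) in the product formula, with the even and odd parts merged into one
    sum over N. *)
Lemma sum_cseq_th I : tsum (fun N => cseq N * th q (I - N)) =
  lau (th Q) q * tsum (fun k => (-1) ^ (3 * k - (I + 1))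
     * q ^ ((3 * k - (I + 1)) * (3 * k - (I + 1)) + tri (I + 1 - 2 * k))).
Proof.
have := mock_coefficient q0 q1 (I + 1); rewrite addrK.
have -> : conv23 (sqc q) (trc q) (I + 1)
   = tsum (fun k => (-1) ^ (3 * k - (I + 1))
     * q ^ ((3 * k - (I + 1)) * (3 * k - (I + 1)) + tri (I + 1 - 2 * k))).
  by apply: eq_tsum => k; rewrite /sqc /trc -mulrA -expfzDr.
move=> <-.
rewrite (@tsum_split _ _ _ _ (fun i => 2 * i - 1) (fun i => 2 * i)
   (fun N : int => (N %% 2)%Z != 0)); last exact: absum_cseq_th.
- congr (_ + _); apply: eq_tsum => i /=.
    by rewrite cseq_odd; congr (_ * th _ _); lia.
  by rewrite cseq_even.
- by move=> i j; lia.
- by move=> i j; lia.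
- by move=> i /=; lia.
- by move=> i /=; lia.
- by move=> N h; exists ((N + 1) %/ 2)%Z; lia.
- by move=> N h; exists (N %/ 2)%Z; lia.
Qed.

End MockSequence.

(** * Comparison of coefficients *)

Section Residues.
Variable R : realType.
Local Notation C := R[i].

Lemma tsum_residue (m : nat) (f : int -> C) : absum f ->
  tsum f = \sum_(i < m.+1) tsum (fun k => f (i%:Z + m.+1%:Z * k)).
Proof.
move=> af; pose h (p : 'I_m.+1 * int) : int := (p.1 : nat)%:Z + m.+1%:Z * p.2.
pose g (n : int) : 'I_m.+1 * int := (inord `|(n %% m.+1%:Z)%Z|%N, (n %/ m.+1%:Z)%Z).
have hg : cancel h g.
  move=> [i k]; rewrite /h /g /=; have hi : (i < m.+1)%N by [].
  have e : (i%:Z + m.+1%:Z * k = k * m.+1%:Z + i%:Z) by rewrite mulrC addrC.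
  congr (_, _); last by rewrite e divzMDl // divz_nat divn_small // addr0.
  by apply/val_inj; rewrite /= e modzMDl modz_nat modn_small ?inordK.
have gh : cancel g h.
  move=> n; rewrite /h /g /= inordK; last by rewrite -ltz_nat gez0_abs ?modz_ge0 ?ltz_pmod.
  by rewrite gez0_abs ?modz_ge0 // addrC mulrC -divz_eq.
rewrite (tsum_bij f hg gh) tsum_pair; last exact: absum_comp (can_inj hg) _ af.
rewrite (@tsum_fin _ _ _ (index_enum 'I_m.+1)) ?index_enum_uniq //.
by move=> i; rewrite mem_index_enum.
Qed.

(** Two sign conventions at 0: [sgc] takes the value 0 and [sgk] the value 1. The value 0 halves the
    weight on the edge N = 10 k of the cone in [pterm], which fits c_0 = 1. *)
Definition sgc (n : int) : C := if n == 0 then 0 else if 0 < n then 1 else -1.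
Definition sgk (n : int) : C := if 0 <= n then 1 else -1.

Lemma cabs_sgc n : cabs (sgc n) <= 1.
Proof. by rewrite /sgc; do 2?case: ifP => _; rewrite ?cabs0 ?cabsN ?cabs1. Qed.

Lemma cabs_sgk n : cabs (sgk n) <= 1.
Proof. by rewrite /sgk; case: ifP => _; rewrite ?cabsN cabs1. Qed.

Lemma sgc_sgk0 m k : k * m < 0 -> sgc m + sgk k = 0.
Proof.
rewrite /sgc /sgk; case: (ltrgtP m 0) => [m0|m0|->]; last by rewrite mulr0.
  rewrite nmulr_llt0 // => k0; rewrite (ltW k0); exact: addNr.
by rewrite pmulr_llt0 // => k0; rewrite leNgt k0 /=; exact: subrr.
Qed.

Lemma sgk_succ k : sgk (k + 1) = sgk k + (if k == -1 then 2 else 0).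
Proof.
rewrite /sgk; case: eqVneq => [->|k1] /=; first by ring.
by rewrite addr0 (_ : (0 <= k + 1) = (0 <= k)) //; lia.
Qed.
Lemma sum_ord10 (f : int -> C) : \sum_(i < 10) f (i%:Z - 4) =
  f (-4) + f (-3) + f (-2) + f (-1) + f 0 + f 1 + f 2 + f 3 + f 4 + f 5.
Proof. by rewrite !big_ord_recr big_ord0 /= add0r. Qed.
End Residues.

Section Gauss.
Variable R : realType.
Local Notation C := R[i].
Variable q : C.
Hypotheses (q0 : q != 0) (q1 : cabs q < 1).

(** Summed over k, this says that a Gaussian series is the theta function j(- q^(a+x);q^(2a)). *)
Lemma gauss_lterm (a x k : int) :
  q ^ (a * (k * k) + x * k) = lterm (th (q ^ (2 * a))) (- q ^ (a + x)) k.
Proof.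
have k0 := expfz_neq0 (a + x) q0.
rewrite /lterm thE (exprzNl k k0) !exprz_exp mulrACA sgnzz mul1r -expfzDr //; congr (_ ^ _).
by rewrite mulrAC triE; ring.
Qed.

Lemma cabs_qz_lt1 (a : int) : 0 < a -> cabs (q ^ a) < 1.
Proof.
case: a => // -[//|n] _; rewrite -exprnP cabsX exprn_ilt1 ?cabs_ge0 //.
Qed.

Lemma absum_gaussz (a x : int) : 0 < a -> absum (fun k => q ^ (a * (k * k) + x * k)).
Proof.
move=> a0; have k0 : - q ^ (a + x) != 0 by rewrite oppr_eq0 expfz_neq0.
have a2 : cabs (q ^ (2 * a)) < 1 by apply: cabs_qz_lt1; lia.
by have := rapid_th a2 k0; apply: eq_absum => k; rewrite gauss_lterm.
Qed.

(** The theta coefficient at - 10 k is q^(50 k^2 + 5 k), without sign because 10 k is even. With the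
    5 k^2 of the recursion it makes 55 k^2. *)
Lemma th_row r s k : q ^ (5 * (k * k) + s * k) * th q (- r - (s + 10 * k))
  = th q (- r) * (th q (- s) * q ^ (r * s))
    * q ^ (55 * (k * k) + (10 * r + 11 * s + 5) * k).
Proof.
have e : th q (- (10 * k)) = q ^ (50 * (k * k) + 5 * k).
  rewrite thE (_ : - (10 * k) = 2 * (- 5 * k)) ?sgnz2 ?mul1r; last by ring.
  by rewrite tri_dbl; congr (_ ^ _); ring.
rewrite (_ : - r - (s + 10 * k) = (- r + - s) + - (10 * k)); last by ring.
rewrite thD // e thD //.
have -> : - r * - s = r * s by ring.
have e2 : q ^ (5 * (k * k) + s * k) * (q ^ (50 * (k * k) + 5 * k) * q ^ ((- r - s) * - (10 * k)))
   = q ^ (55 * (k * k) + (10 * r + 11 * s + 5) * k).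
  by rewrite -!expfzDr //; congr (_ ^ _); ring.
rewrite -e2.
move: (q ^ (5 * (k * k) + s * k)) (q ^ (50 * (k * k) + 5 * k)) (q ^ ((- r - s) * - (10 * k))).
move: (q ^ (r * s)) (th q (- r)) (th q (- s)) => *; ring.
Qed.

(* The term e contributes a multiple of j(q^(j+1);q) = 0. *)
Lemma row_sum (j : int) (e : C) :
  tsum (fun m => (sgc R m + e) * (th q (- m) * q ^ (j * m))) = rho q j - rho q (- j - 1).
Proof.
have k0 := expfz_neq0 (j + 1) q0; have aT := rapid_th q1 k0.
have E m : th q (- m) * q ^ (j * m) = lterm (th q) (q ^ (j + 1)) m.
  by rewrite th_opp // /lterm mulrC mulrA -expfzDr // exprz_exp mulrC; congr (_ * _ ^ _); ring.
have aS : absum (fun m => sgc R m * lterm (th q) (q ^ (j + 1)) m).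
  exact: absum_bdM (@cabs_sgc R) aT.
have -> : tsum (fun m => (sgc R m + e) * (th q (- m) * q ^ (j * m)))
   = tsum (fun m => sgc R m * lterm (th q) (q ^ (j + 1)) m) + e * lau (th q) (q ^ (j + 1)).
  rewrite lau.unlock -tsumZ // -tsumD //; last exact: absumZ.
  by apply: eq_tsum => m; rewrite E mulrDl.
rewrite lau_th_qz // mulr0 addr0.
have -> : rho q j - rho q (- j - 1) = (rho q j - 1) + rho q j.
  by rewrite -(rho_refl q0 q1 j); ring.
rewrite tsum_int //; congr (_ + _).
  rewrite (tsum_natS (absum_Posz aS)) /sgc eqxx mul0r add0r.
  rewrite [in RHS]rho_rec // [1 - _]addrC addrK /rho -tsumZ; last exact: absum_rho.
  rewrite -tsumN; last by apply: absumZ; exact: absum_rho.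
  apply: eq_tsum => n; rewrite /= mul1r /lterm -exprnP exprS.
  by move: (th _ _) (q ^ _) => x y; ring.
rewrite (rho_opp q0 q1) /rho -tsumZ; last exact: absum_rho.
apply: eq_tsum => n; rewrite -E NegzE /= opprK /sgc /=.
rewrite (_ : j * - n.+1%:Z = - j + - j * n%:Z); last by rewrite -addn1 PoszD; ring.
rewrite expfzDr // -exprz_exp -exprnP.
by move: (th _ _) (q ^ _) (_ ^+ _) => x y z; ring.
Qed.
End Gauss.

(** * Particular and homogeneous solutions of the recursion *)

Section FinalAlgebra.
Variable R : realType.
Local Notation C := R[i].
Variable q : C.
Hypotheses (q0 : q != 0) (q1 : cabs q < 1).
Local Notation Q := (q ^+ 2).

(* The sum over k is finite: the sign factor vanishes unless k lies between 0 and N / 10.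
   It also makes the exponent k (N - 10 k) nonnegative, so that the sum over both N and k
   in sum_ppart_th converges absolutely. *)
Definition pterm (N k : int) : C := (sgc R (N - 10 * k) + sgk R k) * q ^ (k * N - 5 * (k * k)).

(** Where k m < 0 the two signs cancel; elsewhere |q^(k m)| <= 1. *)
Lemma cone_bound m k : cabs ((sgc R m + sgk R k) * q ^ (k * m)) <= 2.
Proof.
have [h|h] := leP 0 (k * m); last by rewrite sgc_sgk0 // mul0r cabs0.
have h1 := cabsD (sgc R m) (sgk R k); have h2 := cabs_sgc R m; have h3 := cabs_sgk R k.
have h4 := cabs_qz h q1; have p1 := cabs_ge0 (sgc R m + sgk R k).
rewrite cabsM; move: h1 h2 h3 h4 p1 (cabs_ge0 (q ^ (k * m))).
move: (cabs _) (cabs _) (cabs (sgc R m)) (cabs (sgk R k)) => a b c d; nra.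
Qed.

Lemma ptermE N k :
  pterm N k = (sgc R (N - 10 * k) + sgk R k) * q ^ (k * (N - 10 * k)) * q ^ (5 * (k * k) + 0 * k).
Proof. by rewrite /pterm -mulrA -expfzDr //; congr (_ * _ ^ _); ring. Qed.

Lemma absum_pterm N : absum (pterm N).
Proof.
have a5 : (0 : int) < 5 by [].
have := absum_bdM (fun k => cone_bound (N - 10 * k) k) (absum_gaussz q0 q1 0 a5).
by apply: eq_absum => k; rewrite ptermE.
Qed.

Definition ppart (N : int) : C := tsum (pterm N).

(** Replacing k by k + 1 reproduces the homogeneous recursion, except that [sgk] jumps by 2 at k =
    -1, where the exponent of q is 0. *)
Lemma ppart_rec N : ppart (N + 10) = 2 + q ^ (N + 5) * ppart N.
Proof.
have aN := absum_pterm N.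
pose d (k : int) : C := if k == -1 then 2 else 0.
have d0 i : i \notin [:: (-1) : int] -> d i = 0 by rewrite /d inE => /negPf ->.
have ad : absum d by apply: (@absum_fin _ _ _ [:: -1]).
have td : tsum d = 2 by rewrite (@tsum_fin _ _ _ [:: -1]) // big_seq1 /d eqxx.
rewrite -td -tsumZ // -tsumD //; last exact: absumZ.
rewrite /ppart (tsum_shift 1); apply: eq_tsum => k; rewrite /pterm sgk_succ -/(d k).
have -> : N + 10 - 10 * (k + 1) = N - 10 * k by ring.
have -> : (k + 1) * (N + 10) - 5 * ((k + 1) * (k + 1)) = (N + 5) + (k * N - 5 * (k * k)) by ring.
rewrite expfzDr //; set x := q ^ (N + 5); set y := q ^ _.
have e : d k * (x * y) = d k.
  rewrite /d /x /y; case: eqVneq => [->|_]; last by rewrite mul0r.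
  by rewrite -expfzDr // (_ : N + 5 + _ = 0) ?expr0z ?mulr1 //; ring.
by rewrite -[in RHS]e; ring.
Qed.

Lemma ppart_small N : (-10 < N) -> N < 10 -> ppart N = sgc R N + 1.
Proof.
move=> h1 h2; rewrite /ppart (@tsum_fin _ _ _ [:: 0]) //.
  by rewrite big_seq1 /pterm mulr0 subr0 !mul0r mulr0 subr0 expr0z mulr1.
move=> k; rewrite inE => k0; rewrite /pterm sgc_sgk0 ?mul0r //.
have [kp|kn] := ltP 0 k; first by rewrite pmulr_rlt0 //; lia.
by rewrite nmulr_rlt0; lia.
Qed.

Definition epart (N : int) : C := cseq q N - ppart N.

Lemma epart_rec N : epart (N + 10) = q ^ (N + 5) * epart N.
Proof. by rewrite /epart cseq_rec // ppart_rec; ring. Qed.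

Lemma epart_row (s k : int) : epart (s + 10 * k) = q ^ (5 * (k * k) + s * k) * epart s.
Proof.
move: k; apply: (@int_ind2 (fun k => epart (s + 10 * k) = q ^ (5 * (k * k) + s * k) * epart s) 1) => //.
- by case=> // _; rewrite !mulr0 !addr0 expr0z mul1r.
- move=> k e; rewrite (_ : s + 10 * (k + 1) = s + 10 * k + 10); last by ring.
  rewrite epart_rec e mulrA -expfzDr //; congr (_ ^ _ * _); ring.
- move=> k; rewrite (_ : s + 10 * (k + 1%:Z) = s + 10 * k + 10); last by ring.
  have k0 := expfz_neq0 (s + 10 * k + 5) q0.
  rewrite epart_rec => e; apply: (mulfI k0); rewrite e [RHS]mulrA -expfzDr //.
  congr (_ ^ _ * _); ring.
Qed.

Definition gsum (x : int) : C := tsum (fun k => q ^ (55 * (k * k) + x * k)).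

Definition srow (r : int) : C :=
  tsum (fun k => q ^ (55 * (k * k) + (10 * r + 5) * k)
    * (rho q (11 * k + r) - rho q (- (11 * k + r) - 1))).

Lemma absum_srow (r : int) : absum (fun k => q ^ (55 * (k * k) + (10 * r + 5) * k)
    * (rho q (11 * k + r) - rho q (- (11 * k + r) - 1))).
Proof.
have [B [_ hB]] := rho_bound q0 q1; have a55 : (0 : int) < 55 by [].
have h k : cabs (rho q (11 * k + r) - rho q (- (11 * k + r) - 1)) <= B + B.
  by apply: le_trans (cabsB _ _) _; apply: lerD; exact: (proj1 (hB _)).
by have := absum_bdM h (absum_gaussz q0 q1 (10 * r + 5) a55); apply: eq_absum => k; rewrite mulrC.
Qed.

Section Row.
Variable r : int.

Let F (p : int * int) : C := pterm p.2 p.1 * th q (- r - p.2).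

Let aF : absum F.
Proof.
have a5 : (0 : int) < 5 by [].
have a1 := absum_mul (absum_gaussz q0 q1 0 a5) (rapid_absum (rapid_refl (- r) (rapid_th q1))).
have := absum_bdM (fun p : int * int => cone_bound (p.2 - 10 * p.1) p.1) a1.
by apply: eq_absum => -[k N]; rewrite /F ptermE /= mulrA.
Qed.

Lemma absum_ppart_th : absum (fun N => ppart N * th q (- r - N)).
Proof.
have sw : injective (fun p : int * int => (p.2, p.1)) by move=> [? ?] [? ?] [-> ->].
have := absum_outer (absum_comp sw aF); apply: eq_absum => N.
rewrite /ppart mulrC -tsumZ; last exact: absum_pterm.
by apply: eq_tsum => k; rewrite /F /= mulrC.
Qed.

(** The sum over N is done first. With N = m + 10 k it becomes [row_sum] at j = 11 k + r: the theta
    coefficient contributes (10 k + r) m to the exponent and [pterm] contributes k m. *)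
Lemma sum_ppart_th : tsum (fun N => ppart N * th q (- r - N)) = th q (- r) * srow r.
Proof.
transitivity (tsum (fun N => tsum (fun k => F (k, N)))).
  apply: eq_tsum => N; rewrite /ppart mulrC -tsumZ; last exact: absum_pterm.
  by apply: eq_tsum => k; rewrite /F /= mulrC.
rewrite -(tsum_swap aF).
have E k : tsum (fun N => F (k, N)) = th q (- r) *
   (q ^ (55 * (k * k) + (10 * r + 5) * k)
    * (rho q (11 * k + r) - rho q (- (11 * k + r) - 1))).
  rewrite -(row_sum q0 q1 _ (sgk R k)) [RHS]mulrA -tsumZ; last first.
    have k0 := expfz_neq0 (11 * k + r + 1) q0.
    have hb m : cabs (sgc R m + sgk R k) <= 2.
      have h1 := cabsD (sgc R m) (sgk R k); have h2 := cabs_sgc R m; have h3 := cabs_sgk R k.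
      by move: (cabs _) (cabs (sgc R m)) (cabs (sgk R k)) h1 h2 h3 => a b c; lra.
    have := absum_bdM hb (rapid_th q1 k0); apply: eq_absum => m.
    rewrite th_opp // /lterm; congr (_ * _).
    by rewrite mulrAC -expfzDr // exprz_exp mulrC; congr (_ ^ _ * _); ring.
  rewrite (tsum_shift (10 * k)); apply: eq_tsum => m; rewrite /F /= ptermE addrK.
  have := th_row q0 r 0 k; rewrite oppr0 th0 !(mulr0, add0r, addr0) expr0z !mulr1.
  move=> <-; rewrite (_ : - r - (m + 10 * k) = (- r - 10 * k) + - m); last by ring.
  rewrite thD // (_ : (- r - 10 * k) * - m = (r + 10 * k) * m); last by ring.
  have -> : q ^ ((11 * k + r) * m) = q ^ (k * m) * q ^ ((r + 10 * k) * m).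
    by rewrite -expfzDr //; congr (_ ^ _); ring.
  move: (th q (- m)) (th _) (q ^ (k * m)) (q ^ (_ * m)) (q ^ _) (sgc R m) (sgk R k).
  by move=> *; ring.
by rewrite /srow -tsumZ ?(eq_tsum E) //; exact: absum_srow.
Qed.

Lemma absum_epart_th : absum (fun N => epart N * th q (- r - N)).
Proof.
have := absumB (absum_cseq_th q0 q1 (- r)) absum_ppart_th.
by apply: eq_absum => N; rewrite mulrBl.
Qed.

(** Along each class modulo 10 the homogeneous solution is a Gaussian, so [th_row] turns it into a
    theta series. The representatives -4, ..., 5 are chosen for the pairing of s with - s. *)
Lemma sum_epart_th : tsum (fun N => epart N * th q (- r - N)) =
  th q (- r) * \sum_(i < 10) (epart (i%:Z - 4) * th q (- (i%:Z - 4)) * q ^ (r * (i%:Z - 4))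
     * gsum (10 * r + 11 * (i%:Z - 4) + 5)).
Proof.
rewrite (tsum_shift (-4)) (@tsum_residue _ 9); last exact: absum_shift absum_epart_th.
rewrite mulr_sumr; apply: eq_bigr => i _; have a55 : (0 : int) < 55 by [].
rewrite /gsum mulrA -tsumZ; last exact: absum_gaussz.
apply: eq_tsum => k; rewrite (_ : i%:Z + 10 * k - 4 = (i%:Z - 4) + 10 * k); last by ring.
have := th_row q0 r (i%:Z - 4) k; rewrite epart_row => e.
by rewrite [LHS]mulrAC e; move: (q ^ _) (q ^ _) (th _ _) (th _ _) (epart _) => *; ring.
Qed.

(** The quadratic part 9 k^2 + 2 k^2 = 11 k^2 is that of a single theta function with base q^22. *)
Lemma mock_row : tsum (fun k => (-1) ^ (3 * k - (- r + 1))
     * q ^ ((3 * k - (- r + 1)) * (3 * k - (- r + 1)) + tri (- r + 1 - 2 * k)))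
  = - (th q (- r) * (q ^ (r ^+ 2 - 3 * r + 1) * lau (th (q ^ 22)) (q ^ (4 + 8 * r)))).
Proof.
have q22 : cabs (q ^ 22) < 1 by apply: cabs_qz_lt1.
have k0 := expfz_neq0 (4 + 8 * r) q0; have aT := rapid_th q22 k0.
have a1 := absumZ (q ^ (r ^+ 2 - 3 * r + 1)) aT; have a2 := absumZ (th q (- r)) a1.
rewrite lau.unlock -(tsumZ _ aT) -(tsumZ _ a1) -(tsumN a2).
apply: eq_tsum => k; rewrite /lterm !thE sgnzN.
have -> : (-1 : C) ^ (3 * k - (- r + 1)) = - ((-1) ^ r * (-1) ^ k).
  have -> : 3 * k - (- r + 1) = 2 * k + (r + k + (-1)) by ring.
  by rewrite !sgnzD sgnz2 sgnzN expr1z; ring.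
have -> : q ^ ((3 * k - (- r + 1)) * (3 * k - (- r + 1)) + tri (- r + 1 - 2 * k))
   = q ^ tri (- r) * q ^ (r ^+ 2 - 3 * r + 1) * (q ^ 22) ^ tri k * (q ^ (4 + 8 * r)) ^ k.
  rewrite !exprz_exp -!expfzDr //; congr (_ ^ _).
  by have := triE (- r); have := triE k; have := triE (- r + 1 - 2 * k); lia.
by move: ((-1) ^ r) ((-1) ^ k) (q ^ tri _) (q ^ (r ^+ 2 - _ + _)) ((q ^ 22) ^ _) ((q ^ (4 + 8 * r)) ^ _) => *; ring.
Qed.

(** The coefficient formula [sum_cseq_th] at I = - r, divided by the common factor [th q (- r)] and
    solved for the contribution of the particular solution. *)
Lemma srow_mock : srow r =
  - (q ^ (r ^+ 2 - 3 * r + 1) * lau (th Q) q * lau (th (q ^ 22)) (q ^ (4 + 8 * r)))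
  - (q ^ (6 - 4 * r) * gsum (10 * r - 39) - q ^ (10 + 4 * r) * gsum (10 * r + 49)) * (q * phi10 (- q))
  + (q ^ (3 - 3 * r) * gsum (10 * r - 28) - q ^ (6 + 3 * r) * gsum (10 * r + 38)) * chi10 Q
  - (q ^ (1 - 2 * r) * gsum (10 * r - 17) - q ^ (3 + 2 * r) * gsum (10 * r + 27)) * (- psi10 (- q))
  + (q ^ (- r) * gsum (10 * r - 6) - q ^ (1 + r) * gsum (10 * r + 16)) * X10 Q.
Proof.
have := sum_cseq_th q0 q1 (- r); rewrite mock_row.
have -> : tsum (fun N => cseq q N * th q (- r - N)) = th q (- r) * srow r
    + tsum (fun N => epart N * th q (- r - N)).
  rewrite -sum_ppart_th -tsumD; [|exact: absum_ppart_th|exact: absum_epart_th].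
  by apply: eq_tsum => N; rewrite /epart; ring.
rewrite sum_epart_th -mulrDr mulrN mulrCA -mulrN => /(mulfI (th_neq0 q0 (- r))).
(* The particular solution is 0 for -10 < s < 0 and 2 for 0 < s < 10; in the second range the
   reflection turns c_s - 2 into - c_(-s). *)
have eN s : -10 < s -> s < 0 -> epart s = cseq q s.
  move=> s1 s2; rewrite /epart ppart_small //; last by lia.
  by rewrite /sgc lt_eqF // ltNge ltW //= addNr subr0.
have eP s : 0 < s -> s < 10 -> epart s = - cseq q (- s).
  move=> s1 s2; rewrite /epart ppart_small //; last by lia.
  by rewrite /sgc gt_eqF // s1 -(addrK (cseq q (- s)) (cseq q s)) cseq_refl //; ring.
(* The classes 0 and 5 drop out: there c_0 = 1 and c_5 = 2 agree with the particular solution. *)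
have e0 : epart 0 = 0 by rewrite /epart ppart_small // cseq_0 // /sgc eqxx add0r subrr.
have e5 : epart 5 = 0 by rewrite /epart ppart_small // cseq_5 // /sgc /=; ring.
have t1 : th q 1 = -1 by exact: th1.
have t2 : th q 2 = q.
  have := thS q0 1; rewrite t1 expr1z mulrN1 opprK => h; exact: h.
have p2 : q ^ 2 * q = q ^ 3 by rewrite -[X in _ * X](expr1z q) -expfzDr.
have p3 : q ^ 3 * q ^ 3 = q ^ 6 by rewrite -expfzDr.
have p4 : q ^ 4 * q ^ 6 = q ^ 10 by rewrite -expfzDr.
have t3 : th q 3 = - q ^ 3.
  have := thS q0 2; rewrite t2 p2 => <-; congr (th q _).
have t4 : th q 4 = q ^ 6.
  have := thS q0 3; rewrite t3 mulrN opprK p3 => <-; congr (th q _).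
have tn1 : th q (-1) = - q by rewrite th_opp // t1 expr1z mulrN1.
have tn2 : th q (-2) = q ^ 3 by rewrite th_opp // t2 p2.
have tn3 : th q (-3) = - q ^ 6 by rewrite th_opp // t3 mulrN p3.
have tn4 : th q (-4) = q ^ 10 by rewrite th_opp // t4 p4.
pose f s := epart s * th q (- s) * q ^ (r * s) * gsum (10 * r + 11 * s + 5).
have fv (s e e' g' : int) (c m : C) : epart s = m -> th q (- s) = c * q ^ e ->
    e + r * s = e' -> 10 * r + 11 * s + 5 = g' -> f s = c * m * q ^ e' * gsum g'.
  by move=> h1 h2 <- <-; rewrite /f h1 h2 expfzDr //; move: (gsum _) (q ^ _) (q ^ _) => *; ring.
have f0 : f 0 = 0 by rewrite /f e0 !mul0r.
have f5 : f 5 = 0 by rewrite /f e5 !mul0r.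
have fN4 : f (-4) = 1 * (q * phi10 (- q)) * q ^ (6 - 4 * r) * gsum (10 * r - 39).
  by apply: (fv _ 6); [rewrite eN // cseq_N4 | rewrite mul1r -t4 | ring | ring].
have fN3 : f (-3) = -1 * chi10 Q * q ^ (3 - 3 * r) * gsum (10 * r - 28).
  by apply: (fv _ 3); [rewrite eN // cseq_N3 | rewrite mulN1r -t3 | ring | ring].
have fN2 : f (-2) = 1 * - psi10 (- q) * q ^ (1 - 2 * r) * gsum (10 * r - 17).
  by apply: (fv _ 1); [rewrite eN // cseq_N2 | rewrite mul1r expr1z -[RHS]t2 | ring | ring].
have fN1 : f (-1) = -1 * X10 Q * q ^ (- r) * gsum (10 * r - 6).
  by apply: (fv _ 0); [rewrite eN // cseq_N1 | rewrite expr0z mulr1 -t1 | ring | ring].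
have f4 : f 4 = 1 * - (q * phi10 (- q)) * q ^ (10 + 4 * r) * gsum (10 * r + 49).
  by apply: (fv _ 10); [rewrite eP // cseq_N4 | rewrite mul1r tn4 | ring | ring].
have f3 : f 3 = -1 * - chi10 Q * q ^ (6 + 3 * r) * gsum (10 * r + 38).
  by apply: (fv _ 6); [rewrite eP // cseq_N3 | rewrite mulN1r tn3 | ring | ring].
have f2 : f 2 = 1 * - - psi10 (- q) * q ^ (3 + 2 * r) * gsum (10 * r + 27).
  by apply: (fv _ 3); [rewrite eP // cseq_N2 | rewrite mul1r tn2 | ring | ring].
have f1 : f 1 = -1 * - X10 Q * q ^ (1 + r) * gsum (10 * r + 16).
  by apply: (fv _ 1); [rewrite eP // cseq_N1 | rewrite mulN1r expr1z tn1 | ring | ring].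
rewrite (sum_ord10 f) fN4 fN3 fN2 fN1 f0 f1 f2 f3 f4 f5 => /(canRL (addrK _)) ->.
move: (gsum (10 * r - 39)) (gsum (10 * r + 49)) (gsum (10 * r - 28)) (gsum (10 * r + 38)).
move: (gsum (10 * r - 17)) (gsum (10 * r + 27)) (gsum (10 * r - 6)) (gsum (10 * r + 16)).
move: (q ^ (6 - 4 * r)) (q ^ (10 + 4 * r)) (q ^ (3 - 3 * r)) (q ^ (6 + 3 * r)).
move: (q ^ (1 - 2 * r)) (q ^ (3 + 2 * r)) (q ^ (- r)) (q ^ (1 + r)).
move: (q ^ (r ^+ 2 - 3 * r + 1)) (lau (th Q) q) (lau (th (q ^ 22)) _).
move: (phi10 (- q)) (psi10 (- q)) (chi10 Q) (X10 Q) => *; ring.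
Qed.

End Row.
End FinalAlgebra.

(** * The string function *)

Section Exponential.
Variable R : realType.
Local Notation C := R[i].
Implicit Types (x y t w : C) (a b : rat).

Lemma cexpD x y : cexp (x + y) = cexp x * cexp y.
Proof.
case: x => a b; case: y => c d; rewrite /cexp /= expRD cosD sinD.
by apply/eqP; rewrite eq_complex /=; apply/andP; split; apply/eqP; ring.
Qed.

Lemma cexp0 : cexp (0 : C) = 1.
Proof.
by rewrite /cexp /= expR0 cos0 sin0 mul1r.
Qed.

Lemma cabs_cexp x : cabs (cexp x) = expR (complex.Re x).
Proof.
rewrite /cexp cabsM cabs_real ger0_norm ?expR_ge0 // /cabs normc_def /= cos2Dsin2.
by rewrite sqrtr1 mulr1.
Qed.

Lemma epowD t a b : epow t (a + b) = epow t a * epow t b.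
Proof. by rewrite /epow -cexpD rmorphD /=; congr cexp; ring. Qed.

Lemma epow0 t : epow t 0 = 1.
Proof. by rewrite /epow rmorph0 mulr0 mul0r cexp0. Qed.

Lemma epow_addl t w a : epow (t + w) a = epow t a * epow w a.
Proof. by rewrite /epow -cexpD; congr cexp; ring. Qed.

Lemma epow_mull (n : nat) t a : epow (n%:R * t) a = epow t (n%:R * a).
Proof. by rewrite /epow [ratr (_ * _)]rmorphM /= ratr_nat; congr cexp; ring. Qed.

Lemma epow_neq0 t a : epow t a != 0.
Proof. by rewrite -cabs_gt0 cabs_cexp expR_gt0. Qed.

Lemma epowN t a : epow t (- a) = (epow t a)^-1.
Proof.
apply: (mulfI (epow_neq0 t a)); rewrite divff ?epow_neq0 //.
by rewrite -epowD subrr epow0.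
Qed.

Lemma epow_int t (n : int) : epow t n%:~R = epow t 1 ^ n.
Proof.
have pos (m : nat) : epow t m%:R = epow t 1 ^+ m.
  by elim: m => [|m IH]; rewrite ?epow0 // -[m.+1]addn1 natrD epowD IH exprD.
case: n => m; first by rewrite -exprnP -pos.
by rewrite NegzE mulrNz epowN pos.
Qed.

Lemma cabs_epow_imag (s : R) : cabs (epow (0 +i* s) 1) = expR (- (2 * pi * s)).
Proof. by rewrite /epow cabs_cexp rmorph1 mulr1 /=; congr expR; ring. Qed.

Lemma epow_half : epow (1 : C) (2^-1) = -1.
Proof.
have -> : epow (1 : C) (2^-1) = cexp (0 +i* pi).
  rewrite /epow; congr cexp; rewrite mulr1 fmorphV /= ratr_nat.
  have two0 : (2 : C) != 0 by rewrite pnatr_eq0.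
  apply: (mulIf two0); rewrite mulfVK //.
  by apply/eqP; rewrite eq_complex /=; apply/andP; split; apply/eqP; ring.
by rewrite /cexp /= expR0 cospi sinpi mul1r; apply/eqP; rewrite eq_complex /= oppr0 !eqxx.
Qed.

Lemma cabs_nome t : 0 < complex.Im t -> cabs (epow t 1) < 1.
Proof.
move=> h; rewrite /epow cabs_cexp rmorph1 mulr1.
rewrite (_ : complex.Re _ = - (2 * pi * complex.Im t)); last by case: t h => a b /= _; ring.
by rewrite expR_lt1 oppr_lt0 !mulr_gt0 // pi_gt0.
Qed.

(** The root exp (2 pi i / 2^(m+1)) is taken in the form [epow v 1], so that multiplication by it
    keeps points of this form. *)
Lemma dyadic_root (m : nat) : epow ((2 ^ m.+1)%:R^-1 : C) 1 ^+ (2 ^ m) = -1.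
Proof.
pose N : nat := (2 ^ m.+1)%N; have N0 : (N%:R : C) != 0 by rewrite pnatr_eq0 -lt0n expn_gt0.
rewrite exprnP -epow_int -epow_half -[X in epow X 2^-1](mulfV N0) epow_mull; congr (epow _ _).
by rewrite /N expnS natrM mulrAC mulfV ?mul1r.
Qed.

End Exponential.

Section StringCoefficients.
Variable R : realType.
Local Notation C := R[i].
Variable q : C.
Hypotheses (q0 : q != 0) (q1 : cabs q < 1).
Variable r : int.

Definition nu (k : int) : C := q ^ (55 * (k * k) + (10 * r + 5) * k).

(** The coefficient of z^i in the product of [chinum] with the series of the [rho i]: a term z^(-c)
    of the numerator moves the index to i + c, a term z^(c+1) to i - c - 1. *)
Definition bseq (i : int) : C :=
  tsum (fun k => nu k * (rho q (i + (11 * k + r)) - rho q (i - (11 * k + r) - 1))).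

Lemma absum_nu : absum nu.
Proof. exact: absum_gaussz. Qed.

Let rho_bd : exists B, forall i j, cabs (rho q i - rho q j) <= B.
Proof.
have [B [_ hB]] := rho_bound q0 q1; exists (B + B) => i j.
by apply: le_trans (cabsB _ _) _; apply: lerD; exact: (proj1 (hB _)).
Qed.

Lemma absum_bterm i :
  absum (fun k => nu k * (rho q (i + (11 * k + r)) - rho q (i - (11 * k + r) - 1))).
Proof.
have [B hB] := rho_bd.
have := absum_bdM (fun k => hB (i + (11 * k + r)) (i - (11 * k + r) - 1)) absum_nu.
by apply: eq_absum => k; rewrite mulrC.
Qed.

Lemma bseq_0 : bseq 0 = srow q r.
Proof. by apply: eq_tsum => k; rewrite add0r sub0r. Qed.

(** The Weyl symmetry of the character. By [rho_refl] the two values of [rho] in each term are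
    exchanged and the constants 1 cancel. *)
Lemma bseq_opp i : bseq (- i) = bseq i.
Proof.
apply: eq_tsum => k; congr (_ * _); move: (11 * k + r) => c.
have h1 := rho_refl q0 q1 (i + c); have h2 := rho_refl q0 q1 (i - c - 1).
have e1 : - (i + c) - 1 = - i - c - 1 by ring.
have e2 : - (i - c - 1) - 1 = - i + c by ring.
rewrite e1 in h1; rewrite e2 in h2.
rewrite -[rho q (i + c)](addrK (rho q (- i - c - 1))) h1.
rewrite -[rho q (i - c - 1)](addrK (rho q (- i + c))) h2.
by move: (rho q (- i - c - 1)) (rho q (- i + c)) => x y; ring.
Qed.

(** At index - n the values of [rho] decay like |q|^n up to a power of q linear in k, which the
    Gaussian [nu] absorbs; the symmetry moves the bound to index n. *)
Lemma bseq_bound : exists2 B, 0 <= B & forall n : nat, cabs (bseq n) <= B * cabs q ^+ n.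
Proof.
have [B [B0 hB]] := rho_bound q0 q1; have c0 : 0 < cabs q by rewrite cabs_gt0.
have h1 : absum (fun k => nu k * q ^ (- (11 * k + r))).
  have a55 : (0 : int) < 55 by [].
  have := absumZ (q ^ (- r)) (absum_gaussz q0 q1 (10 * r - 6) a55); apply: eq_absum => k.
  by rewrite /nu -!expfzDr //; congr (_ ^ _); ring.
have h2 : absum (fun k => nu k * q ^ (11 * k + r + 1)).
  have a55 : (0 : int) < 55 by [].
  have := absumZ (q ^ (r + 1)) (absum_gaussz q0 q1 (10 * r + 16) a55); apply: eq_absum => k.
  by rewrite /nu -!expfzDr //; congr (_ ^ _); ring.
have [M1 hM1] := h1; have [M2 hM2] := h2.
have M10 : 0 <= M1 by have := hM1 [::] isT; rewrite big_nil.
have M20 : 0 <= M2 by have := hM2 [::] isT; rewrite big_nil.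
exists (B * (M1 + M2)); first by rewrite mulr_ge0 // addr_ge0.
move=> n; rewrite -bseq_opp; apply: (hsum_cabs_le (tsumP (absum_bterm _))) => s us.
apply: (@le_trans _ _ (\sum_(k <- s) B * cabs q ^+ n *
   (cabs (nu k * q ^ (- (11 * k + r))) + cabs (nu k * q ^ (11 * k + r + 1))))).
  apply: ler_sum => k _; set c := 11 * k + r.
  rewrite !cabsM -mulrDr [leRHS]mulrCA; apply: (ler_wpM2l (cabs_ge0 _)).
  apply: le_trans (cabsB _ _) _; rewrite mulrDr; apply: lerD.
    apply: le_trans (proj2 (hB _)) _; rewrite -mulrA; apply: (ler_wpM2l B0).
    by rewrite !cabsXz exprnP -expfzDr ?gt_eqF // le_eqVlt; apply/orP; left; apply/eqP; congr (_ ^ _); ring.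
  apply: le_trans (proj2 (hB _)) _; rewrite -mulrA; apply: (ler_wpM2l B0).
  by rewrite !cabsXz exprnP -expfzDr ?gt_eqF // le_eqVlt; apply/orP; left; apply/eqP; congr (_ ^ _); ring.
rewrite -mulr_sumr big_split /= mulrAC; apply: ler_wpM2r; first by rewrite exprn_ge0 ?cabs_ge0.
by apply: (ler_wpM2l B0); apply: lerD; [exact: hM1 | exact: hM2].
Qed.

(** The reciprocal theta series stops at |z| = 1 because of the zero of j at z = 1. The numerator
    vanishes there too, and the symmetric decay reflects this. *)
Lemma absum_bseq z : cabs q < cabs z -> cabs z < (cabs q)^-1 -> absum (lterm bseq z).
Proof.
move=> qz zq; have c0 : 0 < cabs q by rewrite cabs_gt0.
have z0 : 0 < cabs z by apply: lt_trans qz.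
have [B B0 hB] := bseq_bound; apply: absum_int.
  apply: (absum_geom (r := cabs q * cabs z) (M := B)).
    by rewrite mulr_ge0 ?cabs_ge0 //= -ltr_pdivlMl // mulr1.
  move=> n; rewrite /lterm -exprnP cabsM cabsX exprMn mulrA.
  by apply: (ler_wpM2r (exprn_ge0 _ (cabs_ge0 _))); exact: hB.
apply: (absum_geom (r := cabs q / cabs z) (M := B)).
  by rewrite divr_ge0 ?cabs_ge0 //= ltr_pdivrMr // mul1r.
move=> n; rewrite /lterm NegzE bseq_opp cabsM cabsXz -invr_expz -exprnP.
apply: (@le_trans _ _ (B * cabs q ^+ n.+1 * (cabs z ^+ n.+1)^-1)).
  by rewrite ler_wpM2r // invr_ge0 exprn_ge0 // ltW.
rewrite -mulrA -expr_div_n; apply: (ler_wpM2l B0); rewrite exprS ler_piMl ?exprn_ge0 //.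
  by rewrite divr_ge0 // ltW.
by rewrite ler_pdivrMr // mul1r ltW.
Qed.

(** The Weyl-Kac numerator without its leading power of q and without z^(-1/2). *)
Definition chinum (z : C) : C :=
  tsum (fun k => nu k * z ^ (- (11 * k + r))) - tsum (fun k => nu k * z ^ (11 * k + r + 1)).

(** Multiplying back by j(z;q) only uses [conv_th_rho], an identity between coefficients, so the
    result is also available where the reciprocal series diverges. *)
Lemma conv_th_bseq i : conv (th q) bseq i = qinf q ^+ 3 *
  (tsum (fun k => if - (11 * k + r) == i then nu k else 0)
    - tsum (fun k => if 11 * k + r + 1 == i then nu k else 0)).
Proof.
have [B hB] := rho_bd.
pose F (p : int * int) : C := th q p.1 *
  (nu p.2 * (rho q (i - p.1 + (11 * p.2 + r)) - rho q (i - p.1 - (11 * p.2 + r) - 1))).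
have aF : absum F.
  have := absum_bdM (fun p : int * int => hB (i - p.1 + (11 * p.2 + r)) (i - p.1 - (11 * p.2 + r) - 1))
     (absum_mul (rapid_absum (rapid_th q1)) absum_nu).
  by apply: eq_absum => p; rewrite /F mulrC mulrA.
have afin (g : int -> int) : injective g -> absum (fun k => if g k == i then nu k else 0).
  move=> gi; have b1 k : cabs (if g k == i then 1 else 0 : C) <= 1.
    by case: ifP => _; rewrite ?cabs1 ?cabs0.
  have := absum_bdM b1 absum_nu; apply: eq_absum => k.
  by case: ifP => _; rewrite ?mul1r ?mul0r.
have i1 : injective (fun k : int => - (11 * k + r)) by move=> k l /=; lia.
have i2 : injective (fun k : int => 11 * k + r + 1) by move=> k l /=; lia.
rewrite -tsumB; [|exact: (afin _ i1)|exact: (afin _ i2)].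
transitivity (tsum (fun n => tsum (fun k => F (n, k)))).
  by apply: eq_tsum => n; rewrite /bseq -tsumZ //; exact: absum_bterm.
have af12 : absum (fun k => (if - (11 * k + r) == i then nu k else 0)
     - (if 11 * k + r + 1 == i then nu k else 0)).
  by apply: absumB; [exact: (afin _ i1)|exact: (afin _ i2)].
rewrite (tsum_swap aF) -tsumZ //.
apply: eq_tsum => k; set c := 11 * k + r.
transitivity (nu k * (conv (th q) (rho q) (i + c) - conv (th q) (rho q) (i - c - 1))).
  have aT j := absum_th_rho q0 q1 j.
  rewrite /conv -tsumB // -tsumZ; last by apply: absumB.
  apply: eq_tsum => n; rewrite /F /= -/c.
  have -> : i - n + c = i + c - n by ring.
  have -> : i - n - c - 1 = i - c - 1 - n by ring.
  by move: (th _ _) (rho _ _) (rho _ _) => *; ring.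
rewrite !conv_th_rho // (_ : (i + c == 0) = (- c == i)); last by lia.
rewrite (_ : (i - c - 1 == 0) = (c + 1 == i)); last by lia.
by case: ifP => _; case: ifP => _; ring.
Qed.

End StringCoefficients.

Section Annulus.
Variable R : realType.
Local Notation C := R[i].
Variable q : C.
Hypotheses (q0 : q != 0) (q1 : cabs q < 1).

Lemma rapid_gaussz (a x : int) : 0 < a -> rapid (fun k => q ^ (a * (k * k) + x * k)).
Proof.
move=> a0; have k0 : - q ^ (a + x) != 0 by rewrite oppr_eq0 expfz_neq0.
have a2 : cabs (q ^ (2 * a)) < 1 by apply: cabs_qz_lt1; lia.
move=> y y0; have := rapid_scale k0 (rapid_th a2) y0; apply: eq_absum => k.
by rewrite /lterm gauss_lterm.
Qed.

Lemma lau_image (f : int -> C) (g : int -> int) x : injective g ->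
  absum (fun k => f k * x ^ g k) ->
  absum (lterm (fun i => tsum (fun k => if g k == i then f k else 0)) x) /\
  lau (fun i => tsum (fun k => if g k == i then f k else 0)) x = tsum (fun k => f k * x ^ g k).
Proof.
move=> gi af.
have at_g k : tsum (fun l => if g l == g k then f l else 0) = f k.
  rewrite (@tsum_fin _ _ _ [:: k]) //; first by rewrite big_seq1 eqxx.
  by move=> l; rewrite inE (inj_eq gi) => /negPf ->.
have off i : (forall k, g k != i) -> lterm (fun i => tsum (fun k => if g k == i then f k else 0)) x i = 0.
  move=> h; rewrite /lterm (_ : tsum _ = 0) ?mul0r // -[RHS](tsum0 R int).
  by apply: eq_tsum => k; rewrite (negPf (h k)).
have E k : f k * x ^ g k = lterm (fun i => tsum (fun k => if g k == i then f k else 0)) x (g k).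
  by rewrite /lterm at_g.
have aE := eq_absum E af; split; first exact: (absum_inj off aE).
by rewrite lau.unlock (tsum_inj gi off aE); apply: eq_tsum => k /=; rewrite E.
Qed.

Variable r : int.
Variable z : C.
Hypothesis z0 : z != 0.
Local Notation nu := (nu q r).
Local Notation bseq := (bseq q r).

Lemma absum_nu_neg : absum (fun k => nu k * z ^ (- (11 * k + r))).
Proof.
have k0 := expfz_neq0 (-11) z0; have a55 : (0 : int) < 55 by [].
have := absumZ (z ^ (- r)) (rapid_gaussz (10 * r + 5) a55 k0); apply: eq_absum => k.
rewrite /lterm exprz_exp mulrCA -expfzDr //; congr (_ * _ ^ _); ring.
Qed.

Lemma absum_nu_pos : absum (fun k => nu k * z ^ (11 * k + r + 1)).
Proof.
have k0 := expfz_neq0 11 z0; have a55 : (0 : int) < 55 by [].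
have := absumZ (z ^ (r + 1)) (rapid_gaussz (10 * r + 5) a55 k0); apply: eq_absum => k.
rewrite /lterm exprz_exp mulrCA -expfzDr //; congr (_ * _ ^ _); ring.
Qed.

Lemma lau_th_bseq : cabs q < cabs z -> cabs z < (cabs q)^-1 ->
  lau (th q) z * lau bseq z = qinf q ^+ 3 * chinum q r z.
Proof.
move=> qz zq; rewrite lau_conv //; [|exact: rapid_th|exact: absum_bseq].
have i1 : injective (fun k : int => - (11 * k + r)) by move=> k l /=; lia.
have i2 : injective (fun k : int => 11 * k + r + 1) by move=> k l /=; lia.
have [a1 e1] := lau_image i1 absum_nu_neg; have [a2 e2] := lau_image i2 absum_nu_pos.
rewrite /chinum -e1 -e2 lau.unlock -tsumB // -tsumZ; last exact: absumB.
apply: eq_tsum => i; rewrite /lterm conv_th_bseq //.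
by move: (tsum _) (tsum _) (z ^ i) => *; ring.
Qed.

(** The even and odd indices of j(z;q) give the two theta functions of the Weyl-Kac denominator. *)
Lemma lau_th_parity : lau (th q) z =
  lau (fun i => q ^ (2 * (i * i) + 1 * i)) (z ^ (-2))
    - z * lau (fun i => q ^ (2 * (i * i) + (-1) * i)) (z ^ (-2)).
Proof.
have k0 := expfz_neq0 (-2) z0; have p2 : (0 : int) < 2 by [].
rewrite lau.unlock (@tsum_split _ _ _ _ (fun i => -2 * i) (fun i => 1 + -2 * i)
   (fun N : int => (N %% 2)%Z == 0)); last exact: rapid_th.
- rewrite -tsumZ; last exact: (rapid_gaussz (-1) p2 k0).
  rewrite -tsumN; last by apply: absumZ; exact: (rapid_gaussz (-1) p2 k0).
  congr (_ + _); apply: eq_tsum => i; rewrite /= /lterm thE.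
    have -> : -2 * i = 2 * - i by ring.
    rewrite sgnz2 mul1r exprz_exp tri_dbl; congr (_ ^ _ * _ ^ _); ring.
  have -> : 1 + -2 * i = 1 - 2 * i by ring.
  rewrite tri_refl tri_dbl sgnzD sgnzN sgnz2 expr1z exprz_exp.
  have -> : z ^ (1 - 2 * i) = z * z ^ (-2 * i).
    by rewrite (_ : 1 - 2 * i = 1 + -2 * i) ?expfzDr ?expr1z //; ring.
  rewrite (_ : 2 * (i * i) + (-1) * i = 2 * (i * i) - i); last by ring.
  by move: (q ^ _) (z ^ _) => *; ring.
- by move=> i j /=; lia.
- by move=> i j /=; lia.
- by move=> i /=; lia.
- by move=> i /=; lia.
- by move=> N h; exists (- (N %/ 2)%Z); lia.
- by move=> N h; exists (- ((N - 1) %/ 2)%Z); lia.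
Qed.

End Annulus.

(** Splits the exponent into a fractional part common to all terms and an integer, so that only
    integral powers of q remain under the sum. *)
Lemma theta_square (p : nat) (m n i : int) : 0 < m ->
  p%:R * (m%:~R * (i%:~R + n%:~R / (2 * m%:~R)) ^+ 2) =
    p%:R * n%:~R ^+ 2 / (4 * m%:~R) + ((p%:Z * m) * (i * i) + (p%:Z * n) * i)%:~R :> rat.
Proof.
move=> m0; have mq : (m%:~R : rat) != 0 by rewrite intr_eq0 gt_eqF.
rewrite rmorphD !rmorphM /= -[(p%:Z)%:~R]pmulrn.
by move: (p%:R : rat) (m%:~R : rat) (n%:~R : rat) (i%:~R : rat) mq => x y u v y0; field.
Qed.

Lemma theta_linear (m n i : int) : 0 < m ->
  - (m%:~R * (i%:~R + n%:~R / (2 * m%:~R))) = - (n%:~R / 2) + (- m * i)%:~R :> rat.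
Proof.
move=> m0; have mq : (m%:~R : rat) != 0 by rewrite intr_eq0 gt_eqF.
rewrite rmorphM rmorphN /=.
by move: (m%:~R : rat) (n%:~R : rat) (i%:~R : rat) mq => y u v y0; field.
Qed.

Section Characters.
Variable R : realType.
Local Notation C := R[i].
Variables (tau w : C).
Hypothesis htau : 0 < complex.Im tau.
Local Notation q := (epow tau 1).
Local Notation z := (epow w 1).

Let q0 : q != 0. Proof. exact: epow_neq0. Qed.
Let z0 : z != 0. Proof. exact: epow_neq0. Qed.
Let q1 : cabs q < 1. Proof. exact: cabs_nome. Qed.

Lemma ThetaE (p : nat) (n m : int) : (0 < p)%N -> 0 < m ->
  Theta n m w (p%:R * tau) =
    epow tau (p%:R * n%:~R ^+ 2 / (4 * m%:~R)) * epow w (- (n%:~R / 2))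
    * lau (fun i => q ^ ((p%:Z * m) * (i * i) + (p%:Z * n) * i)) (z ^ (- m)).
Proof.
move=> p0 m0; have k0 := expfz_neq0 (- m) z0.
have pm : 0 < p%:Z * m by rewrite mulr_gt0.
have aG := rapid_gaussz q0 q1 (p%:Z * n) pm k0.
have E i : epow (p%:R * tau) (m%:~R * (i%:~R + n%:~R / (2 * m%:~R)) ^+ 2)
     * epow w (- (m%:~R * (i%:~R + n%:~R / (2 * m%:~R))))
   = epow tau (p%:R * n%:~R ^+ 2 / (4 * m%:~R)) * epow w (- (n%:~R / 2))
     * lterm (fun i => q ^ ((p%:Z * m) * (i * i) + (p%:Z * n) * i)) (z ^ (- m)) i.
  rewrite epow_mull theta_square // theta_linear // !epowD !epow_int /lterm exprz_exp.
  by rewrite mulrACA.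
rewrite /Theta lau.unlock -tsumZ // -(eq_tsum E); apply: zsum_tsum.
by have := absumZ (epow tau (p%:R * n%:~R ^+ 2 / (4 * m%:~R)) * epow w (- (n%:~R / 2))) aG;
  apply: eq_absum => i; rewrite -E.
Qed.

Lemma chi_denE : chi_den w tau = epow tau (1 / 8) * epow w (- (1 / 2)) * lau (th q) z.
Proof.
rewrite /chi_den -[tau in LHS]mul1r !(@ThetaE 1) // (lau_th_parity q0 q1 z0).
have -> : 1%:R * 1%:~R ^+ 2 / (4 * 2%:~R) = 1 / 8 :> rat by field.
have -> : - (1%:~R / 2) = - (1 / 2) :> rat by [].
have -> : - ((-1)%:~R / 2) = - (1 / 2) + 1 :> rat by field.
rewrite !mul1r epowD.
move: (lau _ _) (lau _ _) (epow tau 8^-1) (epow w (- 2^-1)) => x y u v; ring.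
Qed.

Lemma chi_numE (r : nat) : chi_num 5 11 (2 * r) w tau =
  epow tau (5 * (2 * r).+1%:R ^+ 2 / 44) * epow w (- (1 / 2)) * chinum q r%:Z z.
Proof.
rewrite /chi_num !(@ThetaE 5) // /chinum.
set a : int := (2 * r).+1%:Z.
have a55 : (0 : int) < 55 by [].
have -> : 5%:R * a%:~R ^+ 2 / (4 * 11%:~R) = 5 * (2 * r).+1%:R ^+ 2 / 44 :> rat.
  by rewrite /a -pmulrn; field.
have -> : 5%:R * (- a)%:~R ^+ 2 / (4 * 11%:~R) = 5 * (2 * r).+1%:R ^+ 2 / 44 :> rat.
  by rewrite rmorphN /a /= -pmulrn; field.
have aE : a%:~R = 2 * r%:R + 1 :> rat by rewrite /a -pmulrn -addn1 natrD natrM.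
have -> : - (a%:~R / 2) = - (1 / 2) + (- r%:Z)%:~R :> rat by rewrite aE rmorphN /= -pmulrn; field.
have -> : - ((- a)%:~R / 2) = - (1 / 2) + (r%:Z + 1)%:~R :> rat.
  by rewrite rmorphN rmorphD /= aE -pmulrn; field.
rewrite !(epowD w (- (1 / 2))) (epow_int w (- r%:Z)) (epow_int w (r%:Z + 1)).
move: (epow tau (5 * _ / _)) (epow w (- (1 / 2))) => A B.
have -> : forall x y u v : C, A * (B * x) * u - A * (B * y) * v = A * B * (x * u - y * v).
  by move=> x y u v; ring.
congr (_ * _).
have k0 := expfz_neq0 (- 11) z0.
have a5 : 10 * r%:Z + 5 = 5%:Z * a by rewrite /a; lia.
have g1 := rapid_gaussz q0 q1 (5%:Z * a) a55 k0.
have g2 := rapid_gaussz q0 q1 (5%:Z * - a) a55 k0.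
rewrite lau.unlock -(tsumZ _ g1) -(tsumZ _ g2); congr (_ - _); last first.
  rewrite [RHS](tsum_refl 0); apply: eq_tsum => k.
  rewrite /lterm /nu exprz_exp a5 mulrCA -expfzDr // sub0r.
  by congr (_ ^ _ * _ ^ _); ring.
apply: eq_tsum => k; rewrite /lterm /nu exprz_exp a5 mulrCA -expfzDr //.
by congr (_ ^ _ * _ ^ _); ring.
Qed.

End Characters.

(** * Existence and uniqueness of the string expansion *)

Section Convergence.
Variable R : realType.
Local Notation C := R[i].

Lemma series_terms_bounded (u : nat -> C) a :
  (series (u : nat -> C^o) @ \oo --> (a : C^o))%classic -> exists M, forall n, cabs (u n) <= M.
Proof.
move=> /climP h; have [N hN] := h 1 ltr01.
exists (2 + \sum_(i < N) cabs (u i)) => n.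
have s0 m : 0 <= \sum_(i < m) cabs (u i) by apply: sumr_ge0 => i _; exact: cabs_ge0.
have [nN|Nn] := ltnP n N.
  rewrite (bigD1 (Ordinal nN)) //= addrCA lerDl addr_ge0 // sumr_ge0 // => i _.
  exact: cabs_ge0.
have h1 := hN n.+1 (leqW Nn); have h2 := hN n Nn.
have e : u n = (series (u : nat -> C^o) n.+1 - a) - (series (u : nat -> C^o) n - a).
  by rewrite /series /= big_nat_recr //=; ring.
rewrite e; have := cabsB (series (u : nat -> C^o) n.+1 - a) (series (u : nat -> C^o) n - a).
move: (s0 N) h1 h2; move: (cabs _) (cabs _) (cabs _) (\sum_(i < N) _) => x y v s; lra.
Qed.

(** Abel's lemma: terms that are bounded at x decay geometrically at y, with ratio |x| / |y|. *)
Lemma absum_lterm_tail (c : int -> C) (s : int) x y : x != 0 -> y != 0 ->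
  cabs x < cabs y -> (exists M, forall n : nat, cabs (lterm c x (s - n%:Z)) <= M) ->
  absum (fun n : nat => lterm c y (s - n%:Z)).
Proof.
move=> x0 y0 xy [M hM]; have cx : 0 < cabs x by rewrite cabs_gt0.
have cy : 0 < cabs y by rewrite cabs_gt0.
apply: (absum_geom (r := cabs x / cabs y) (M := M * cabs ((y / x) ^ s))).
  by rewrite divr_ge0 ?cabs_ge0 //= ltr_pdivrMr // mul1r.
move=> n; have yx0 : y / x != 0 by rewrite mulf_neq0 ?invr_eq0.
have -> : lterm c y (s - n%:Z) = lterm c x (s - n%:Z) * ((y / x) ^ s * (x / y) ^+ n).
  rewrite exprnP -[x / y]invf_div exprz_inv -expfzDr // /lterm exprzMl ?unitfE ?invr_eq0 //.
  rewrite exprz_inv -!mulrA; congr (_ * _); rewrite mulrCA -expfzDr // addrN expr0z mulr1 //.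
rewrite [cabs (lterm _ _ _ * _)]cabsM [cabs (_ * _ ^+ n)]cabsM cabsX [cabs (x / y)]cabsM cabsV mulrA.
apply: ler_wpM2r; first by rewrite exprn_ge0 // divr_ge0 ?cabs_ge0.
by apply: (ler_wpM2r (cabs_ge0 _)); exact: hM.
Qed.

(* Convergence at x and at v, even conditional, bounds the terms there. *)
Lemma absum_laurent (c : int -> C) (s : int) x y v (a b : C) : x != 0 -> y != 0 -> v != 0 ->
  cabs x < cabs y -> cabs y < cabs v ->
  has_zsum (fun k => lterm c x (s - k)) a -> has_zsum (fun k => lterm c v (s - k)) b ->
  absum (fun k => lterm c y (s - k)).
Proof.
move=> x0 y0 v0 xy yv [a1 [_ [h1 _ _]]] [_ [b1 [_ h2 _]]].
apply: absum_int.
  by apply: (absum_lterm_tail x0 y0 xy); exact: series_terms_bounded h1.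
have E (z : C) n : lterm c z (s - Negz n) = lterm (fun i => c (- i)) z^-1 (- s - 1 - n%:Z).
  rewrite /lterm exprz_inv; have -> : s - Negz n = - (- s - 1 - n%:Z) by lia.
  by [].
have := @absum_lterm_tail (fun i => c (- i)) (- s - 1) v^-1 y^-1.
rewrite !invr_eq0 !cabsV ltf_pV2 ?posrE ?cabs_gt0 // => /(_ v0 y0 yv) h.
apply: (@eq_absum _ _ _ _ (fun n => esym (E y n))); apply: h.
have [M hM] := series_terms_bounded h2; exists M => n; rewrite -E; exact: hM.
Qed.

End Convergence.

Section StringFunction.
Variable R : realType.
Local Notation C := R[i].
Variables (tau : C) (r : nat).
Hypothesis htau : 0 < complex.Im tau.
Local Notation q := (epow tau 1).
Let q0 : q != 0. Proof. exact: epow_neq0. Qed.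
Let q1 : cabs q < 1. Proof. exact: cabs_nome. Qed.
Let cq0 : 0 < cabs q. Proof. by rewrite cabs_gt0. Qed.
Local Notation b := (bseq q r%:Z).

Definition lead_exponent : rat := 5 * (2 * r).+1%:R ^+ 2 / 44 - 1 / 8.
Local Notation K := (epow tau lead_exponent / qinf q ^+ 3).
Local Notation P m := (epow tau (m%:~R ^+ 2 / (4 * level 5 11))).

Let D0 : qinf q ^+ 3 != 0. Proof. by rewrite expf_neq0 ?qinf_neq0. Qed.

Lemma annulusP w : (`|epow tau 1| < `|epow w 1| < `|epow tau 1|^-1) =
  (cabs q < cabs (epow w 1) < (cabs q)^-1).
Proof. by rewrite !cabsE -fmorphV !ltcR. Qed.

Lemma chiE w : cabs q < cabs (epow w 1) -> cabs (epow w 1) < (cabs q)^-1 ->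
  lau (th q) (epow w 1) != 0 -> chi 5 11 (2 * r) w tau = K * lau b (epow w 1).
Proof.
move=> qz zq J0; have z0 : epow w 1 != 0 by exact: epow_neq0.
have h := lau_th_bseq q0 q1 r%:Z z0 qz zq.
have A0 := epow_neq0 tau (1 / 8); have B0 := epow_neq0 w (- (1 / 2)).
rewrite /chi chi_denE // chi_numE // /lead_exponent epowD (epowN tau).
move: h J0 D0 A0 B0; move: (lau (th _) _) (lau b _) (qinf _ ^+ 3) (chinum _ _ _).
move: (epow tau (1 / 8)) (epow w (- (1 / 2))) (epow tau (5 * _ / _)).
move=> A' B A J L D N h J0 D0' A0 B0.
apply: (mulfI J0); rewrite [RHS]mulrCA h; field.
by rewrite D0' A0 B0 J0.
Qed.

(** With m = - 2 n the power z^(-m/2) is z^n, so the expansion is a Laurent series in n = - r -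
    k. *)
Lemma coef_term (c : int -> C) w (k : int) :
  let m : int := 2 * k + (2 * r)%N%:Z in
  c m * P m * epow w (- m%:~R / 2) =
    lterm (fun n => c (-2 * n) * P (-2 * n)) (epow w 1) (- r%:Z - k).
Proof.
move=> m; rewrite /lterm; have -> : -2 * (- r%:Z - k) = m by rewrite /m; lia.
rewrite -epow_int; congr (_ * epow _ _).
have -> : m = 2 * (k + r%:Z) by rewrite /m; lia.
have -> : - r%:Z - k = - (k + r%:Z) by lia.
by rewrite rmorphM rmorphN /=; move: ((k + r%:Z)%:~R : rat) => x; field.
Qed.

(** An explicit expansion, which shows that the set from which [string_fun] is chosen is not
    empty. *)
Definition bstring (m : int) : C := (P m)^-1 * (K * b (- (m %/ 2)%Z)).

Lemma bstring_coef n : bstring (-2 * n) * P (-2 * n) = K * b n.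
Proof.
have p0 := epow_neq0 tau ((-2 * n)%:~R ^+ 2 / (4 * level 5 11)).
rewrite /bstring (_ : - ((-2 * n) %/ 2)%Z = n); last by lia.
by rewrite mulrC mulrA mulfV ?mul1r.
Qed.

Lemma absum_Kb w : cabs q < cabs (epow w 1) -> cabs (epow w 1) < (cabs q)^-1 ->
  absum (lterm (fun n => K * b n) (epow w 1)).
Proof.
move=> qz zq; have := absumZ K (absum_bseq q0 q1 r%:Z qz zq); apply: eq_absum => n.
by rewrite /lterm mulrA.
Qed.

Lemma bstring_expansion : string_expansion 5 11 (2 * r) tau bstring.
Proof.
move=> w; rewrite annulusP => /andP[qz zq].
rewrite chi_denE // mulf_eq0 negb_or => /andP[_ J0].
have aK := absum_Kb qz zq; rewrite chiE // -lauZ; last exact: absum_bseq.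
rewrite lau.unlock (tsum_refl (- r%:Z)).
have := has_zsum_tsum (absum_refl (- r%:Z) aK).
set f := (X in has_zsum X _); set g := (X in _ -> has_zsum X _).
suff -> : g = f by [].
apply/funext => k; rewrite /g /f coef_term /lterm; congr (_ * _).
exact: bstring_coef.
Qed.

Lemma epow_radius (s : R) : 0 < s -> exists w : C, cabs (epow w 1) = s.
Proof.
move=> s0; exists (0 +i* (- ln s / (2 * pi))); rewrite cabs_epow_imag.
have pi0 : (2 * pi : R) != 0 by rewrite mulf_neq0 ?pnatr_eq0 // gt_eqF ?pi_gt0.
by rewrite mulrCA mulfV // mulr1 opprK lnK.
Qed.

(** The definition grants mere convergence off the zeros of the denominator. On |q| < |z| < 1 there
    are no zeros, and convergence on a smaller and a larger circle gives absolute convergence in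
    between, where coefficients are unique. *)
Lemma expansion_unique (c : int -> C) : string_expansion 5 11 (2 * r) tau c ->
  c 0 = K * b 0.
Proof.
move=> hc; pose f n := c (-2 * n) * P (-2 * n).
have hz w : cabs q < cabs (epow w 1) -> cabs (epow w 1) < 1 ->
    has_zsum (fun k => lterm f (epow w 1) (- r%:Z - k)) (K * lau b (epow w 1)).
  move=> qz z1; have zq : cabs (epow w 1) < (cabs q)^-1.
    by apply: lt_le_trans z1 _; rewrite invf_ge1 // ltW.
  have J0 := lau_th_neq0 q0 q1 qz z1.
  have dn : chi_den w tau != 0.
    by rewrite chi_denE //; apply: mulf_neq0 J0; apply: mulf_neq0; exact: epow_neq0.
  have := hc w; rewrite annulusP qz zq => /(_ isT dn); rewrite chiE //.
  by congr (has_zsum _ _); apply/funext => k; exact: coef_term.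
(* The three quarter points between |q| and 1. *)
have [s1 [s [s2 [h1 h2 h3 h4]]]] : exists s1 s s2 : R, [/\ cabs q < s1, s1 < s, s < s2 & s2 < 1].
  exists ((3 * cabs q + 1) / 4), ((cabs q + 1) / 2), ((cabs q + 3) / 4).
  by move: (cabs q) q1 => x x1; split; lra.
have p1 : 0 < s1 by apply: lt_trans h1. have p : 0 < s by apply: lt_trans h2.
have p2 : 0 < s2 by apply: lt_trans h3.
have [w1 e1] := epow_radius p1; have [w e] := epow_radius p; have [w2 e2] := epow_radius p2.
pose U z := exists2 v : C, z = epow v 1 & cabs z = s.
have aU z : U z -> absum (lterm f z) /\ lau f z = K * lau b z.
  move=> [v -> ev].
  have qv : cabs q < cabs (epow v 1) by rewrite ev; apply: lt_trans h2.
  have v1 : cabs (epow v 1) < 1 by rewrite ev; apply: lt_trans h4.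
  have k1 := hz w1; rewrite e1 in k1; have k2 := hz w2; rewrite e2 in k2.
  have a : absum (fun k => lterm f (epow v 1) (- r%:Z - k)).
    apply: (absum_laurent _ _ _ _ _ (k1 h1 _) (k2 _ h4)); rewrite ?epow_neq0 ?e1 ?e2 ?ev //.
    - by apply: lt_trans h2 _; apply: lt_trans h3 _.
    - by apply: lt_trans h1 _; apply: lt_trans h2 _.
  split.
    by have := absum_refl (- r%:Z) a; apply: eq_absum => k; rewrite subKr.
  rewrite (has_zsum_unique a (hz v qv v1)).
  by rewrite lau.unlock [LHS](tsum_refl (- r%:Z)).
have sq : s < (cabs q)^-1.
  by apply: lt_trans h3 _; apply: lt_le_trans h4 _; rewrite invf_ge1 // ltW.
have aB z : U z -> absum (lterm (fun n => K * b n) z) /\ lau (fun n => K * b n) z = K * lau b z.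
  move=> [v -> ev]; have qv : cabs q < cabs (epow v 1) by rewrite ev; apply: lt_trans h2.
  have vq : cabs (epow v 1) < (cabs q)^-1 by rewrite ev.
  by split; [exact: absum_Kb | rewrite lauZ //; exact: absum_bseq].
have Un0 z : U z -> z != 0 by move=> [v -> _]; exact: epow_neq0.
have zn m : cabs (epow ((2 ^ m.+1)%:R^-1 : C) 1) = 1.
  have := dyadic_root R m => /(congr1 (@cabs R)); rewrite cabsX cabsN cabs1 => /eqP.
  by rewrite pexpr_eq1 ?expn_gt0 ?cabs_ge0 // => /eqP.
have Uz m z : U z -> U (epow ((2 ^ m.+1)%:R^-1 : C) 1 * z).
  move=> [v -> ev]; exists ((2 ^ m.+1)%:R^-1 + v); first by rewrite epow_addl.
  by rewrite cabsM zn mul1r.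
have Uw : U (epow w 1) by exists w.
have := @lau_unique _ _ U (@dyadic_root R) Un0 Uz (fun n => f n - K * b n) _ Uw _ _ 0.
have E z : lterm (fun n => f n - K * b n) z =1 (fun n => lterm f z n - lterm (fun n => K * b n) z n).
  by move=> n; rewrite /lterm mulrBl.
have h z : U z -> absum (lterm (fun n => f n - K * b n) z).
  move=> Uy; have := absumB (aU _ Uy).1 (aB _ Uy).1; apply: eq_absum => n; by rewrite E.
move=> /(_ h) H; apply/eqP; rewrite -subr_eq0; apply/eqP.
have <- : f 0 = c 0 by rewrite /f mulr0 expr0n /= mul0r epow0 mulr1.
apply: H => z Uy; have [a ea] := aU _ Uy; have [a' ea'] := aB _ Uy.
rewrite lau.unlock (eq_tsum (E z)) tsumB //.
by have := ea; have := ea'; rewrite lau.unlock => -> ->; rewrite subrr.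
Qed.

(** At m = 0 the normalizing exponent is exactly the leading exponent of the character, so the
    fractional powers of q cancel. *)
Lemma nstring_funE : qinf q ^+ 3 * nstring_fun 5 11 (2 * r) 0 tau = srow q r%:Z.
Proof.
have hS : string_expansion 5 11 (2 * r) tau (string_fun 5 11 (2 * r) tau).
  by have := @xgetPex _ (fun=> 0) [set c | string_expansion 5 11 (2 * r) tau c]; apply; exists bstring; exact: bstring_expansion.
rewrite /nstring_fun (expansion_unique hS) bseq_0.
have -> : s_exponent 5 11 (2 * r) 0 = lead_exponent.
  by rewrite /s_exponent /lead_exponent expr0n /= mul0r subr0 addrC.
rewrite epowN; have := epow_neq0 tau lead_exponent.
move: D0; move: (qinf q ^+ 3) (epow tau lead_exponent) (srow _ _) => D E S hD hE.
by field; rewrite hD hE.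
Qed.

End StringFunction.

Lemma jthetaE (R : realType) (q x : R[i]) : cabs q < 1 -> x != 0 -> jtheta x q = lau (th q) x.
Proof.
move=> q1 x0; rewrite lau.unlock -(zsum_tsum (rapid_th q1 x0)); congr zsum.
by apply/funext => n; rewrite /lterm thE.
Qed.

Section Bridge.
Variable R : realType.
Local Notation C := R[i].
Variable q : C.
Hypotheses (q0 : q != 0) (q1 : cabs q < 1).

Lemma gsum_opp x : gsum q (- x) = gsum q x.
Proof.
rewrite /gsum (tsum_refl 0); apply: eq_tsum => k; congr (_ ^ _); ring.
Qed.
Lemma jtheta_gsum (x y : int) : x - 55 = y -> jtheta (- q ^ x) (q ^ 110) = gsum q y.
Proof.
move=> <-; have q110 : cabs (q ^ 110) < 1 by apply: cabs_qz_lt1.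
rewrite (jthetaE q110) // ?oppr_eq0 ?expfz_neq0 // lau.unlock /gsum.
by apply: eq_tsum => k; rewrite (gauss_lterm q0 55 (x - 55)) [55 + _]addrC subrK.
Qed.

End Bridge.

Theorem theorem2p9 (R : realType) (tau : R[i]) (htau : 0 < complex.Im tau)
    (r : nat) (hr : (r <= 4)%N) :
  let q : R[i] := epow tau 1 in
  let k : int := r%:Z in
  qinf q ^+ 3 * nstring_fun 5 11 (2 * r) 0 tau =
    - q ^ (k ^+ 2 - 3 * k + 1) * Jtheta 1 2 q * jtheta (q ^ (4 + 8 * k)) (q ^ 22)
    - q ^ (6 - 4 * k)
        * (jtheta (- q ^ (16 + 10 * k)) (q ^ 110)
           - q ^ (4 + 8 * k) * jtheta (- q ^ (6 - 10 * k)) (q ^ 110))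
        * (q * phi10 (- q))
    + q ^ (3 - 3 * k)
        * (jtheta (- q ^ (27 + 10 * k)) (q ^ 110)
           - q ^ (3 + 6 * k) * jtheta (- q ^ (17 - 10 * k)) (q ^ 110))
        * chi10 (q ^+ 2)
    - q ^ (1 - 2 * k)
        * (jtheta (- q ^ (38 + 10 * k)) (q ^ 110)
           - q ^ (2 + 4 * k) * jtheta (- q ^ (28 - 10 * k)) (q ^ 110))
        * (- psi10 (- q))
    + q ^ (- k)
        * (jtheta (- q ^ (49 + 10 * k)) (q ^ 110)
           - q ^ (1 + 2 * k) * jtheta (- q ^ (39 - 10 * k)) (q ^ 110))
        * X10 (q ^+ 2).
Proof.
move=> q k; have q0 : q != 0 by exact: epow_neq0.
have q1 : cabs q < 1 by exact: cabs_nome.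
rewrite nstring_funE // -/q -/k (srow_mock q0 q1 k).
have q22 : cabs (q ^ 22) < 1 by apply: cabs_qz_lt1.
have qz n := expfz_neq0 n q0.
have -> : Jtheta 1 2 q = lau (th (q ^+ 2)) q.
  by rewrite /Jtheta expr1z -exprnP jthetaE //; exact: cabs_sqr1.
rewrite (jthetaE q22) //.
(* The theta functions with - 10 k in their argument are Gaussian sums whose linear coefficient has
   the opposite sign; the substitution of - k for the summation index restores it. *)
have flip (x y : int) : x - 55 = - y -> jtheta (- q ^ x) (q ^ 110) = gsum q y.
  by move=> /(jtheta_gsum q0 q1) ->; rewrite gsum_opp.
have g1 : jtheta (- q ^ (16 + 10 * k)) (q ^ 110) = gsum q (10 * k - 39).
  by apply: (jtheta_gsum q0 q1); ring.
have g2 : jtheta (- q ^ (6 - 10 * k)) (q ^ 110) = gsum q (10 * k + 49) by apply: flip; ring.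
have g3 : jtheta (- q ^ (27 + 10 * k)) (q ^ 110) = gsum q (10 * k - 28).
  by apply: (jtheta_gsum q0 q1); ring.
have g4 : jtheta (- q ^ (17 - 10 * k)) (q ^ 110) = gsum q (10 * k + 38) by apply: flip; ring.
have g5 : jtheta (- q ^ (38 + 10 * k)) (q ^ 110) = gsum q (10 * k - 17).
  by apply: (jtheta_gsum q0 q1); ring.
have g6 : jtheta (- q ^ (28 - 10 * k)) (q ^ 110) = gsum q (10 * k + 27) by apply: flip; ring.
have g7 : jtheta (- q ^ (49 + 10 * k)) (q ^ 110) = gsum q (10 * k - 6).
  by apply: (jtheta_gsum q0 q1); ring.
have g8 : jtheta (- q ^ (39 - 10 * k)) (q ^ 110) = gsum q (10 * k + 16) by apply: flip; ring.
rewrite g1 g2 g3 g4 g5 g6 g7 g8.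
(* The statement factors the power of q of the first theta function out of each difference; the four
   exponents are split accordingly. *)
have p1 : q ^ (10 + 4 * k) = q ^ (6 - 4 * k) * q ^ (4 + 8 * k).
  by rewrite -expfzDr //; congr (_ ^ _); ring.
have p2 : q ^ (6 + 3 * k) = q ^ (3 - 3 * k) * q ^ (3 + 6 * k).
  by rewrite -expfzDr //; congr (_ ^ _); ring.
have p3 : q ^ (3 + 2 * k) = q ^ (1 - 2 * k) * q ^ (2 + 4 * k).
  by rewrite -expfzDr //; congr (_ ^ _); ring.
have p4 : q ^ (1 + k) = q ^ (- k) * q ^ (1 + 2 * k).
  by rewrite -expfzDr //; congr (_ ^ _); ring.
rewrite p1 p2 p3 p4.
move: (gsum q (10 * k - 39)) (gsum q (10 * k + 49)) (gsum q (10 * k - 28)) (gsum q (10 * k + 38)).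
move: (gsum q (10 * k - 17)) (gsum q (10 * k + 27)) (gsum q (10 * k - 6)) (gsum q (10 * k + 16)).
move: (lau (th (q ^+ 2)) q) (lau (th (q ^ 22)) _).
move: (phi10 (- q)) (psi10 (- q)) (chi10 _) (X10 _).
move: (q ^ (6 - 4 * k)) (q ^ (3 - 3 * k)) (q ^ (1 - 2 * k)) (q ^ (- k)).
move: (q ^ (4 + 8 * k)) (q ^ (3 + 6 * k)) (q ^ (2 + 4 * k)) (q ^ (1 + 2 * k)).
by move: (q ^ (k ^+ 2 - 3 * k + 1)) => *; ring.
Qed.
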